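(* Let $k\geq 1$ be an odd integer. For a complex number $q$ with $|q|<1$ we have $$\sum_{n=0}^\infty \frac{q^{2n+1}\,P^o_{4k-2}(q^{2n+1})}{(1-q^{2(2n+1)})^{2k}}-T_{2k}(\tau)=q^{k}\,d_k\prod_{n=1}^\infty\frac{(1-q^{4n})^{4k}}{(1-q^{4n-2})^{4k}},$$ where $$P^o_{4k-2}(z)=(1+z)^{2k}P^e_{2k-2}(z)-2^{2k-1}zP^e_{2k-2}(z^2)$$ is a polynomial of degree $4k-2$ with integer coefficients, where $P^e_{2k-2}(z)$ is the polynomial $$P^e_{2k-2}(z)=\sum_{l=1}^{2k-1}(-1)^l b_k(l)z^{l-1},\qquad b_k(l)=\sum_{m=0}^{2k-1}(-1)^m a_k(m)\binom{2k-m-1}{l},$$ $$a_k(m)=\sum_{j=0}^{2k-1}j!\,(-1)^j S(2k-1,j)\binom{j}{m},$$ and $T_{2k}(\tau)\in\mathcal{S}_{2k}(\Gamma_0(4))$; thus $T_{2k}(\tau)\to 0$ as $q\to 1$, where the limit is taken from inside the unit disk. In other words, this result gives a $q$-analogue of Euler's formula $$\zeta(2k)=\frac{(-1)^{k+1}2^{2k}B_{2k}\pi^{2k}}{2(2k)!}$$ for $\zeta(2k)$ with $k$ odd.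
   Context: Here $q=e^{2\pi i\tau}$ with $\tau$ in the complex upper half-plane. $S(n,j)$ denotes the Stirling number of the second kind, the number of ways of partitioning a set of $n$ objects into $j$ non-empty subsets. Binomial coefficients $\binom{a}{b}$ with integers $0\le a<b$ are $0$. $B_{2k}$ is the $2k$-th Bernoulli number, $\zeta$ is the Riemann zeta function, and $$d_k=-\frac{(-16)^k B_{2k}(4^k-1)}{8k}\in\mathbb{Q}.$$ $\Gamma_0(4)$ is the subgroup of $SL_2(\mathbb{Z})$ of matrices $\begin{pmatrix}a&b\\c&d\end{pmatrix}$ with $c\equiv 0\pmod 4$, and $\mathcal{S}_{2k}(\Gamma_0(4))$ is the space of weight $2k$ cusp forms on $\Gamma_0(4)$. The function $T_{2k}(\tau)$ is uniquely determined as the difference of a $q$-series and a $q$-product: for $k$ odd, $$T_{2k}(\tau)=\sum_{n=0}^\infty \frac{q^{2n+1}\,P^o_{4k-2}(q^{2n+1})}{(1-q^{4n+2})^{2k}}-q^{k}d_k\prod_{n=1}^\infty\frac{(1-q^{4n})^{4k}}{(1-q^{4n-2})^{4k}}.$$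
   Formalization: The limit T_{2k}→0 as q→1 is proved nontangentially, in every region |1−q| ≤ M(1−|q|) (so also radially); over all |q|<1 it fails, e.g. for k=3, where T_6 = q−12q^3+… is a nonzero cusp form, unbounded along horocycles at the cusp 0. *)

(* Defs.v *)
(* Analysis over the Stdlib reals and Coquelicot's complex numbers; the finite
   combinatorics (set partitions, binomials, factorials) is MathComp's. *)
From Stdlib Require Export Reals ZArith.
From Coquelicot Require Export Coquelicot.
From mathcomp Require Export all_boot.
Export Complex.

Open Scope C_scope.
Open Scope R_scope.

(** * Arithmetic ingredients *)

Definition stirling2 (n j : nat) : nat :=
  #|[set P : {set {set 'I_n}} | partition P [set: 'I_n] & #|P| == j]|.

(* [bernoulli_seq n] is [:: B_0; ...; B_n], computed from B_0 = 1 and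
   sum_(i <= n) binomial(n + 1, i) B_i = 0 for n >= 1; in particular
   B_1 = -1/2. *)
Fixpoint bernoulli_seq (n : nat) : seq R :=
  if n is m.+1 then
    let s := bernoulli_seq m in
    rcons s (- sum_n (fun i => INR 'C(m.+2, i) * nth 0 s i) m / INR m.+2)
  else [:: 1].

Definition bernoulli (n : nat) : R := nth 0 (bernoulli_seq n) n.

(* The Riemann zeta function at an integer s >= 2. *)
Definition zeta (s : nat) : R := Series (fun n => / INR n.+1 ^ s).

Definition d_coef (k : nat) : R :=
  - ((- 16) ^ k * bernoulli (2 * k)%N * (4 ^ k - 1) / (8 * INR k)).

(* Coquelicot's [sum_n u n] includes the index n. *)
Definition a_coef (k m : nat) : R :=
  sum_n (fun j => INR j`! * (-1) ^ j * INR (stirling2 (2 * k - 1)%N j)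
                  * INR 'C(j, m)) (2 * k - 1)%N.

Definition b_coef (k l : nat) : R :=
  sum_n (fun m => (-1) ^ m * a_coef k m * INR 'C(2 * k - m - 1, l)) (2 * k - 1)%N.

(* [Pe k] and [Po k] are the polynomial functions on C usually written
   P^e_{2k-2} and P^o_{4k-2}. *)
Definition Pe (k : nat) (z : C) : C :=
  sum_n_m (fun l => RtoC ((-1) ^ l * b_coef k l) * z ^ (l - 1)%N)%C 1 (2 * k - 1)%N.

Definition Po (k : nat) (z : C) : C :=
  ((1 + z) ^ (2 * k)%N * Pe k z - RtoC (2 ^ (2 * k - 1)%N) * z * Pe k (z ^ 2))%C.

Definition is_int_poly_of_degree (n : nat) (P : C -> C) : Prop :=
  exists c : nat -> Z, c n <> 0%Z /\
    forall z : C, P z = sum_n (fun i => RtoC (IZR (c i)) * z ^ i)%C n.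

(** * Complex series, products and exponential *)

Definition Cis_series (u : nat -> C) (s : C) : Prop :=
  @is_series C_AbsRing C_NormedModule u s.

(* Like Coquelicot's [Series], [CSeries] and [CProd] are total: their values
   are meaningful only when the limit exists. *)
Definition CSeries (u : nat -> C) : C :=
  @lim C_CompleteNormedModule
    (filtermap (@sum_n C_NormedModule u) eventually).

Definition Cpartial_prod (u : nat -> C) (N : nat) : C :=
  \big[Cmult/RtoC 1]_(1 <= n < N.+1) u n.

Definition Cis_prod (u : nat -> C) (p : C) : Prop :=
  filterlim (Cpartial_prod u) eventually (@locally C_UniformSpace p).

Definition CProd (u : nat -> C) : C :=
  @lim C_CompleteNormedModule (filtermap (Cpartial_prod u) eventually).

Definition Cexp (z : C) : C :=
  (exp (Re z) * cos (Im z), exp (Re z) * sin (Im z)).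

(* The nome exp(2 pi i tau). *)
Definition nome (tau : C) : C := Cexp (RtoC (2 * PI) * Ci * tau)%C.

(** * Cusp forms *)

Record SL2Z := MkSL2Z {
  m11 : Z; m12 : Z; m21 : Z; m22 : Z;
  SL2Z_det : (m11 * m22 - m12 * m21 = 1)%Z }.

Definition Gamma0 (N : Z) (g : SL2Z) : Prop := (N | m21 g)%Z.

Definition aut_factor (g : SL2Z) (tau : C) : C :=
  (RtoC (IZR (m21 g)) * tau + RtoC (IZR (m22 g)))%C.

Definition moebius (g : SL2Z) (tau : C) : C :=
  ((RtoC (IZR (m11 g)) * tau + RtoC (IZR (m12 g))) / aut_factor g tau)%C.

(* The weight w slash operator f|_w g. *)
Definition slash (w : nat) (f : C -> C) (g : SL2Z) (tau : C) : C :=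
  (f (moebius g tau) / aut_factor g tau ^ w)%C.

Definition zero_at_i_infty (f : C -> C) : Prop :=
  forall eps : R, 0 < eps ->
    exists A : R, forall tau : C, 0 < Im tau -> A < Im tau -> Cmod (f tau) < eps.

(* Holomorphic on the upper half-plane, weight w invariant under G, and
   vanishing at every cusp: the cusps are the SL2(Z)-translates of i oo. Values
   of f off the upper half-plane are irrelevant. *)
Definition cusp_form (w : nat) (G : SL2Z -> Prop) (f : C -> C) : Prop :=
  (forall tau : C, 0 < Im tau -> @ex_derive C_AbsRing C_NormedModule f tau) /\
  (forall g : SL2Z, G g -> forall tau : C, 0 < Im tau -> slash w f g tau = f tau) /\
  (forall g : SL2Z, zero_at_i_infty (slash w f g)).

(** * The functions of the theorem *)

(* n >= 0 *)
Definition series_term (k : nat) (q : C) (n : nat) : C :=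
  (q ^ (2 * n + 1)%N * Po k (q ^ (2 * n + 1)%N)
   / (1 - q ^ (2 * (2 * n + 1))%N) ^ (2 * k)%N)%C.

(* n >= 1 *)
Definition prod_term (k : nat) (q : C) (n : nat) : C :=
  ((1 - q ^ (4 * n)%N) ^ (4 * k)%N / (1 - q ^ (4 * n - 2)%N) ^ (4 * k)%N)%C.

Definition q_series (k : nat) (q : C) : C := CSeries (series_term k q).

Definition q_prod (k : nat) (q : C) : C := CProd (prod_term k q).

(* T_{2k} as a function of q, and of tau through q = exp(2 pi i tau). *)
Definition Tq (k : nat) (q : C) : C :=
  (q_series k q - q ^ k * RtoC (d_coef k) * q_prod k q)%C.

Definition T2k (k : nat) (tau : C) : C := Tq k (nome tau).

(* q -> 1 from inside the unit disk, nontangentially: within the Stolz region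
   of aperture M at 1. A nonzero cusp form has no unrestricted limit there: it
   is unbounded along the images of a point under Gamma_0(4) that accumulate
   at 0. *)
Definition within_disk_to_1 (M : R) : (C -> Prop) -> Prop :=
  within (fun q : C => Cmod q < 1 /\ Cmod (1 - q)%C <= M * (1 - Cmod q))
         (@locally C_UniformSpace (RtoC 1)).

Definition lim_to_1 (f : C -> C) (l : C) : Prop :=
  forall M : R, filterlim f (within_disk_to_1 M) (@locally C_UniformSpace l).

(* Main.v *)
(* The summand of the q-series is the sum over odd [m] of [m^(2k-1) q^(mn)], so that the series
   is an Eisenstein series F_k.  A finite q-identity, proved by telescoping, gives in the limit
   F_1 = q prod ((1 - q^(4n)) / (1 - q^(4n-2)))^4; hence T_2k = F_k - d_k F_1^k and no theta function
   is needed.  With q = exp(i pi tau), the Lipschitz formula turns F_k into the sum of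
   (-1)^j / (n tau + j)^(2k) over odd n > 0 and all integers j; after grouping neighbouring j the
   double series converges absolutely even for k = 1, and exchanging the summations gives
   F_k(-1/tau) = tau^(2k) (kappa_k + O(exp(i pi tau))) with kappa_k = d_k kappa_1^k by Euler's formula.
   Thus T_2k(-1/tau) / tau^(2k) is exponentially small and 2-periodic, and T_2k changes sign under
   tau -> tau + 1 because k is odd.  Three functions permuted up to sign by the generators of SL2(Z)
   then give the invariance and the vanishing at all cusps, and the limits q -> 1 are read off after
   the inversion.  The Lipschitz formula itself follows from Herglotz' argument: the difference of its
   two sides is bounded and satisfies 2^(2k) g(w) = g(w/2) + g((w+1)/2). *)
Require Import Defs.
From Stdlib Require Import Lra Lia.
From HB Require Import structures.
From mathcomp Require Import zify.
From mathcomp Require all_algebra ssrZ.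

(** * Series and limits of complex numbers *)

(** In weight two the Eisenstein series converges only conditionally, and a careless exchange of
    summations would create a quasimodular correction. The signs (-1)^j prevent this, since
    neighbouring terms differ by one further power of the lattice vector. The grouping they require
    is not symmetric under inversion; its mismatch telescopes, and this is what leaves the constant
    kappa_k. The number d_k is forced: it is kappa_k / kappa_1^k with kappa_1 = -1/16, so that the
    constant terms of F_k and d_k F_1^k cancel at the cusp 0. Doubling the variable turns Gamma_0(4)
    into the matrices with even off-diagonal entries, the principal group of level 2, whose three
    cusps are permuted by its quotient in SL2(Z), the symmetric group on three letters. For k odd
    both F_k and F_1^k are odd in q, so translation by 1 carries the cancellation at the cusp 0 to
    the cusp 1. Euler's formula is obtained on the way: the Laurent expansion that makes the
    Lipschitz difference bounded near 0 also has a constant term, which is compared with 2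
    zeta(2k). *)

Lemma Cis_series_unique u s t : Cis_series u s -> Cis_series u t -> s = t.
Proof.
exact (@filterlim_locally_unique nat C_AbsRing C_NormedModule eventually _
  (@sum_n C_NormedModule u) s t).
Qed.

(** The total operator [lim] is specified only through Cauchy filters, so convergence is first
    turned into the Cauchy property; uniqueness of limits then identifies the two values. *)
Lemma Clim_unique (f : nat -> C) (l : C) :
  filterlim f eventually (@locally C_UniformSpace l) ->
  @lim C_CompleteNormedModule (filtermap f eventually) = l.
Proof.
intros Hl.
pose proof (filtermap_proper_filter _ _ f eventually eventually_filter) as FF.
assert (cF : @cauchy C_UniformSpace (filtermap f eventually)).
{ intros eps; exists l; apply (Hl (@ball C_UniformSpace l eps)), locally_ball. }
pose proof (@complete_cauchy C_CompleteNormedModule _ FF cF) as H.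
refine (@filterlim_locally_unique nat C_AbsRing C_NormedModule eventually _ f _ _ _ Hl).
intros P [eps HP].
exact (filter_imp _ _ (fun n Hn => HP (f n) Hn) (H eps)).
Qed.

Lemma CSeries_unique u s : Cis_series u s -> CSeries u = s.
Proof. intros H; exact (Clim_unique _ _ H). Qed.

Lemma CProd_unique u p : Cis_prod u p -> CProd u = p.
Proof. intros H; exact (Clim_unique _ _ H). Qed.

Lemma Cis_series_ext u v s : (forall n, u n = v n) -> Cis_series u s -> Cis_series v s.
Proof. exact (@is_series_ext C_AbsRing C_NormedModule u v s). Qed.

Lemma Cis_series_plus u v s t : Cis_series u s -> Cis_series v t ->
  Cis_series (fun n => u n + v n)%C (s + t)%C.
Proof. exact (@is_series_plus C_AbsRing C_NormedModule u v s t). Qed.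

Lemma Cis_series_minus u v s t : Cis_series u s -> Cis_series v t ->
  Cis_series (fun n => u n - v n)%C (s - t)%C.
Proof. exact (@is_series_minus C_AbsRing C_NormedModule u v s t). Qed.

Lemma Cis_series_scal c u s : Cis_series u s ->
  Cis_series (fun n => c * u n)%C (c * s)%C.
Proof. exact (@is_series_scal C_AbsRing C_NormedModule c u s). Qed.

Lemma Cis_series_S u s : Cis_series u (s + u 0%N)%C -> Cis_series (fun n => u n.+1) s.
Proof. exact (@is_series_incr_1 C_AbsRing C_NormedModule u s). Qed.

Lemma Cis_series_S_inv u s : Cis_series (fun n => u n.+1) s -> Cis_series u (u 0%N + s)%C.
Proof.
intros H; apply (@is_series_decr_1 C_AbsRing C_NormedModule).
match goal with |- is_series _ ?t => replace t with s; [exact H|] end.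
unfold plus, opp; simpl; change (s = (u 0%N + s) + - u 0%N)%C; ring.
Qed.

(** * Absolutely convergent series *)

Definition Cabs_series (u : nat -> C) : Prop :=
  @ex_series R_AbsRing R_NormedModule (fun n => Cmod (u n)).

Lemma Cabs_series_CSeries u : Cabs_series u -> Cis_series u (CSeries u).
Proof.
intros H.
assert (Hs : @ex_series C_AbsRing C_NormedModule u).
{ apply (@ex_series_le C_AbsRing C_CompleteNormedModule u (fun n => Cmod (u n))); [|exact H].
  intros n; apply Rle_refl. }
destruct Hs as [s Hs]; rewrite (CSeries_unique _ _ Hs); exact Hs.
Qed.

Lemma Cabs_series_le u (M : nat -> R) : (forall n, Cmod (u n) <= M n) ->
  @ex_series R_AbsRing R_NormedModule M -> Cabs_series u.
Proof.
intros H HM; apply (@ex_series_le R_AbsRing R_CompleteNormedModule _ M); [|exact HM].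
intros n; unfold norm; simpl; unfold abs; simpl.
rewrite Rabs_pos_eq; [apply H | apply Cmod_ge_0].
Qed.

Definition Csum (u : nat -> C) (n : nat) : C := @sum_n C_AbelianMonoid u n.

Lemma Csum_O u : Csum u 0 = u 0%N.
Proof. exact (sum_O u). Qed.

Lemma Csum_S u n : Csum u n.+1 = (Csum u n + u n.+1)%C.
Proof. exact (sum_Sn u n). Qed.

Lemma Cmod_Csum (u : nat -> C) n : Cmod (Csum u n) <= sum_n (fun i => Cmod (u i)) n.
Proof.
induction n as [|n IH]; [rewrite Csum_O sum_O; apply Rle_refl|].
rewrite Csum_S sum_Sn; eapply Rle_trans; [apply Cmod_triangle|].
apply Rplus_le_compat; [exact IH|apply Rle_refl].
Qed.

(** The epsilon form over an arbitrary filter lets the same lemmas serve sequences ([eventually])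
    and approach inside the unit disk ([within_disk_to_1]). *)
Definition Clim {T : Type} (F : (T -> Prop) -> Prop) (f : T -> C) (l : C) : Prop :=
  forall eps, 0 < eps -> F (fun x => Cmod (f x - l) < eps).

Lemma filterlim_Clim {T} (F : (T -> Prop) -> Prop) {FF : Filter F} f l :
  filterlim f F (@locally C_UniformSpace l) <-> Clim F f l.
Proof.
split.
- intros H eps Heps.
  refine (H (fun y => Cmod (y - l)%C < eps) _).
  apply (@locally_le_locally_norm C_AbsRing C_NormedModule l).
  exists (mkposreal eps Heps); intros y Hy; exact Hy.
- intros H P HP.
  destruct (@locally_norm_le_locally C_AbsRing C_NormedModule l P HP) as [eps Hn].
  apply (filter_imp _ _ (fun x Hx => Hn (f x) Hx)), H, eps.
Qed.

Lemma Cis_series_Clim u s : Cis_series u s <-> Clim eventually (Csum u) s.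
Proof. exact (filterlim_Clim eventually (Csum u) s). Qed.

Lemma Clim_Cmod_le {T} (F : (T -> Prop) -> Prop) {FF : ProperFilter F} f l M :
  Clim F f l -> F (fun x => Cmod (f x) <= M) -> Cmod l <= M.
Proof.
intros H HM; apply Rnot_lt_le; intros Hl.
assert (e : 0 < Cmod l - M) by lra.
destruct (filter_ex _ (filter_and _ _ HM (H _ e))) as [x [Hx1 Hx2]].
assert (Cmod l <= Cmod (f x) + Cmod (f x - l)); [|lra].
replace l with (f x + - (f x - l))%C at 1 by ring.
rewrite <- (Cmod_opp (f x - l)); apply Cmod_triangle.
Qed.

Lemma sum_n_le_Series (a : nat -> R) n : (forall i, 0 <= a i) -> ex_series a ->
  sum_n a n <= Series a.
Proof.
intros Ha He; rewrite (Series_incr_n a n.+1 (Nat.lt_0_succ n) He).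
rewrite sum_n_Reals; change (n.+1.-1) with n.
assert (0 <= Series (fun k => a (n.+1 + k)%coq_nat)); [|lra].
rewrite <- (Rmult_0_l (Series (fun _ => 0))), <- Series_scal_l.
apply Series_le; [intros k; split; [lra|]|].
- rewrite Rmult_0_l; apply Ha.
- apply (ex_series_incr_n a n.+1), He.
Qed.

Lemma Cmod_CSeries_le u : Cabs_series u -> Cmod (CSeries u) <= Series (fun n => Cmod (u n)).
Proof.
intros H; pose proof (Cabs_series_CSeries _ H) as Hs; apply Cis_series_Clim in Hs.
apply (Clim_Cmod_le _ _ _ _ Hs); apply filter_forall; intros n.
eapply Rle_trans; [apply Cmod_Csum|]; apply sum_n_le_Series; [|exact H].
intros i; apply Cmod_ge_0.
Qed.

Lemma Cis_series_Cmod_le u s (M : nat -> R) : Cis_series u s -> (forall n, Cmod (u n) <= M n) ->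
  ex_series M -> Cmod s <= Series M.
Proof.
intros Hs HM He.
pose proof (Cabs_series_le _ _ HM He) as Ha.
rewrite <- (CSeries_unique _ _ Hs); eapply Rle_trans; [apply Cmod_CSeries_le, Ha|].
apply Series_le; [intros n; split; [apply Cmod_ge_0|apply HM]|exact He].
Qed.

Lemma Clim_ext {T} (F : (T -> Prop) -> Prop) {FF : Filter F} f g l :
  F (fun x => f x = g x) -> Clim F f l -> Clim F g l.
Proof.
intros H Hf eps Heps; generalize (filter_and _ _ H (Hf eps Heps)); apply filter_imp.
intros x [<- Hx]; exact Hx.
Qed.

Lemma Clim_const {T} (F : (T -> Prop) -> Prop) {FF : Filter F} l : Clim F (fun _ => l) l.
Proof.
intros eps Heps; apply filter_forall; intros _.
replace (l - l)%C with (RtoC 0) by ring; rewrite Cmod_0; exact Heps.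
Qed.

Lemma Clim_plus {T} (F : (T -> Prop) -> Prop) {FF : Filter F} f g l m :
  Clim F f l -> Clim F g m -> Clim F (fun x => f x + g x)%C (l + m)%C.
Proof.
intros Hf Hg eps Heps.
assert (h2 : 0 < eps / 2) by lra.
generalize (filter_and _ _ (Hf _ h2) (Hg _ h2)); apply filter_imp; intros x [H1 H2].
replace (f x + g x - (l + m))%C with ((f x - l) + (g x - m))%C by ring.
eapply Rle_lt_trans; [apply Cmod_triangle|lra].
Qed.

Lemma Clim_opp {T} (F : (T -> Prop) -> Prop) {FF : Filter F} f l :
  Clim F f l -> Clim F (fun x => - f x)%C (- l)%C.
Proof.
intros Hf eps Heps; generalize (Hf _ Heps); apply filter_imp; intros x H1.
replace (- f x - - l)%C with (- (f x - l))%C by ring; rewrite Cmod_opp; exact H1.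
Qed.

Lemma Clim_mult {T} (F : (T -> Prop) -> Prop) {FF : Filter F} f g l m :
  Clim F f l -> Clim F g m -> Clim F (fun x => f x * g x)%C (l * m)%C.
Proof.
intros Hf Hg eps Heps.
pose proof (Cmod_ge_0 l) as L0; pose proof (Cmod_ge_0 m) as M0.
set (d := Rmin 1 (eps / (2 + Cmod l + Cmod m))).
assert (D : 0 < d) by (apply Rmin_glb_lt; [lra|apply Rdiv_lt_0_compat; lra]).
assert (D1 : d <= 1) by apply Rmin_l.
assert (D2 : d * (2 + Cmod l + Cmod m) <= eps).
{ apply Rle_trans with (eps / (2 + Cmod l + Cmod m) * (2 + Cmod l + Cmod m)).
  - apply Rmult_le_compat_r; [lra|apply Rmin_r].
  - right; field; lra. }
generalize (filter_and _ _ (Hf _ D) (Hg _ D)); apply filter_imp; intros x [H1 H2].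
replace (f x * g x - l * m)%C with ((f x - l) * (g x - m) + l * (g x - m) + (f x - l) * m)%C by ring.
eapply Rle_lt_trans; [apply Cmod_triangle|].
eapply Rle_lt_trans; [apply Rplus_le_compat_r, Cmod_triangle|]; rewrite !Cmod_mult.
pose proof (Cmod_ge_0 (f x - l)) as A0; pose proof (Cmod_ge_0 (g x - m)) as B0.
nra.
Qed.

Lemma Clim_pow {T} (F : (T -> Prop) -> Prop) {FF : Filter F} f l n :
  Clim F f l -> Clim F (fun x => f x ^ n)%C (l ^ n)%C.
Proof.
intros H; induction n as [|n IH]; [exact (Clim_const F (RtoC 1))|].
exact (Clim_mult _ _ _ _ _ H IH).
Qed.

Lemma Clim_uniq {T} (F : (T -> Prop) -> Prop) {FF : ProperFilter F} f l m :
  Clim F f l -> Clim F f m -> l = m.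
Proof.
intros Hl Hm.
assert (H : Clim F (fun _ : T => RtoC 0) (l - m)%C).
{ apply (Clim_ext F (fun x => f x - f x)%C); [apply filter_forall; intros x; ring|].
  apply (Clim_plus F); [exact Hl|apply (Clim_opp F), Hm]. }
assert (H0 : Cmod (l - m) <= 0).
{ apply (Clim_Cmod_le _ _ _ _ H); apply filter_forall; intros _; rewrite Cmod_0; apply Rle_refl. }
replace l with ((l - m) + m)%C by ring; rewrite (Cmod_eq_0 (l - m)); [ring|].
apply Rle_antisym; [exact H0|apply Cmod_ge_0].
Qed.

Lemma Clim_squeeze {T} (F : (T -> Prop) -> Prop) {FF : Filter F} f l (g : T -> R) :
  F (fun x => Cmod (f x - l) <= g x) -> (forall eps, 0 < eps -> F (fun x => g x < eps)) ->
  Clim F f l.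
Proof.
intros H Hg eps Heps; generalize (filter_and _ _ H (Hg _ Heps)); apply filter_imp.
intros x [H1 H2]; lra.
Qed.

(** * Dominated convergence and exchange of summations *)

Lemma Series_tail_small (M : nat -> R) eps : ex_series M -> 0 < eps ->
  exists N, Rabs (Series M - sum_n M N) < eps.
Proof.
intros He Heps; pose proof (Series_correct _ He) as Hs.
assert (Hl : locally (Series M) (fun y => Rabs (Series M - y) < eps)).
{ exists (mkposreal eps Heps); intros y Hy.
  rewrite Rabs_minus_sym; exact Hy. }
destruct (Hs _ Hl) as [N HN]; exists N; apply HN; lia.
Qed.

(** Dominated convergence for series. A single cut-off [N], chosen from the majorant alone, makes
    the tails of all the series small at once; the finite head converges term by term. *)
Lemma tannery {T} (F : (T -> Prop) -> Prop) {FF : Filter F}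
  (f : T -> nat -> C) (l : nat -> C) (M : nat -> R) (s : T -> C) (s' : C) :
  (forall n, Clim F (fun x => f x n) (l n)) ->
  F (fun x => forall n, Cmod (f x n) <= M n) ->
  (forall n, Cmod (l n) <= M n) -> ex_series M ->
  F (fun x => Cis_series (f x) (s x)) -> Cis_series l s' ->
  Clim F s s'.
Proof.
intros Hf HM HlM He Hs Hs' eps Heps.
assert (e4 : 0 < eps / 4) by lra.
destruct (Series_tail_small M _ He e4) as [N HN].
assert (M0 : forall n, 0 <= M n) by (intros n; eapply Rle_trans; [apply Cmod_ge_0|apply HlM]).
assert (tail : forall u t, (forall n, Cmod (u n) <= M n) -> Cis_series u t ->
  Cmod (t - Csum u N) <= eps / 4).
{ intros u t Hu Ht; apply Cis_series_Clim in Ht.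
  apply (Clim_Cmod_le eventually (fun n => Csum u n - Csum u N)%C).
  { apply (Clim_plus eventually); [exact Ht|apply (Clim_const eventually)]. }
  exists N; intros n Hn.
  apply Rle_trans with (sum_n M n - sum_n M N).
  - assert (Hk : exists k, n = (N + k)%coq_nat) by (exists (n - N)%coq_nat; lia).
    destruct Hk as [k ->]; clear Hn; induction k as [|k IH].
    + rewrite Nat.add_0_r; replace (Csum u N - Csum u N)%C with (RtoC 0) by ring.
      rewrite Cmod_0; lra.
    + rewrite Nat.add_succ_r Csum_S sum_Sn.
      replace (Csum u (N + k)%coq_nat + u (N + k)%coq_nat.+1 - Csum u N)%C
        with ((Csum u (N + k)%coq_nat - Csum u N) + u (N + k)%coq_nat.+1)%C by ring.
      eapply Rle_trans; [apply Cmod_triangle|].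
      change (plus ?a ?b) with (a + b).
      specialize (Hu (N + k)%coq_nat.+1); lra.
  - pose proof (sum_n_le_Series M n M0 He).
    apply Rabs_def2 in HN; lra. }
assert (Hfin : Clim F (fun x => Csum (f x) N) (Csum l N)).
{ clear -Hf FF; induction N as [|N IH].
  - apply (Clim_ext F (fun x => f x 0%N)); [apply filter_forall; intros x; now rewrite Csum_O|].
    rewrite Csum_O; apply Hf.
  - apply (Clim_ext F (fun x => Csum (f x) N + f x N.+1)%C);
      [apply filter_forall; intros x; now rewrite Csum_S|].
    rewrite Csum_S; apply (Clim_plus F); [exact IH|apply Hf]. }
generalize (filter_and _ _ (filter_and _ _ HM Hs) (Hfin _ e4)); apply filter_imp.
intros x [[H1 H2] H3].
pose proof (tail _ _ H1 H2) as T1; pose proof (tail _ _ HlM Hs') as T2.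
replace (s x - s')%C with ((s x - Csum (f x) N) + (Csum (f x) N - Csum l N) - (s' - Csum l N))%C by ring.
eapply Rle_lt_trans; [apply Cmod_triangle|]; rewrite Cmod_opp.
eapply Rle_lt_trans; [apply Rplus_le_compat_r, Cmod_triangle|]; lra.
Qed.

Lemma Cis_series_Csum (f : nat -> nat -> C) (s : nat -> C) N :
  (forall j, Cis_series (fun i => f i j) (s j)) ->
  Cis_series (fun i => Csum (f i) N) (Csum s N).
Proof.
intros H; induction N as [|N IH].
- rewrite Csum_O; apply (Cis_series_ext (fun i => f i 0%N)); [|apply H].
  intros i; now rewrite Csum_O.
- rewrite Csum_S; apply (Cis_series_ext (fun i => Csum (f i) N + f i N.+1)%C).
  + intros i; now rewrite Csum_S.
  + apply Cis_series_plus; [exact IH|apply H].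
Qed.

(** Dominated convergence applied to partial sums over the columns: row [i] is dominated by [M i]
    however many of its entries have been summed. *)
Lemma Cabs_series_fubini (a : nat -> nat -> C) (M : nat -> R) :
  (forall i, Cabs_series (a i)) ->
  (forall i, Series (fun j => Cmod (a i j)) <= M i) -> ex_series M ->
  (forall j, Cabs_series (fun i => a i j)) /\
  Cis_series (fun j => CSeries (fun i => a i j)) (CSeries (fun i => CSeries (a i))).
Proof.
intros Ha HM He.
assert (H1 : forall i j, Cmod (a i j) <= M i).
{ intros i j; eapply Rle_trans; [|apply HM].
  eapply Rle_trans; [|apply (sum_n_le_Series _ j (fun k => Cmod_ge_0 (a i k)) (Ha i))].
  destruct j as [|j]; [rewrite sum_O; apply Rle_refl|rewrite sum_Sn].
  assert (0 <= sum_n (fun k => Cmod (a i k)) j).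
  { eapply Rle_trans; [|apply (Cmod_Csum (a i))]; apply Cmod_ge_0. }
  change (plus ?x ?y) with (x + y); lra. }
assert (Hj : forall j, Cabs_series (fun i => a i j)).
{ intros j; apply (Cabs_series_le _ M); [intros i; apply H1|exact He]. }
split; [exact Hj|].
assert (HC : forall i, Cmod (CSeries (a i)) <= M i).
{ intros i; eapply Rle_trans; [apply Cmod_CSeries_le, Ha|apply HM]. }
apply Cis_series_Clim.
apply (tannery eventually (fun N i => Csum (a i) N) (fun i => CSeries (a i)) M).
- intros i; apply Cis_series_Clim, Cabs_series_CSeries, Ha.
- apply filter_forall; intros N i; eapply Rle_trans; [apply Cmod_Csum|].
  eapply Rle_trans; [|apply HM]; apply sum_n_le_Series; [|apply Ha].
  intros k; apply Cmod_ge_0.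
- exact HC.
- exact He.
- apply filter_forall; intros N; apply Cis_series_Csum; intros j.
  apply Cabs_series_CSeries, Hj.
- apply Cabs_series_CSeries, (Cabs_series_le _ M HC He).
Qed.

(** * Stirling numbers *)

(** A function with kernel [P] amounts to an injective labelling of the blocks of [P] by elements of
    ['I_x], and such labellings are counted by the falling factorial. The map [lift] is this
    correspondence. *)
Lemma card_ffun_kernel (n x : nat) (P : {set {set 'I_n}}) : partition P [set: 'I_n] ->
  #|[set f : {ffun 'I_n -> 'I_x} | preim_partition f [set: 'I_n] == P]| = (x ^_ #|P|)%N.
Proof.
move=> partP; have tiP := partition_trivIset partP; have covP := cover_partition partP.
have inP i : pblock P i \in P by apply: pblock_mem; rewrite covP inE.
pose blk i : {B | B \in P} := exist _ (pblock P i) (inP i).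
pose lift (g : {ffun {B | B \in P} -> 'I_x}) : {ffun 'I_n -> 'I_x} := [ffun i => g (blk i)].
have blk_onto B : exists i, blk i = B.
  case: B => B PB; have /set0Pn [i Bi] : B != set0 by apply: partition_neq0 partP PB.
  by exists i; apply: val_inj => /=; apply: def_pblock.
have -> : [set f : {ffun 'I_n -> 'I_x} | preim_partition f [set: 'I_n] == P]
          = lift @: [set g : {ffun {B | B \in P} -> 'I_x} | injectiveb g].
  apply/setP => f; rewrite inE; apply/eqP/imsetP.
  - move=> kf.
    have feq i j : (f i == f j) = (blk i == blk j).
      have -> : (blk i == blk j) = (pblock P i == pblock P j) by [].
      rewrite eq_pblock ?covP ?inE // -kf pblock_equivalence_partition ?inE //.
      by split=> // /eqP->.
    have blk_ex B : exists i, blk i == B by have [i <-] := blk_onto B; exists i.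
    exists [ffun B => f (xchoose (blk_ex B))].
      rewrite inE; apply/injectiveP => B1 B2; rewrite !ffunE => /eqP; rewrite feq.
      by rewrite (eqP (xchooseP (blk_ex B1))) (eqP (xchooseP (blk_ex B2))) => /eqP.
    apply/ffunP => i; rewrite !ffunE; apply/eqP; rewrite feq.
    by rewrite (eqP (xchooseP (blk_ex (blk i)))).
  - case=> g; rewrite inE => /injectiveP ginj ->.
    rewrite -[RHS](preim_partition_pblock partP).
    apply: eq_imset => i; apply/setP => j; rewrite !inE !ffunE.
    by rewrite (inj_eq ginj).
rewrite card_in_imset.
  by rewrite card_inj_ffuns card_ord card_sig.
move=> g1 g2 _ _ /ffunP eg; apply/ffunP => B; have [i <-] := blk_onto B.
by have := eg i; rewrite !ffunE.
Qed.

(** All functions from an [n]-set to an [x]-set are sorted by their kernel, and the kernels by their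
    number of blocks. Only here is the counting definition of the Stirling numbers opened. *)
Lemma expn_stirling2 (n x : nat) : (x ^ n = \sum_(j < n.+1) stirling2 n j * x ^_ j)%N.
Proof.
have -> : (x ^ n = #|{ffun 'I_n -> 'I_x}|)%N by rewrite card_ffun !card_ord.
rewrite -sum1_card.
rewrite (partition_big (fun f : {ffun 'I_n -> 'I_x} => preim_partition f [set: 'I_n])
           (fun P : {set {set 'I_n}} => partition P [set: 'I_n])) /=; last by move=> f _; apply: preim_partitionP.
have cP (P : {set {set 'I_n}}) : partition P [set: 'I_n] -> (#|P| < n.+1)%N.
  move=> partP; rewrite ltnS.
  apply: (@leq_trans (\sum_(A in P) #|A|)%N); last first.
    by rewrite -(card_partition partP) cardsT card_ord.
  rewrite -sum1_card; apply: leq_sum => A PA; rewrite card_gt0.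
  exact: partition_neq0 partP PA.
rewrite (partition_big (fun P : {set {set 'I_n}} => inord #|P| : 'I_n.+1) xpredT) //=.
apply: eq_bigr => j _; rewrite /stirling2 -sum1_card big_distrl /=.
apply: eq_big => [P|P /andP [partP /eqP Pj]].
  rewrite inE; case partP : (partition P _) => //=.
  by rewrite -val_eqE /= inordK ?cP.
have -> : nat_of_ord j = #|P| by rewrite -Pj inordK ?cP.
rewrite mul1n -(card_ffun_kernel n x P partP) -sum1_card.
by apply: eq_bigl => f; rewrite inE.
Qed.

(** * The Eulerian identity *)

Lemma RtoC_m1 : RtoC (-1) = (- (1))%C.
Proof. rewrite -RtoC_opp; f_equal; ring. Qed.

Lemma Cpow_addn (c : C) (m n : nat) : (c ^ (m + n)%N = c ^ m * c ^ n)%C.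
Proof. rewrite -plusE; apply Cpow_add_r. Qed.

Lemma Cpow_muln (c : C) (m n : nat) : (c ^ (m * n)%N = (c ^ m) ^ n)%C.
Proof. rewrite -multE; apply Cpow_mult_r. Qed.

Lemma Csum_ext u v n : (forall i, (i <= n)%N -> u i = v i) -> Csum u n = Csum v n.
Proof.
induction n as [|n IH]; intros H; [rewrite !Csum_O; apply H; lia|].
rewrite !Csum_S (H n.+1); [|lia]; f_equal; apply IH; intros i Hi; apply H; lia.
Qed.

Lemma Csum_plus u v n : Csum (fun i => u i + v i)%C n = (Csum u n + Csum v n)%C.
Proof. induction n as [|n IH]; [now rewrite !Csum_O|rewrite !Csum_S IH; ring]. Qed.

Lemma Csum_scal c u n : Csum (fun i => c * u i)%C n = (c * Csum u n)%C.
Proof. induction n as [|n IH]; [now rewrite !Csum_O|rewrite !Csum_S IH; ring]. Qed.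

Lemma Csum_swap (u : nat -> nat -> C) n m :
  Csum (fun i => Csum (u i) m) n = Csum (fun j => Csum (fun i => u i j) n) m.
Proof.
induction n as [|n IH].
- rewrite Csum_O; apply Csum_ext; intros j _; now rewrite Csum_O.
- rewrite Csum_S IH -Csum_plus; apply Csum_ext; intros j _; now rewrite Csum_S.
Qed.

Lemma RtoC_sum_n (f : nat -> R) n : RtoC (sum_n f n) = Csum (fun i => RtoC (f i)) n.
Proof.
induction n as [|n IH]; [now rewrite sum_O Csum_O|].
rewrite sum_Sn Csum_S -IH -RtoC_plus; reflexivity.
Qed.

Lemma RtoC_INR_big_ord (f : nat -> nat) n :
  RtoC (INR (\sum_(j < n.+1) f j)%N) = Csum (fun j => RtoC (INR (f j))) n.
Proof.
induction n as [|n IH]; [now rewrite big_ord1 Csum_O|].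
rewrite big_ord_recr /= Csum_S -IH -RtoC_plus -plus_INR; reflexivity.
Qed.

Lemma INR_expn m n : INR (m ^ n)%N = INR m ^ n.
Proof.
induction n as [|n IH]; [reflexivity|].
now rewrite expnS mulnE mult_INR IH.
Qed.

(** The upper index [N] may exceed [j], the extra binomials being zero, so that expansions for
    different [j] share one range and double sums can be swapped. *)
Lemma Cbinom z j N : (j <= N)%N ->
  ((1 + z) ^ j)%C = Csum (fun m => RtoC (INR 'C(j, m)) * z ^ m)%C N.
Proof.
(* Pascal's rule for a truncated sum; the correction term at [N] vanishes once [j < N]. *)
assert (step : forall j N, Csum (fun m => RtoC (INR 'C(j.+1, m)) * z ^ m)%C N =
  ((1 + z) * Csum (fun m => RtoC (INR 'C(j, m)) * z ^ m) N - RtoC (INR 'C(j, N)) * z ^ N.+1)%C).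
{ intros i M; induction M as [|M IH]; [rewrite !Csum_O !bin0; simpl; ring|].
  rewrite !Csum_S IH binS addnE plus_INR RtoC_plus !Cpow_S; ring. }
revert N; induction j as [|j IH]; intros N HN.
- clear; induction N as [|N IH]; [rewrite Csum_O bin0; simpl; ring|].
  rewrite Csum_S -IH bin0n; simpl; ring.
- rewrite step bin_small; [|exact HN]; rewrite -IH; [|lia]; simpl; ring.
Qed.

(** * Powers against geometric decay, and generating series *)

Lemma pow_geom_bound p r : 0 <= r < 1 ->
  exists rho K, r < rho < 1 /\ 0 < K /\ forall n, INR n ^ p * r ^ n <= K * rho ^ n.
Proof.
intros Hr; induction p as [|p [rho [K [H1 [HK H2]]]]].
- exists ((1 + r) / 2), 1; split; [lra|split; [lra|]]; intros n; rewrite !Rmult_1_l.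
  apply pow_incr; lra.
- set (rho' := (1 + rho) / 2); set (th := rho / rho').
  assert (Hth : 0 < th < 1).
  { unfold th, rho'; split; [apply Rdiv_lt_0_compat; lra|].
    apply (Rmult_lt_reg_r ((1 + rho) / 2)); [lra|].
    unfold Rdiv at 1; rewrite Rmult_assoc Rinv_l; lra. }
  (* The product [n th^n] is at most the geometric sum [1 + th + ... + th^(n-1)], so one factor [n]
     is absorbed by enlarging the ratio from [rho] to [rho']. *)
  assert (Hn : forall n, INR n * th ^ n <= / (1 - th)).
  { intros n; apply Rle_trans with ((1 - th ^ n) / (1 - th)).
    - apply (Rmult_le_reg_r (1 - th)); [lra|].
      unfold Rdiv; rewrite !Rmult_assoc Rinv_l; [|lra]; rewrite Rmult_1_r.
      induction n as [|n IH]; [simpl; lra|].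
      rewrite S_INR; change (th ^ n.+1) with (th * th ^ n).
      pose proof (pow_lt th n (proj1 Hth)).
      apply Rle_trans with (th * (INR n * (th ^ n * (1 - th))) + th * th ^ n * (1 - th)); [right; ring|].
      assert (th ^ n <= 1) by (rewrite -(pow1 n); apply pow_incr; lra).
      apply Rle_trans with (th * (1 - th ^ n) + th * th ^ n * (1 - th)); [nra|].
      assert (th * th ^ n <= 1) by nra; nra.
    - unfold Rdiv; pose proof (pow_lt th n (proj1 Hth)).
      pose proof (Rinv_0_lt_compat (1 - th)); nra. }
  exists rho', (K * / (1 - th)); split; [unfold rho'; lra|split].
  { apply Rmult_lt_0_compat; [lra|apply Rinv_0_lt_compat; lra]. }
  intros n; change (INR n ^ p.+1) with (INR n * INR n ^ p).
  replace rho with (th * rho') in H2 by (unfold th, rho'; field; lra).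
  specialize (H2 n); specialize (Hn n); rewrite Rpow_mult_distr in H2.
  pose proof (pos_INR n); pose proof (pow_lt rho' n).
  apply Rle_trans with (INR n * (K * (th ^ n * rho' ^ n))); [nra|].
  apply Rle_trans with (K * (INR n * th ^ n) * rho' ^ n); [right; ring|].
  apply Rmult_le_compat_r; [apply Rlt_le, H0; unfold rho'; lra|].
  apply Rmult_le_compat_l; [lra|exact Hn].
Qed.

Lemma ex_series_pow_geom p r : 0 <= r < 1 -> ex_series (fun n => INR n ^ p * r ^ n).
Proof.
intros Hr; destruct (pow_geom_bound p r Hr) as [rho [K [H1 [HK H2]]]].
apply (@ex_series_le R_AbsRing R_CompleteNormedModule _ (fun n => K * rho ^ n)).
- intros n; unfold norm; simpl; unfold abs; simpl; rewrite Rabs_pos_eq; [apply H2|].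
  apply Rmult_le_pos; apply pow_le; [apply pos_INR|lra].
- apply (@ex_series_scal_l R_AbsRing R_NormedModule), ex_series_geom; rewrite Rabs_pos_eq; lra.
Qed.

Lemma one_minus_neq0 x : Cmod x < 1 -> (1 - x)%C <> RtoC 0.
Proof.
intros H E; replace x with (1 - (1 - x))%C in H by ring; rewrite E in H.
replace (1 - 0)%C with (RtoC 1) in H by ring; rewrite Cmod_1 in H; lra.
Qed.

Lemma Cmod_pow_lt1 x n : Cmod x < 1 -> (0 < n)%N -> Cmod (x ^ n)%C < 1.
Proof.
intros H Hn; rewrite Cmod_pow; apply pow_lt_1_compat; [split; [apply Cmod_ge_0|exact H]|lia].
Qed.


Lemma bin_leq_expn m i : ('C(m, i) <= m ^ i)%N.
Proof.
apply: (@leq_trans ('C(m, i) * i`!)%N); first by rewrite leq_pmulr ?fact_gt0.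
rewrite bin_ffact; elim: i => [|i IH]; first by rewrite ffactn0.
by rewrite ffactnSr expnSr leq_mul // leq_subr.
Qed.

Lemma Cmult_cancel_l a b c : a <> RtoC 0 -> (a * b = a * c)%C -> b = c.
Proof.
intros Ha H; replace b with (/ a * (a * b))%C by (field; exact Ha).
rewrite H; field; exact Ha.
Qed.

(** Summing Pascal's rule against powers of [x] gives [b = x (b + b')] between the sums [b] for
    [j + 1] and [b'] for [j], which determines [b]; the case [j = 0] is the geometric series. *)
Lemma Cis_series_binomial x j : Cmod x < 1 ->
  Cis_series (fun m => RtoC (INR 'C(m, j)) * x ^ m)%C (x ^ j / (1 - x) ^ j.+1)%C.
Proof.
intros Hx; pose proof (one_minus_neq0 x Hx) as Hx1.
assert (Hex : forall j, exists b, Cis_series (fun m => RtoC (INR 'C(m, j)) * x ^ m)%C b).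
{ intros i; eexists; apply Cabs_series_CSeries.
  apply (Cabs_series_le _ (fun m => INR m ^ i * Cmod x ^ m)).
  - intros m; rewrite Cmod_mult Cmod_R Cmod_pow Rabs_pos_eq; [|apply pos_INR].
    apply Rmult_le_compat_r; [apply pow_le, Cmod_ge_0|].
    rewrite -INR_expn; apply le_INR; pose proof (bin_leq_expn m i); lia.
  - apply ex_series_pow_geom; split; [apply Cmod_ge_0|exact Hx]. }
assert (shift : forall u b, Cis_series u b -> Cis_series (fun m => u m.+1) (b - u 0%N)%C).
{ intros u b H; apply Cis_series_S; replace (b - u 0%N + u 0%N)%C with b by ring; exact H. }
induction j as [|j IH].
- destruct (Hex 0%N) as [b Hb]; pose proof (shift _ _ Hb) as H1.
  pose proof (Cis_series_scal x _ _ Hb) as H2.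
  assert (E : (x * b = b - 1)%C).
  { replace (b - 1)%C with (b - RtoC (INR 'C(0, 0)) * x ^ 0)%C by (rewrite bin0; simpl; ring).
    apply (Cis_series_unique _ _ _ H2); refine (Cis_series_ext _ _ _ _ H1); intros m.
    rewrite !bin0; simpl; ring. }
  replace (x ^ 0 / (1 - x) ^ 1)%C with b; [exact Hb|].
  apply (Cmult_cancel_l (1 - x)%C); [exact Hx1|].
  transitivity (b - x * b)%C; [ring|]; rewrite E; simpl; field; exact Hx1.
- destruct (Hex j.+1) as [b Hb]; pose proof (shift _ _ Hb) as H1.
  pose proof (Cis_series_scal x _ _ (Cis_series_plus _ _ _ _ Hb IH)) as H2.
  assert (E : (x * (b + x ^ j / (1 - x) ^ j.+1) = b)%C).
  { replace b with (b - RtoC (INR 'C(0, j.+1)) * x ^ 0)%C at 2 by (simpl; ring).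
    apply (Cis_series_unique _ _ _ H2); refine (Cis_series_ext _ _ _ _ H1); intros m.
    rewrite binS addnE plus_INR RtoC_plus Cpow_S; ring. }
  replace (x ^ j.+1 / (1 - x) ^ j.+2)%C with b; [exact Hb|].
  apply (Cmult_cancel_l (1 - x)%C); [exact Hx1|].
  transitivity (b - x * b)%C; [ring|]; rewrite -{1}E; simpl.
  field; repeat split; try apply Cpow_nz; exact Hx1.
Qed.

Lemma Csum_S_l u n : Csum u n.+1 = (u 0%N + Csum (fun i => u i.+1) n)%C.
Proof.
induction n as [|n IH]; [now rewrite Csum_S !Csum_O|].
rewrite Csum_S IH Csum_S; ring.
Qed.

Lemma Cis_series_pow_stirling2 n x : Cmod x < 1 ->
  Cis_series (fun m => RtoC (INR m ^ n) * x ^ m)%C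
    (Csum (fun j => RtoC (INR (j`! * stirling2 n j)%N) * (x ^ j / (1 - x) ^ j.+1))%C n).
Proof.
intros Hx.
apply (Cis_series_ext (fun m => Csum (fun j =>
   RtoC (INR (j`! * stirling2 n j)%N) * (RtoC (INR 'C(m, j)) * x ^ m))%C n)).
- intros m; rewrite -INR_expn expn_stirling2 (RtoC_INR_big_ord (fun j => (stirling2 n j * m ^_ j)%N)).
  rewrite Cmult_comm -Csum_scal; apply Csum_ext; intros j _.
  rewrite -bin_ffact !mulnE !mult_INR !RtoC_mult; ring.
- apply Cis_series_Csum; intros j; apply Cis_series_scal, Cis_series_binomial, Hx.
Qed.

Lemma Pe_Csum k x : (1 <= k)%N ->
  (x * Pe k x)%C = (Csum (fun l => RtoC ((-1) ^ l * b_coef k l) * x ^ l)%C (2 * k - 1)%N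
     - RtoC (b_coef k 0))%C.
Proof.
intros Hk; unfold Pe; destruct k as [|k]; [discriminate|].
replace (2 * k.+1 - 1)%N with (2 * k).+1 by lia.
generalize (2 * k)%N; intros n; rewrite Csum_S_l.
assert (H : forall f : nat -> C, sum_n_m f 1 n.+1 = Csum (fun i => f i.+1) n).
{ intros f; change (Csum (fun i => f i.+1) n) with (@sum_n_m C_AbelianMonoid (fun i => f i.+1) 0 n).
  exact (Logic.eq_sym (@sum_n_m_S C_AbelianMonoid f 0 n)). }
rewrite H -Csum_scal Rmult_1_l Cmult_1_r.
match goal with |- ?a = (?b + ?c - ?d)%C => replace (b + c - d)%C with c by ring end.
apply Csum_ext; intros i _; rewrite subn1 Cpow_S /=; ring.
Qed.

(** This is where [a_coef] and [b_coef] come from. Each [x^j / (1-x)^(j+1)] is rewritten in powers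
    of [1 - x], which collects the Stirling numbers into [a_coef]; expanding those powers back in
    [x] collects the [a_coef] into [b_coef]. *)
Lemma eulerian_Csum k x : (1 <= k)%N -> Cmod x < 1 ->
  Cis_series (fun m => RtoC (INR m ^ (2 * k - 1)%N) * x ^ m)%C
    (Csum (fun l => RtoC ((-1) ^ l * b_coef k l) * x ^ l)%C (2 * k - 1)%N / (1 - x) ^ (2 * k)%N)%C.
Proof.
intros Hk Hx; pose proof (one_minus_neq0 x Hx) as Hx1.
set (n := (2 * k - 1)%N); assert (En : (2 * k)%N = n.+1) by (unfold n; lia).
match goal with |- Cis_series _ ?s =>
  replace s with (Csum (fun j => RtoC (INR (j`! * stirling2 n j)%N) * (x ^ j / (1 - x) ^ j.+1))%C n) end.
{ apply Cis_series_pow_stirling2, Hx. }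
apply (Cmult_cancel_l ((1 - x) ^ n.+1)%C); [apply Cpow_nz, Hx1|].
rewrite En; transitivity (Csum (fun l => RtoC ((-1) ^ l * b_coef k l) * x ^ l)%C n);
  [|field; apply Cpow_nz, Hx1].
rewrite -Csum_scal.
transitivity (Csum (fun m => RtoC ((-1) ^ m * a_coef k m) * (1 - x) ^ (n - m)%N)%C n).
- unfold a_coef; fold n.
  transitivity (Csum (fun j => Csum (fun m => RtoC ((-1) ^ m) *
     RtoC (INR j`! * (-1) ^ j * INR (stirling2 n j) * INR 'C(j, m)) * (1 - x) ^ (n - m)%N)%C n) n).
  + apply Csum_ext; intros j Hj.
    (* In this form the binomial formula expands [x^j] in powers of [1 / (1 - x)]. *)
    assert (Ex : (x = - (1 - x) * (1 + - / (1 - x)))%C) by (field; exact Hx1).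
    rewrite {2}Ex Cpow_mult_l (Cbinom _ j n Hj).
    transitivity (Csum (fun m => (RtoC (INR (j`! * stirling2 n j)%N) * (-1) ^ j * (1 - x) ^ n) *
       (RtoC (INR 'C(j, m)) * (- / (1 - x)) ^ m))%C n).
    * rewrite Csum_scal.
      replace (- (1 - x))%C with (- (1) * (1 - x))%C by ring; rewrite Cpow_mult_l RtoC_m1; simpl.
      field; repeat split; try apply Cpow_nz; exact Hx1.
    * apply Csum_ext; intros m Hm.
      rewrite !mulnE !mult_INR !RtoC_mult !RtoC_pow.
      replace (- / (1 - x))%C with (- (1) * / (1 - x))%C by ring; rewrite Cpow_mult_l Cpow_inv; [|exact Hx1].
      replace ((1 - x) ^ n)%C with ((1 - x) ^ m * (1 - x) ^ (n - m)%N)%C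
        by (rewrite -Cpow_addn; f_equal; lia).
      rewrite RtoC_m1; field; apply Cpow_nz, Hx1.
  + rewrite Csum_swap; apply Csum_ext; intros m Hm.
    rewrite RtoC_mult RtoC_sum_n -Cmult_assoc (Cmult_comm _ ((1 - x) ^ _)%C) Cmult_assoc -Csum_scal.
    apply Csum_ext; intros j Hj; ring.
- transitivity (Csum (fun m => Csum (fun l => RtoC ((-1) ^ m * a_coef k m) *
     (RtoC (INR 'C((n - m)%N, l)) * (- x) ^ l))%C n) n).
  + apply Csum_ext; intros m Hm; rewrite Csum_scal; f_equal.
    rewrite -(Cbinom (- x) (n - m)%N n); [f_equal; ring|lia].
  + rewrite Csum_swap; apply Csum_ext; intros l Hl.
    unfold b_coef; fold n; rewrite RtoC_mult RtoC_sum_n -Cmult_assoc (Cmult_comm _ (x ^ _)%C) Cmult_assoc -Csum_scal.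
    apply Csum_ext; intros m Hm.
    replace (- x)%C with (- (1) * x)%C by ring; rewrite Cpow_mult_l !RtoC_mult !RtoC_pow RtoC_m1.
    replace (2 * k - m - 1)%N with (n - m)%N by (unfold n; lia); ring.
Qed.

Lemma Cis_series_0 u : (forall n, u n = RtoC 0) -> Cis_series u (RtoC 0).
Proof.
intros H; apply Cis_series_Clim, (Clim_ext eventually (fun _ => RtoC 0)).
- apply filter_forall; intros n; induction n as [|n IH]; [rewrite Csum_O H; reflexivity|].
  rewrite Csum_S -IH H; ring.
- apply (Clim_const eventually).
Qed.

(** At [x = 0] the series vanishes, the exponent [2k - 1] being positive, while the closed form
    reduces to [b_coef k 0]. This is why the sum in [Pe] can start at 1 with a factor [x] split
    off. *)
Lemma b_coef_0 k : (1 <= k)%N -> b_coef k 0 = 0.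
Proof.
intros Hk; apply RtoC_inj.
assert (H0 : Cmod 0 < 1) by (rewrite Cmod_0; lra).
assert (pz : forall i, (RtoC 0 ^ i.+1 = 0)%C) by (intros i; rewrite Cpow_S; ring).
pose proof (eulerian_Csum k (RtoC 0) Hk H0) as H.
assert (E : Cis_series (fun m => RtoC (INR m ^ (2 * k - 1)%N) * RtoC 0 ^ m)%C (RtoC 0)).
{ apply Cis_series_0; intros [|m]; [|rewrite pz; ring].
  replace (2 * k - 1)%N with (2 * k - 2).+1 by lia; simpl; rewrite Rmult_0_l; ring. }
pose proof (Cis_series_unique _ _ _ H E) as U; clear -U Hk pz.
replace (2 * k - 1)%N with (2 * k - 2).+1 in U by lia.
rewrite Csum_S_l in U.
replace (1 - 0)%C with (RtoC 1) in U by ring; rewrite Cpow_1_l in U.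
assert (Z : Csum (fun i => RtoC ((-1) ^ i.+1 * b_coef k i.+1) * RtoC 0 ^ i.+1)%C (2 * k - 2)%N = RtoC 0).
{ rewrite (Csum_ext _ (fun _ => RtoC 0 * RtoC 0)%C); [rewrite Csum_scal; ring|].
  intros i _; rewrite pz; ring. }
rewrite Z in U; simpl in U; rewrite Rmult_1_l in U.
transitivity ((b_coef k 0 * 1 + 0) / 1)%C; [field|rewrite U; ring].
Qed.

Lemma eulerian k x : (1 <= k)%N -> Cmod x < 1 ->
  Cis_series (fun m => RtoC (INR m ^ (2 * k - 1)%N) * x ^ m)%C (x * Pe k x / (1 - x) ^ (2 * k)%N)%C.
Proof.
intros Hk Hx; rewrite Pe_Csum // b_coef_0 //.
replace (Csum _ _ - 0)%C with
  (Csum (fun l => RtoC ((-1) ^ l * b_coef k l) * x ^ l)%C (2 * k - 1)%N) by ring.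
exact (eulerian_Csum k x Hk Hx).
Qed.

Lemma Cis_series_pairs u s : Cis_series u s ->
  Cis_series (fun i => u (2 * i)%N + u (2 * i + 1)%N)%C s.
Proof.
rewrite !Cis_series_Clim; intros H eps Heps.
destruct (H eps Heps) as [N HN]; exists N; intros n Hn.
replace (Csum (fun i => u (2 * i)%N + u (2 * i + 1)%N)%C n) with (Csum u (2 * n + 1)%N).
{ apply HN; lia. }
clear; induction n as [|n IH]; [rewrite Csum_S !Csum_O; reflexivity|].
rewrite Csum_S -IH; replace (2 * n.+1 + 1)%N with (2 * n + 1).+2 by lia.
rewrite !Csum_S; replace (2 * n.+1)%N with (2 * n + 1).+1 by lia; ring_simplify.
replace (2 * n + 1).+1.+1 with ((2 * n + 1).+1 + 1)%N by lia; ring.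
Qed.

(** The even indices are removed: they contribute [2^(2k-1)] times the full series at [x^2]. Over
    the common denominator [(1 - x^2)^(2k)] the difference has numerator [x * Po k x], which
    explains the definition of [Po]. *)
Lemma eulerian_odd k x : (1 <= k)%N -> Cmod x < 1 ->
  Cis_series (fun i => RtoC (INR (2 * i + 1)%N ^ (2 * k - 1)%N) * x ^ (2 * i + 1)%N)%C
    (x * Po k x / (1 - x ^ 2) ^ (2 * k)%N)%C.
Proof.
intros Hk Hx.
assert (Hx2 : Cmod (x ^ 2)%C < 1) by (apply Cmod_pow_lt1; auto).
pose proof (one_minus_neq0 x Hx) as N1; pose proof (one_minus_neq0 _ Hx2) as N2.
pose proof (Cis_series_pairs _ _ (eulerian k x Hk Hx)) as H1.
pose proof (Cis_series_scal (RtoC (2 ^ (2 * k - 1)%N)) _ _ (eulerian k _ Hk Hx2)) as H2.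
pose proof (Cis_series_minus _ _ _ _ H1 H2) as H3.
match type of H3 with Cis_series _ ?t =>
  match goal with |- Cis_series _ ?s => replace s with t end end.
- refine (Cis_series_ext _ _ _ _ H3); intros i.
  replace (INR (2 * i)%N) with (2 * INR i) by (rewrite mulnE mult_INR /=; ring).
  rewrite Rpow_mult_distr RtoC_mult Cpow_muln; ring.
- assert (N3 : (1 + x)%C <> RtoC 0).
  { intros E; apply N2; transitivity ((1 - x) * (1 + x))%C; [simpl; ring|rewrite E; ring]. }
  unfold Po.
  replace (1 - x ^ 2)%C with ((1 - x) * (1 + x))%C by (simpl; ring).
  rewrite !Cpow_mult_l (Cpow_S _ 1) Cpow_1_r.
  field; split; apply Cpow_nz; assumption.
Qed.

(** * Integrality and degree of the polynomial *)

Section AlternatingStirling.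
Import all_algebra ssrZ GRing.Theory.
Local Open Scope ring_scope.

(** The expansion of powers in falling factorials holds at every natural number, hence between
    polynomials, and may be evaluated at [-1], where the falling factorial of length [j] is
    [(-1)^j j!]. *)
Lemma stirling2_alternating_int (n : nat) :
  \sum_(j < n.+1) (-1) ^+ j * (j`! * stirling2 n j)%N%:Z = (-1) ^+ n :> int.
Proof.
pose ff j : {poly int} := \prod_(i < j) ('X - (i%:Z)%:P).
have ff_nat j (x : nat) : (ff j).[x%:Z] = (x ^_ j)%:Z.
  rewrite /ff; elim: j => [|j IH]; first by rewrite big_ord0 ffactn0 hornerC.
  rewrite big_ord_recr /= hornerM IH hornerXsubC ffactnSr PoszM.
  have [jx|xj] := leqP j x; first by rewrite subzn.
  by rewrite ffact_small ?mul0r.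
have ff_m1 j : (ff j).[-1] = (-1) ^+ j * (j`!)%:Z.
  rewrite /ff; elim: j => [|j IH]; first by rewrite big_ord0 hornerC.
  rewrite big_ord_recr /= hornerM IH hornerXsubC factS PoszM exprSr.
  by rewrite -addn1 PoszD -!mulrA; congr (_ * _); rewrite mulrA mulN1r opprD addrC mulrC.
pose p : {poly int} := \sum_(j < n.+1) ((stirling2 n j)%:Z)%:P * ff j - 'X^n.
have p_nat (x : nat) : root p x%:Z.
  rewrite /root /p hornerD hornerN hornerXn horner_sum subr_eq0; apply/eqP.
  rewrite -[in RHS]natz -natrX expn_stirling2 natr_sum; apply: eq_bigr => j _.
  by rewrite hornerM hornerC ff_nat natrM !natz.
have p0 : p = 0.
  apply/eqP; apply: contraT => pn0.
  have := max_poly_roots (rs := [seq x%:Z | x <- iota 0 (size p)]) pn0.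
  rewrite size_map size_iota ltnn => -> //.
    by apply/allP => _ /mapP [x _ ->].
  by rewrite map_inj_uniq ?iota_uniq // => x y [].
have : p.[-1] = 0 by rewrite p0 horner0.
rewrite /p hornerD hornerN hornerXn horner_sum => /eqP; rewrite subr_eq0 => /eqP <-.
apply: eq_bigr => j _; rewrite hornerM hornerC ff_m1 PoszM.
by rewrite mulrA mulrC.
Qed.

Lemma IZR_Z_of_int_sign (j m : nat) :
  IZR (Z_of_int ((-1) ^+ j * m%:Z)) = Rmult (pow (IZR (Zneg 1)) j) (INR m).
Proof.
elim: j => [|j IH].
  by rewrite expr0 mul1r /= Rmult_1_l INR_IZR_INZ.
rewrite exprS -mulrA mulN1r rmorphN /= [LHS]opp_IZR IH; lra.
Qed.

Lemma IZR_Z_of_int_sum (F : nat -> int) n :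
  IZR (Z_of_int (\sum_(j < n.+1) F j)) = sum_n (fun j => IZR (Z_of_int (F j))) n.
Proof.
elim: n => [|n IH]; first by rewrite big_ord1 sum_O.
by rewrite big_ord_recr /= rmorphD /= [LHS]plus_IZR IH sum_Sn.
Qed.

Lemma stirling2_alternating_sum (n : nat) :
  sum_n (fun j => Rmult (Rmult (INR j`!) (pow (IZR (Zneg 1)) j)) (INR (stirling2 n j))) n
  = pow (IZR (Zneg 1)) n.
Proof.
have H := stirling2_alternating_int n.
rewrite -(Rmult_1_r (pow _ n)) -(IZR_Z_of_int_sign n 1) mulr1 -H.
rewrite (IZR_Z_of_int_sum (fun j => (-1) ^+ j * (j`! * stirling2 n j)%N%:Z)).
by apply: sum_n_ext => j; rewrite IZR_Z_of_int_sign -multE mult_INR; lra.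
Qed.

End AlternatingStirling.

(* [all_algebra] has bound the key [R] to its own ring scope. *)
Delimit Scope R_scope with R.

(** The prescribed coefficient [lead] in degree [n] may be zero, so that leading coefficients add
    without case distinctions; the exact degree is read off only at the end. *)
Definition int_poly_le (n : nat) (lead : Z) (P : C -> C) : Prop :=
  exists c : nat -> Z, c n = lead /\ forall z, P z = Csum (fun i => RtoC (IZR (c i)) * z ^ i)%C n.

Lemma int_poly_le_plus n a b P Q : int_poly_le n a P -> int_poly_le n b Q ->
  int_poly_le n (a + b) (fun z => P z + Q z)%C.
Proof.
intros [c [<- Hc]] [d [<- Hd]]; exists (fun i => c i + d i)%Z; split; [reflexivity|]; intros z.
rewrite Hc Hd -Csum_plus; apply Csum_ext; intros i _; rewrite plus_IZR RtoC_plus; ring.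
Qed.

Lemma int_poly_le_scal n a b P : int_poly_le n a P ->
  int_poly_le n (b * a) (fun z => RtoC (IZR b) * P z)%C.
Proof.
intros [c [<- Hc]]; exists (fun i => b * c i)%Z; split; [reflexivity|]; intros z.
rewrite Hc -Csum_scal; apply Csum_ext; intros i _; rewrite mult_IZR RtoC_mult; ring.
Qed.

Lemma int_poly_le_monomial n i : (i <= n)%N ->
  int_poly_le n (if i == n then 1 else 0)%Z (fun z => z ^ i)%C.
Proof.
intros Hi; exists (fun j => if i == j then 1 else 0)%Z; split; [reflexivity|]; intros z.
revert Hi; induction n as [|n IH]; intros Hi.
- rewrite Csum_O; destruct i as [|i]; [simpl; ring|discriminate].
- rewrite Csum_S; destruct (leqP i n) as [Hn|Hn].
  + rewrite -IH //; replace (i == n.+1) with false by lia; ring.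
  + replace i with n.+1 by lia; rewrite eqxx.
    rewrite (Csum_ext _ (fun _ => 0 * 0)%C); [rewrite Csum_scal; ring|].
    intros j Hj; replace (n.+1 == j) with false by lia; ring.
Qed.

Lemma int_poly_le_ext n a P Q : (forall z, P z = Q z) -> int_poly_le n a P -> int_poly_le n a Q.
Proof. intros H [c [Hc E]]; exists c; split; [exact Hc|intros z; rewrite -H; apply E]. Qed.

Lemma int_poly_le_zero_lead_Csum n (f : nat -> C -> C) N :
  (forall i, (i <= N)%N -> int_poly_le n 0 (f i)) ->
  int_poly_le n 0 (fun z => Csum (fun i => f i z) N).
Proof.
induction N as [|N IH]; intros H.
- apply (int_poly_le_ext n _ (f 0%N)); [intros z; now rewrite Csum_O|apply H; reflexivity].
- apply (int_poly_le_ext n _ (fun z => Csum (fun i => f i z) N + f N.+1 z)%C);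
    [intros z; now rewrite Csum_S|].
  apply (int_poly_le_plus n 0 0); [apply IH; intros i Hi|]; apply H; lia.
Qed.

Lemma int_poly_le_mul_1z n a P : int_poly_le n a P -> int_poly_le n.+1 a (fun z => (1 + z) * P z)%C.
Proof.
intros [c [Hc E]].
exists (fun i => (if (i <= n)%N then c i else 0) + (if i is j.+1 then c j else 0))%Z.
split; [rewrite ltnn; exact Hc|]; intros z; rewrite E.
transitivity (Csum (fun i => RtoC (IZR (if (i <= n)%N then c i else 0%Z)) * z ^ i)%C n.+1 +
  Csum (fun i => RtoC (IZR (if i is j.+1 then c j else 0%Z)) * z ^ i)%C n.+1)%C.
- rewrite Csum_S (Csum_S_l _ n) ltnn.
  rewrite (Csum_ext (fun i => RtoC (IZR (if (i <= n)%N then c i else 0%Z)) * z ^ i)%C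
    (fun i => RtoC (IZR (c i)) * z ^ i)%C); [|intros i Hi; now rewrite Hi].
  rewrite (Csum_ext (fun i => RtoC (IZR (c i)) * z ^ i.+1)%C
    (fun i => z * (RtoC (IZR (c i)) * z ^ i))%C); [|intros i _; rewrite Cpow_S; ring].
  rewrite Csum_scal; ring.
- rewrite -Csum_plus; apply Csum_ext; intros i _; rewrite plus_IZR RtoC_plus; ring.
Qed.

Definition is_IZR (x : R) : Prop := exists z : Z, x = IZR z.

Lemma is_IZR_mult x y : is_IZR x -> is_IZR y -> is_IZR (x * y).
Proof. intros [a ->] [b ->]; exists (a * b)%Z; now rewrite mult_IZR. Qed.

Lemma is_IZR_INR n : is_IZR (INR n).
Proof. exists (Z.of_nat n); apply INR_IZR_INZ. Qed.

Lemma is_IZR_m1_pow n : is_IZR ((-1) ^ n).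
Proof.
induction n as [|n IH]; [exists 1%Z; reflexivity|].
apply is_IZR_mult; [exists (-1)%Z; reflexivity|exact IH].
Qed.

Lemma is_IZR_sum_n f n : (forall i, is_IZR (f i)) -> is_IZR (sum_n f n).
Proof.
intros H; induction n as [|n [a IH]]; [rewrite sum_O; apply H|].
rewrite sum_Sn IH; destruct (H n.+1) as [b ->]; exists (a + b)%Z; now rewrite plus_IZR.
Qed.

Lemma is_IZR_b_coef k l : is_IZR (b_coef k l).
Proof.
apply is_IZR_sum_n; intros m; apply is_IZR_mult; [apply is_IZR_mult|apply is_IZR_INR].
- apply is_IZR_m1_pow.
- apply is_IZR_sum_n; intros j; repeat apply is_IZR_mult; try apply is_IZR_INR; apply is_IZR_m1_pow.
Qed.

(** The binomial [C(2k-1-m, 2k-1)] vanishes unless [m = 0], and [a_coef k 0] is the alternating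
    Stirling sum, equal to [(-1)^(2k-1)]. *)
Lemma b_coef_top k : (1 <= k)%N -> b_coef k (2 * k - 1) = -1.
Proof.
intros Hk; unfold b_coef.
assert (E : forall n f, (forall i, (0 < i <= n)%N -> f i = 0) -> sum_n f n = f 0%N).
{ induction n as [|n IH]; intros f Hf; [apply sum_O|].
  rewrite sum_Sn IH; [|intros i Hi; apply Hf; lia].
  rewrite (Hf n.+1); [|lia]; exact (Rplus_0_r _). }
rewrite E.
- rewrite subn0 binn; unfold a_coef.
  rewrite (sum_n_ext _ (fun j => INR j`! * (-1) ^ j * INR (stirling2 (2 * k - 1)%N j))).
  + rewrite stirling2_alternating_sum.
    replace (2 * k - 1)%N with (2 * (k - 1)).+1 by lia.
    rewrite -multE pow_1_odd; simpl; ring.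
  + intros j; rewrite bin0; simpl; ring.
- intros i Hi; rewrite bin_small; [simpl; ring|lia].
Qed.

(** The product [(1+z)^(2k) Pe(z)] is monic of degree [4k-2]. The subtracted term, a multiple of
    [z Pe(z^2)], has odd powers only, up to [4k-3], and leaves the leading coefficient unchanged. *)
Lemma Po_int_poly k : (1 <= k)%N -> is_int_poly_of_degree (4 * k - 2)%N (Po k).
Proof.
intros Hk.
enough (int_poly_le (4 * k - 2)%N 1 (Po k)) as [c [Hc E]] by (exists c; split; [rewrite Hc; discriminate|exact E]).
assert (PeS : forall z, Pe k z = Csum (fun i => RtoC ((-1) ^ i.+1 * b_coef k i.+1) * z ^ i)%C (2 * k - 2)%N).
{ intros z; unfold Pe; replace (2 * k - 1)%N with (2 * k - 2).+1 by lia.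
  generalize (2 * k - 2)%N; intros n.
  transitivity (Csum (fun i => RtoC ((-1) ^ i.+1 * b_coef k i.+1) * z ^ (i.+1 - 1)%N)%C n).
  - exact (Logic.eq_sym (@sum_n_m_S C_AbelianMonoid
      (fun l => RtoC ((-1) ^ l * b_coef k l) * z ^ (l - 1)%N)%C 0 n)).
  - apply Csum_ext; intros i _; now rewrite subn1. }
assert (term : forall i, exists a, (-1) ^ i.+1 * b_coef k i.+1 = IZR a).
{ intros i; apply is_IZR_mult; [apply is_IZR_m1_pow|apply is_IZR_b_coef]. }
assert (P1 : int_poly_le (2 * k - 2)%N 1 (Pe k)).
(* For [k = 1] the polynomial [Pe] is constant and has no lower part to split off. *)
{ destruct k as [|[|k]]; [discriminate| |].
  - apply (int_poly_le_ext 0 1 (fun z => z ^ 0)%C); [|exact (int_poly_le_monomial 0 0 isT)].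
    intros z; rewrite PeS Csum_O.
    replace ((-1) ^ 1 * b_coef 1 1) with 1; [ring|].
    change (b_coef 1 1) with (b_coef 1 (2 * 1 - 1)%N); rewrite b_coef_top //; ring.
  - replace (2 * k.+2 - 2)%N with (2 * k).+2 in * by lia.
    apply (int_poly_le_ext _ 1 (fun z =>
      Csum (fun i => RtoC ((-1) ^ i.+1 * b_coef k.+2 i.+1) * z ^ i)%C (2 * k).+1 + z ^ (2 * k).+2)%C).
    + intros z; rewrite PeS (Csum_S _ (2 * k).+1).
      pose proof (b_coef_top k.+2 isT) as B; replace (2 * k.+2 - 1)%N with (2 * k).+3 in B by lia.
      rewrite B; replace (2 * k).+3 with (2 * k.+1).+1 by lia.
      rewrite -multE pow_1_odd; replace (-1 * -1) with 1 by ring; ring.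
    + apply (int_poly_le_plus _ 0 1).
      * apply int_poly_le_zero_lead_Csum; intros i Hi.
        destruct (term i) as [a ->]; rewrite -(Z.mul_0_r a); apply int_poly_le_scal.
        pose proof (int_poly_le_monomial (2 * k).+2 i) as M.
        replace (i == (2 * k).+2) with false in M by lia; apply M; lia.
      * pose proof (int_poly_le_monomial (2 * k).+2 (2 * k).+2) as M; rewrite eqxx in M.
        apply M; lia. }
assert (P2 : forall j, int_poly_le (j + (2 * k - 2))%N 1 (fun z => (1 + z) ^ j * Pe k z)%C).
{ induction j as [|j IH].
  - apply (int_poly_le_ext _ _ (Pe k)); [intros z; simpl; ring|exact P1].
  - apply (int_poly_le_ext _ _ (fun z => (1 + z) * ((1 + z) ^ j * Pe k z))%C);
      [intros z; rewrite Cpow_S; ring|].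
    rewrite addSn; apply int_poly_le_mul_1z, IH. }
specialize (P2 (2 * k)%N); replace (2 * k + (2 * k - 2))%N with (4 * k - 2)%N in P2 by lia.
(* The zero is the coefficient of degree [4k-2] in the odd part. *)
replace 1%Z with (1 + (- 2 ^ Z.of_nat (2 * k - 1)) * 0)%Z by ring.
apply (int_poly_le_ext _ (1 + (- 2 ^ Z.of_nat (2 * k - 1)) * 0) (fun z => (1 + z) ^ (2 * k)%N * Pe k z +
  RtoC (IZR (- 2 ^ Z.of_nat (2 * k - 1))) *
   Csum (fun i => RtoC ((-1) ^ i.+1 * b_coef k i.+1) * z ^ (2 * i + 1)%N)%C (2 * k - 2)%N)%C).
- intros z; unfold Po; rewrite opp_IZR -pow_IZR RtoC_opp (PeS (z ^ 2)%C).
  rewrite (Csum_ext _ (fun i => z * (RtoC ((-1) ^ i.+1 * b_coef k i.+1) * (z ^ 2) ^ i))%C).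
  + rewrite Csum_scal; ring.
  + intros i _; rewrite addn1 Cpow_S Cpow_muln; generalize ((z ^ 2) ^ i)%C; intros y; ring.
- apply int_poly_le_plus; [exact P2|apply int_poly_le_scal, int_poly_le_zero_lead_Csum].
  intros i Hi; destruct (term i) as [a ->]; rewrite -(Z.mul_0_r a); apply int_poly_le_scal.
  pose proof (int_poly_le_monomial (4 * k - 2)%N (2 * i + 1)%N) as M.
  replace (2 * i + 1 == 4 * k - 2)%N with false in M by lia; apply M; lia.
Qed.

(** * A finite identity behind the infinite product *)

Lemma Cis_series_finite u n : (forall i, (n < i)%N -> u i = RtoC 0) -> Cis_series u (Csum u n).
Proof.
intros H; apply Cis_series_Clim, (Clim_ext eventually (fun _ => Csum u n)).
- exists n; intros m Hm; replace m with (n + (m - n))%N by lia.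
  generalize (m - n)%N; intros k; induction k as [|k IH]; [now rewrite addn0|].
  rewrite addnS Csum_S -IH H; [ring|lia].
- apply (Clim_const eventually).
Qed.

Lemma exp_le_mono x y : x <= y -> exp x <= exp y.
Proof. intros [H| ->]; [left; apply exp_increasing, H|right; reflexivity]. Qed.

Fixpoint Cprod (u : nat -> C) (n : nat) : C :=
  if n is m.+1 then (Cprod u m * u m)%C else 1.

(** The partial products are bounded by the exponential of the sum of moduli; their successive
    differences [P n * a n] are then absolutely summable, and the product converges as a telescoping
    series. *)
Lemma Cprod_Clim (a : nat -> C) : Cabs_series a ->
  exists P, Clim eventually (Cprod (fun i => 1 + a i)%C) P.
Proof.
intros Ha; set (P := Cprod (fun i => 1 + a i)%C).
assert (PS : forall m, P m.+1 = (P m * (1 + a m))%C) by reflexivity.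
set (B := exp (Series (fun n => Cmod (a n)))).
assert (HB : forall n, Cmod (P n) <= B).
{ intros n; apply Rle_trans with (exp (sum_n (fun i => Cmod (a i)) n)).
  (* The last summand is removed because [sum_n] includes the index [n], whereas [Cprod] stops
     before it. *)
  - apply Rle_trans with (exp (sum_n (fun i => Cmod (a i)) n - Cmod (a n))).
    + induction n as [|n IH]; [simpl; rewrite Cmod_1 sum_O Rminus_diag exp_0; lra|].
      change (P n.+1) with (P n * (1 + a n))%C; rewrite Cmod_mult sum_Sn.
      change (plus ?x ?y) with (x + y).
      replace (sum_n (fun i => Cmod (a i)) n + Cmod (a n.+1) - Cmod (a n.+1))
        with (sum_n (fun i => Cmod (a i)) n - Cmod (a n) + Cmod (a n)) by ring.
      rewrite exp_plus; apply Rmult_le_compat; try apply Cmod_ge_0; [exact IH|].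
      eapply Rle_trans; [apply Cmod_triangle|]; rewrite Cmod_1; apply exp_ineq1_le.
    + apply exp_le_mono; pose proof (Cmod_ge_0 (a n)); lra.
  - apply exp_le_mono, sum_n_le_Series; [intros i; apply Cmod_ge_0|exact Ha]. }
exists (1 + CSeries (fun n => P n * a n))%C.
assert (Hs : Cis_series (fun n => P n * a n)%C (CSeries (fun n => P n * a n)%C)).
{ apply Cabs_series_CSeries, (Cabs_series_le _ (fun n => B * Cmod (a n))).
  - intros n; rewrite Cmod_mult; apply Rmult_le_compat_r; [apply Cmod_ge_0|apply HB].
  - apply (@ex_series_scal_l R_AbsRing R_NormedModule), Ha. }
apply Cis_series_Clim in Hs; intros eps Heps; destruct (Hs eps Heps) as [N HN].
exists N.+1; intros [|n] Hn; [lia|].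
replace (P n.+1 - (1 + CSeries (fun n0 => P n0 * a n0)))%C
  with (Csum (fun n => P n * a n)%C n - CSeries (fun n0 => P n0 * a n0)%C)%C; [apply HN; lia|].
assert (E : forall m, P m.+1 = (1 + Csum (fun n => P n * a n) m)%C).
{ induction m as [|m IH]; [rewrite Csum_O PS; change (P 0%N) with (RtoC 1); ring|].
  rewrite Csum_S Cplus_assoc -IH PS; ring. }
rewrite E; ring.
Qed.

Section FiniteIdentity.
Variable p : C.
Hypothesis Hp : Cmod p < 1.

Let nz n : (1 - p ^ n.+1)%C <> RtoC 0.
Proof. apply one_minus_neq0, Cmod_pow_lt1; [exact Hp|reflexivity]. Qed.

Definition qratio_factor (n : nat) : C := ((1 - p ^ (2 * n).+1) / (1 - p ^ (2 * n).+2))%C.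
(** The quotient of q-Pochhammer symbols [(p; p^2)_n / (p^2; p^2)_n], a q-analogue of the central
    binomial coefficient divided by [4^n]. *)
Definition qratio (n : nat) : C := Cprod qratio_factor n.

Lemma qratio_S n : qratio n.+1 = (qratio n * ((1 - p ^ (2 * n).+1) / (1 - p ^ (2 * n).+2)))%C.
Proof. reflexivity. Qed.

(** With [p = q^2] and a further factor [q] this is the general term of the weight-two series, since
    [Po 1 z = 1 + z^2]. *)
Definition lambert_coef (i : nat) : C :=
  (p ^ i * (1 + p ^ (2 * i).+1) / (1 - p ^ (2 * i).+1) ^ 2)%C.

(* Gosper's certificate for the dependence on [N] of the sum [lambert_partial]. *)
Definition wz_certificate (n i : nat) : C :=
  (- (1 - p ^ (4 * (n + i)).+1) / ((1 - p ^ (2 * (n + i))%N) * (1 - p ^ (2 * (n + i)).+1))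
   * p ^ (2 * n + i)%N * (1 - p ^ (2 * i)%N) * qratio n * qratio (n + 2 * i))%C.

(** Here [d] stands for [M - i], and the left side compares the summands of [lambert_partial] for
    [M + 1] and [M]. The two squared weights are the normalising factors of [lambert_partial_eq]
    with their common factor [qratio M.+1] dropped. *)
Lemma wz_step d i :
  (lambert_coef i * (qratio d.+1 * qratio (d + 2 * i).+2 * (1 - p ^ (2 * (d.+1 + i)).+1) ^ 2
     - qratio d * qratio (d + 2 * i).+1 * (1 - p ^ (2 * (d.+1 + i))%N) ^ 2)
   = wz_certificate d i.+1 - wz_certificate d.+1 i)%C.
Proof.
unfold lambert_coef, wz_certificate.
replace (d + 2 * i.+1)%N with (d + 2 * i).+2 by lia.
replace (d.+1 + 2 * i)%N with (d + 2 * i).+1 by lia.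
replace (d + i.+1)%N with (d.+1 + i)%N by lia.
rewrite (qratio_S d) (qratio_S (d + 2 * i).+1).
set (x := qratio d); set (y := qratio (d + 2 * i).+1).
(* All exponents are written as [a d + b i + c], so that [field] sees only the atoms [p^d], [p^i]
   and [p]. *)
assert (e : forall n a b c, n = (a * d + b * i + c)%N ->
  (p ^ n = (p ^ d) ^ a * (p ^ i) ^ b * p ^ c)%C).
{ intros n a b c ->; rewrite !Cpow_addn (mulnC a) (mulnC b) !Cpow_muln; reflexivity. }
pose proof (nz (2 * d).+1) as Z1; pose proof (nz (2 * i)) as Z2.
pose proof (nz (2 * d + 2 * i).+1) as Z3; pose proof (nz (2 * d + 2 * i).+2) as Z4.
pose proof (nz (2 * d + 4 * i).+3) as Z5.
rewrite (e (2 * d).+2 2 0 2)%N in Z1; [|lia].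
rewrite (e (2 * i).+1 0 2 1)%N in Z2; [|lia].
rewrite (e (2 * d + 2 * i).+2 2 2 2)%N in Z3; [|lia].
rewrite (e (2 * d + 2 * i).+3 2 2 3)%N in Z4; [|lia].
rewrite (e (2 * d + 4 * i).+4 2 4 4)%N in Z5; [|lia].
rewrite (e (2 * i).+1 0 2 1)%N; [|lia].
rewrite (e (2 * d).+1 2 0 1)%N; [|lia].
rewrite (e (2 * d).+2 2 0 2)%N; [|lia].
rewrite (e (2 * (d + 2 * i).+1).+1 2 4 3)%N; [|lia].
rewrite (e (2 * (d + 2 * i).+1).+2 2 4 4)%N; [|lia].
rewrite (e (2 * (d.+1 + i)).+1 2 2 3)%N; [|lia].
rewrite (e (2 * (d.+1 + i)) 2 2 2)%N; [|lia].
rewrite (e (4 * (d.+1 + i)).+1 4 4 5)%N; [|lia].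
rewrite (e (2 * d + i.+1) 2 1 1)%N; [|lia].
rewrite (e (2 * d.+1 + i) 2 1 2)%N; [|lia].
rewrite (e (2 * i.+1) 0 2 2)%N; [|lia].
rewrite (e (2 * i) 0 2 0)%N; [|lia].
revert Z1 Z2 Z3 Z4 Z5; generalize (p ^ d)%C (p ^ i)%C; clear; intros P J.
simpl; rewrite !Cmult_1_r !Cmult_1_l; intros Z1 Z2 Z3 Z4 Z5.
field; repeat split; assumption.
Qed.

(** A truncation whose summands tend to a common multiple of [lambert_coef i] as [M] grows, while
    for finite [M] its value is known in closed form. *)
Definition lambert_partial (M : nat) : C :=
  Csum (fun i => lambert_coef i * (qratio (M - i)%N * qratio (M + i).+1))%C M.

Lemma wz_sum M I : (I <= M)%N ->
  Csum (fun i => lambert_coef i * (qratio (M - i).+1 * qratio (M + i).+2 * (1 - p ^ (2 * M).+3) ^ 2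
     - qratio (M - i) * qratio (M + i).+1 * (1 - p ^ (2 * M).+2) ^ 2))%C I
  = wz_certificate (M - I)%N I.+1.
Proof.
assert (step : forall i, (i <= M)%N ->
  (lambert_coef i * (qratio (M - i).+1 * qratio (M + i).+2 * (1 - p ^ (2 * M).+3) ^ 2
     - qratio (M - i) * qratio (M + i).+1 * (1 - p ^ (2 * M).+2) ^ 2)
   = wz_certificate (M - i) i.+1 - wz_certificate (M - i).+1 i)%C).
{ intros i Hi; rewrite -wz_step.
  replace (M - i + 2 * i)%N with (M + i)%N by lia.
  replace (2 * ((M - i).+1 + i))%N with (2 * M).+2 by lia; reflexivity. }
induction I as [|I IH]; intros HI.
- rewrite Csum_O step // subn0.
  replace (wz_certificate M.+1 0) with (RtoC 0); [ring|].
  unfold wz_certificate; rewrite muln0 /=; ring.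
- rewrite Csum_S IH; [|lia]; rewrite step //.
  replace (M - I)%N with (M - I.+1).+1 by lia; ring.
Qed.

(** By induction on [M]: the old summands change by the telescoped boundary term
    [wz_certificate 0 M.+1], and a new summand [i = M + 1] appears. As [M] grows all factors
    [qratio] tend to one product [R], so that the series of [lambert_coef] will equal [R^(-4)]. *)
Lemma lambert_partial_eq M :
  (lambert_partial M * (qratio M.+1 * (1 - p ^ (2 * M).+2)) ^ 2 = 1)%C.
Proof.
unfold lambert_partial; induction M as [|M IH].
- rewrite Csum_O; unfold lambert_coef, qratio, Cprod, qratio_factor; rewrite !muln0 /=.
  pose proof (nz 0) as Z1; pose proof (nz 1) as Z2; simpl in Z1, Z2; rewrite !Cmult_1_r in Z1, Z2 *.
  field; split; assumption.
- pose proof (wz_sum M M (leqnn M)) as H; rewrite subnn in H.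
  set (S1 := Csum _ M) in IH |- *.
  set (lc := (fun i => lambert_coef i * (qratio (M.+1 - i) * qratio (M.+1 + i).+1))%C).
  assert (E : Csum lc M.+1 = (Csum lc M + lambert_coef M.+1 * (qratio 0 * qratio (2 * M).+3))%C).
  { rewrite Csum_S /lc subnn; replace (M.+1 + M.+1).+1 with (2 * M).+3 by lia; reflexivity. }
  assert (H2 : (Csum lc M * (1 - p ^ (2 * M).+3) ^ 2 - S1 * (1 - p ^ (2 * M).+2) ^ 2
                = wz_certificate 0 M.+1)%C).
  { rewrite -H /S1 Cmult_comm -Csum_scal (Cmult_comm (Csum _ _)) -Csum_scal.
    unfold Cminus at 1; rewrite -(Cmult_1_l (Csum _ M)) -(Cmult_1_l (- _)%C).
    replace (1 * - Csum (fun i : nat => (1 - p ^ (2 * M).+2) ^ 2 * (lambert_coef i * (qratio (M - i) * qratio (M + i).+1))) M)%C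
     with (- (1) * Csum (fun i : nat => (1 - p ^ (2 * M).+2) ^ 2 * (lambert_coef i * (qratio (M - i) * qratio (M + i).+1))) M)%C by ring.
    rewrite Cmult_1_l -Csum_scal -Csum_plus; apply Csum_ext; intros i Hi; rewrite /lc.
    replace (M.+1 - i)%N with (M - i).+1 by lia; rewrite addSn; ring. }
  rewrite E; clearbody S1; clear E H.
  revert H2; unfold wz_certificate, lambert_coef.
  replace (0 + M.+1)%N with M.+1 by lia; replace (2 * 0 + M.+1)%N with M.+1 by lia.
  replace (0 + 2 * M.+1)%N with (2 * M).+2 by lia.
  rewrite (qratio_S (2 * M).+2) (qratio_S M.+1).
  revert IH; set (x := qratio M.+1); set (y := qratio (2 * M).+2).
  change (qratio 0) with (RtoC 1); generalize (Csum lc M) x y; clear x y; intros L x y.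
  assert (e : forall n b c, n = (b * M + c)%N -> (p ^ n = (p ^ M) ^ b * p ^ c)%C).
  { intros n b c ->; rewrite !Cpow_addn (mulnC b) !Cpow_muln; reflexivity. }
  pose proof (nz (2 * M).+1) as Z1; pose proof (nz (2 * M).+2) as Z2.
  pose proof (nz (4 * M).+4.+1) as Z3; pose proof (nz (2 * M).+3) as Z4.
  rewrite (e (2 * M).+2 2 2)%N in Z1; [|lia].
  rewrite (e (2 * M).+3 2 3)%N in Z2; [|lia].
  rewrite (e (4 * M).+4.+2 4 6)%N in Z3; [|lia].
  rewrite (e (2 * M).+4 2 4)%N in Z4; [|lia].
  rewrite (e (2 * M).+2 2 2)%N; [|lia]. rewrite (e (2 * M).+3 2 3)%N; [|lia].
  rewrite (e (4 * M.+1).+1 4 5)%N; [|lia]. rewrite (e (2 * M.+1)%N 2 2)%N; [|lia].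
  rewrite (e (2 * M.+1).+1 2 3)%N; [|lia]. rewrite (e (2 * M.+1).+2 2 4)%N; [|lia].
  rewrite (e M.+1 1 1)%N; [|lia].
  rewrite (e (2 * (2 * M).+2).+1 4 5)%N; [|lia]. rewrite (e (2 * (2 * M).+2).+2 4 6)%N; [|lia].
  revert Z1 Z2 Z3 Z4; generalize (p ^ M)%C; clear; intros P.
  simpl; rewrite !Cmult_1_r; intros Z1 Z2 Z3 Z4 IH H2.
  refine (Logic.eq_trans _ IH); clear IH.
  match type of H2 with (_ = ?r)%C => set (G := r) in H2 end.
  match goal with |- ((_ + ?v) * _)%C = _ => transitivity
    ((L * ((1 - P * P * (p * (p * p))) * (1 - P * P * (p * (p * p)))) - S1 * ((1 - P * P * (p * p)) * (1 - P * P * (p * p)))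
     + S1 * ((1 - P * P * (p * p)) * (1 - P * P * (p * p)))
     + v * ((1 - P * P * (p * (p * p))) * (1 - P * P * (p * (p * p))))) * (x * x))%C end.
  { field; repeat split; assumption. }
  rewrite H2 /G; field; repeat split; assumption.
Qed.
End FiniteIdentity.

(** * The product as the series of weight two *)

HB.instance Definition _ := Monoid.isComLaw.Build C (RtoC 1) Cmult Cmult_assoc Cmult_comm Cmult_1_l.

Lemma Cprod_S u n : Cprod u n.+1 = (Cprod u n * u n)%C.
Proof. reflexivity. Qed.

Lemma Clim_bounded f l : Clim eventually f l -> exists B, 0 < B /\ forall n, Cmod (f n) <= B.
Proof.
intros H; destruct (H 1 Rlt_0_1) as [N HN].
exists (sum_n (fun i => Cmod (f i)) N + (Cmod l + 1)).
assert (S0 : forall n, 0 <= sum_n (fun i => Cmod (f i)) n).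
{ intros n; eapply Rle_trans; [|apply Cmod_Csum]; apply Cmod_ge_0. }
split; [pose proof (S0 N); pose proof (Cmod_ge_0 l); lra|].
intros n; destruct (leqP n N) as [Hn|Hn].
- apply Rle_trans with (sum_n (fun i => Cmod (f i)) N); [|pose proof (Cmod_ge_0 l); lra].
  clear -Hn S0; induction N as [|N IH].
  + replace n with 0%N by lia; rewrite sum_O; lra.
  + rewrite sum_Sn; change (plus ?x ?y) with (x + y); pose proof (Cmod_ge_0 (f N.+1)).
    destruct (leqP n N) as [Hn'|Hn']; [specialize (IH isT); lra|].
    replace n with N.+1 by lia; specialize (S0 N); lra.
- replace (f n) with ((f n - l) + l)%C by ring; eapply Rle_trans; [apply Cmod_triangle|].
  assert (Cmod (f n - l) < 1) by (apply HN; lia); specialize (S0 N); lra.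
Qed.

Lemma Clim_comp_eventually (f : nat -> C) l (g : nat -> nat) :
  Clim eventually f l -> (forall N, exists N', forall n, (N' <= n)%N -> (N <= g n)%N) ->
  Clim eventually (fun n => f (g n)) l.
Proof.
intros H Hg eps Heps; destruct (H eps Heps) as [N HN]; destruct (Hg N) as [N' HN'].
exists N'; intros n Hn; apply HN; specialize (HN' n); lia.
Qed.

Lemma Clim_pow_0 p : Cmod p < 1 -> Clim eventually (fun n => p ^ n)%C (RtoC 0).
Proof.
intros Hp eps Heps.
destruct (pow_lt_1_zero (Cmod p)) with (y := eps) as [N HN]; [|exact Heps|].
{ rewrite Rabs_pos_eq; [exact Hp|apply Cmod_ge_0]. }
exists N; intros n Hn; replace (p ^ n - 0)%C with (p ^ n)%C by ring; rewrite Cmod_pow.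
eapply Rle_lt_trans; [apply Rle_abs|apply HN; lia].
Qed.

Lemma Cmod_one_minus_ge x : 1 - Cmod x <= Cmod (1 - x).
Proof.
pose proof (Cmod_triangle (1 - x) x) as H.
replace (1 - x + x)%C with (RtoC 1) in H by ring; rewrite Cmod_1 in H; lra.
Qed.

Lemma pow_le_1 x n : 0 <= x <= 1 -> x ^ n <= 1.
Proof. intros H; pose proof (pow_incr x 1 n H) as E; rewrite pow1 in E; exact E. Qed.

Lemma Cmod_pow_le p n : Cmod p < 1 -> Cmod (p ^ n.+1) <= Cmod p.
Proof.
intros Hp; rewrite Cmod_pow -{2}(Rmult_1_r (Cmod p)); apply Rmult_le_compat_l; [apply Cmod_ge_0|].
apply pow_le_1; split; [apply Cmod_ge_0|lra].
Qed.

Lemma ex_series_geom_scal c r : 0 <= r < 1 -> ex_series (fun n => c * r ^ n).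
Proof.
intros Hr; apply (@ex_series_scal_l R_AbsRing R_NormedModule), ex_series_geom.
rewrite Rabs_pos_eq; lra.
Qed.

Section QRatioLimit.
Variable p : C.
Hypothesis Hp : Cmod p < 1.

Let nz n : (1 - p ^ n.+1)%C <> RtoC 0.
Proof. apply one_minus_neq0, Cmod_pow_lt1; [exact Hp|reflexivity]. Qed.

Let inv_bound n : Cmod (/ (1 - p ^ n.+1)) <= / (1 - Cmod p).
Proof.
rewrite Cmod_inv; [|apply nz]; apply Rinv_le_contravar; [lra|].
eapply Rle_trans; [|apply Cmod_one_minus_ge]; pose proof (Cmod_pow_le p n Hp); lra.
Qed.

Let pow_bound n m : Cmod (p ^ (n + m)%N) <= Cmod p ^ n.
Proof.
rewrite Cpow_addn Cmod_mult !Cmod_pow -{2}(Rmult_1_r (Cmod p ^ n)).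
apply Rmult_le_compat_l; [apply pow_le, Cmod_ge_0|].
apply pow_le_1; split; [apply Cmod_ge_0|lra].
Qed.

Let quotient_lim (i j : nat) : exists P, Clim eventually
  (Cprod (fun n => (1 - p ^ (2 * n + i).+1) / (1 - p ^ (2 * n + j).+1))%C) P.
Proof.
destruct (Cprod_Clim (fun n => (p ^ (2 * n + j).+1 - p ^ (2 * n + i).+1) / (1 - p ^ (2 * n + j).+1))%C)
  as [P HP].
- apply (Cabs_series_le _ (fun n => (2 * / (1 - Cmod p)) * Cmod p ^ n)).
  + intros n; unfold Cdiv; rewrite Cmod_mult.
    apply Rle_trans with ((2 * Cmod p ^ n) * / (1 - Cmod p)); [|right; ring].
    apply Rmult_le_compat; try apply Cmod_ge_0; [|apply inv_bound].
    eapply Rle_trans; [apply Cmod_triangle|]; rewrite Cmod_opp.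
    replace (2 * n + j).+1 with (n + (n + j).+1)%N by lia.
    replace (2 * n + i).+1 with (n + (n + i).+1)%N by lia.
    pose proof (pow_bound n (n + j).+1); pose proof (pow_bound n (n + i).+1); lra.
  + apply ex_series_geom_scal; split; [apply Cmod_ge_0|exact Hp].
- exists P; refine (Clim_ext eventually _ _ _ _ HP); apply filter_forall; intros n.
  induction n as [|n IH]; [reflexivity|]; simpl Cprod; rewrite IH; f_equal.
  field; apply nz.
Qed.

Lemma qratio_neq0 n : qratio p n <> RtoC 0.
Proof.
induction n as [|n IH]; [intros E; injection E; lra|]; rewrite qratio_S.
apply Cmult_neq_0; [exact IH|]; unfold Cdiv; apply Cmult_neq_0; [apply nz|].
intros E; assert (F : ((1 - p ^ (2 * n).+2) * / (1 - p ^ (2 * n).+2) = 1)%C) by (field; apply nz).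
rewrite E Cmult_0_r in F; injection F; lra.
Qed.

(** The reciprocals form a convergent product of the same shape, with numerators and denominators
    exchanged. This yields the inverse of the limit at once, and with it the nonvanishing. *)
Lemma qratio_lim : exists R R', Clim eventually (qratio p) R /\
  Clim eventually (fun n => / qratio p n)%C R' /\ (R * R' = 1)%C.
Proof.
destruct (quotient_lim 0 1) as [R HR]; destruct (quotient_lim 1 0) as [R' HR'].
assert (H1 : Clim eventually (qratio p) R).
{ refine (Clim_ext eventually _ _ _ _ HR); apply filter_forall; intros n.
  unfold qratio; induction n as [|n IH]; [reflexivity|]; simpl Cprod; rewrite IH; f_equal.
  unfold qratio_factor; rewrite addn0 addn1; reflexivity. }
pose proof qratio_neq0 as nzq.
assert (H2 : Clim eventually (fun n => / qratio p n)%C R').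
{ refine (Clim_ext eventually _ _ _ _ HR'); apply filter_forall; intros n.
  induction n as [|n IH]; [change (RtoC 1 = / 1)%C; field; intros E; injection E; lra|].
  rewrite Cprod_S IH qratio_S addn0 addn1.
  field; repeat split; try apply nz; apply nzq. }
exists R, R'; split; [exact H1|split; [exact H2|]].
apply (Clim_uniq eventually (fun n => qratio p n * / qratio p n)%C); [apply (Clim_mult eventually); assumption|].
apply (Clim_ext eventually (fun _ => RtoC 1)); [|apply (Clim_const eventually)].
apply filter_forall; intros n; field; apply nzq.
Qed.

(** Dominated convergence in [lambert_partial_eq] with majorant [B^2 |lambert_coef i|]: the
    truncation tends to [R^2] times the series, and the normalising factor to [R^2]. *)
Lemma lambert_series R R' : Clim eventually (qratio p) R -> (R * R' = 1)%C ->
  Cis_series (lambert_coef p) (R' ^ 4)%C.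
Proof.
intros HR HRR.
destruct (Clim_bounded _ _ HR) as [B [B0 HB]].
assert (HL : forall i, Cmod (lambert_coef p i) <= 2 * / (1 - Cmod p) * / (1 - Cmod p) * Cmod p ^ i).
{ intros i; unfold lambert_coef, Cdiv; rewrite !Cmod_mult -Cpow_inv; [|apply nz].
  rewrite (Cmod_pow (/ _)) Cmod_pow.
  pose proof (inv_bound (2 * i)) as I1; pose proof (Cmod_ge_0 (/ (1 - p ^ (2 * i).+1))) as I0.
  assert (I2 : Cmod (1 + p ^ (2 * i).+1) <= 2).
  { eapply Rle_trans; [apply Cmod_triangle|]; rewrite Cmod_1; pose proof (Cmod_pow_le p (2 * i)%N Hp); lra. }
  apply Rle_trans with (Cmod p ^ i * 2 * (/ (1 - Cmod p)) ^ 2); [|right; simpl; ring].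
  apply Rmult_le_compat; [apply Rmult_le_pos; [apply pow_le|]; apply Cmod_ge_0|apply pow_le, I0| |].
  - apply Rmult_le_compat_l; [apply pow_le, Cmod_ge_0|exact I2].
  - apply pow_incr; split; assumption. }
assert (AL : Cabs_series (lambert_coef p)).
{ apply (Cabs_series_le _ _ HL), ex_series_geom_scal; split; [apply Cmod_ge_0|exact Hp]. }
assert (T : Clim eventually (lambert_partial p) (R * R * CSeries (lambert_coef p))%C).
{ assert (RB : Cmod R <= B).
  { apply (Clim_Cmod_le eventually _ _ _ HR), filter_forall; exact HB. }
  apply (tannery eventually
    (fun M i => if (i <= M)%N then lambert_coef p i * (qratio p (M - i)%N * qratio p (M + i).+1) else 0)%C
    (fun i => R * R * lambert_coef p i)%C (fun i => B * B * Cmod (lambert_coef p i))).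
  - intros i; apply (Clim_ext eventually (fun M => lambert_coef p i * (qratio p (M - i)%N * qratio p (M + i).+1))%C).
    + exists i; intros M HM; replace (i <= M)%N with true by lia; reflexivity.
    + rewrite Cmult_comm; apply (Clim_mult eventually); [apply (Clim_const eventually)|].
      apply (Clim_mult eventually); apply (Clim_comp_eventually (qratio p)); try exact HR; intros N.
      * exists (N + i)%N; intros n; lia.
      * exists N; intros n; lia.
  - apply filter_forall; intros M i; destruct (i <= M)%N.
    + rewrite Cmod_mult (Cmod_mult (qratio p _)) Rmult_comm; apply Rmult_le_compat_r; [apply Cmod_ge_0|].
      apply Rmult_le_compat; try apply Cmod_ge_0; apply HB.
    + rewrite Cmod_0; repeat apply Rmult_le_pos; try lra; apply Cmod_ge_0.
  - intros i; rewrite (Cmod_mult (R * R)) (Cmod_mult R); apply Rmult_le_compat_r; [apply Cmod_ge_0|].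
    apply Rmult_le_compat; try apply Cmod_ge_0; exact RB.
  - apply (@ex_series_scal_l R_AbsRing R_NormedModule), AL.
  - apply filter_forall; intros M.
    match goal with |- Cis_series ?u _ => replace (lambert_partial p M) with (Csum u M) end.
    + apply Cis_series_finite; intros i Hi; replace (i <= M)%N with false by lia; reflexivity.
    + apply Csum_ext; intros i Hi; rewrite Hi; reflexivity.
  - apply Cis_series_scal, Cabs_series_CSeries, AL. }
assert (E : (R * R * CSeries (lambert_coef p) * (R * (1 - 0)) ^ 2 = 1)%C).
{ apply (Clim_uniq eventually (fun M => lambert_partial p M * (qratio p M.+1 * (1 - p ^ (2 * M).+2)) ^ 2)%C).
  - apply (Clim_mult eventually); [exact T|]; apply (Clim_pow eventually), (Clim_mult eventually).
    + apply (Clim_comp_eventually (qratio p)); [exact HR|intros N; exists N; intros n; lia].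
    + apply (Clim_plus eventually); [apply (Clim_const eventually)|apply (Clim_opp eventually)].
      apply (Clim_comp_eventually (fun n => p ^ n)%C); [apply Clim_pow_0, Hp|intros N; exists N; intros n; lia].
  - apply (Clim_ext eventually (fun _ => RtoC 1)); [|apply (Clim_const eventually)].
    apply filter_forall; intros M; symmetry; apply lambert_partial_eq, Hp. }
replace (R' ^ 4)%C with (CSeries (lambert_coef p)); [apply Cabs_series_CSeries, AL|].
transitivity ((R * R * CSeries (lambert_coef p) * (R * (1 - 0)) ^ 2) * R' ^ 4)%C; [|rewrite E; ring].
transitivity (CSeries (lambert_coef p) * (R * R') ^ 4)%C; [rewrite HRR; simpl; ring|simpl; ring].
Qed.
End QRatioLimit.

(** * Closed forms and bounds for the Lambert series *)

Definition odd_part_sum (k : nat) (x : C) : C := (x * Po k x / (1 - x ^ 2) ^ (2 * k)%N)%C.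

Lemma series_term_odd_part_sum k q n : series_term k q n = odd_part_sum k (q ^ (2 * n + 1)%N).
Proof. unfold series_term, odd_part_sum; rewrite (mulnC 2%N (2 * n + 1)%N) (Cpow_muln q (2 * n + 1)%N); reflexivity. Qed.

Definition full_sum (k : nat) (x : C) : C := (x * Pe k x / (1 - x) ^ (2 * k)%N)%C.

(** The bound is linear in [x] because the series has no constant term; its constant comes from the
    majorant series at [rho] divided by [rho]. *)
Lemma full_sum_bound k rho : (1 <= k)%N -> 0 < rho < 1 ->
  exists K, 0 < K /\ forall x, Cmod x <= rho -> Cmod (full_sum k x) <= K * Cmod x.
Proof.
intros Hk Hr; set (a := fun m => INR m ^ (2 * k - 1)%N * rho ^ m).
assert (a0 : forall m, 0 <= a m) by (intros m; apply Rmult_le_pos; apply pow_le; [apply pos_INR|lra]).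
assert (ea : ex_series a) by (apply ex_series_pow_geom; lra).
assert (S0 : 0 <= Series a).
{ eapply Rle_trans; [|apply (sum_n_le_Series a 0 a0 ea)]; rewrite sum_O; apply a0. }
exists ((Series a + 1) * / rho); split; [apply Rmult_lt_0_compat; [lra|apply Rinv_0_lt_compat; lra]|].
intros x Hx; pose proof (Cmod_ge_0 x) as x0.
assert (Hx1 : Cmod x < 1) by lra.
apply Rle_trans with (Series (fun m => (/ rho * Cmod x) * a m)).
- apply (Cis_series_Cmod_le _ _ _ (eulerian k x Hk Hx1)).
  + intros m; rewrite Cmod_mult Cmod_R Cmod_pow Rabs_pos_eq; [|apply pow_le, pos_INR].
    unfold a; destruct m as [|m].
    * replace (2 * k - 1)%N with (2 * k - 2).+1 by lia; simpl; lra.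
    * apply Rle_trans with (INR m.+1 ^ (2 * k - 1)%N * (Cmod x * rho ^ m)).
      -- apply Rmult_le_compat_l; [apply pow_le, pos_INR|]; simpl.
         apply Rmult_le_compat_l; [exact x0|apply pow_incr; lra].
      -- right; simpl; field; lra.
  + apply (@ex_series_scal_l R_AbsRing R_NormedModule), ea.
- rewrite Series_scal_l; pose proof (Rinv_0_lt_compat rho (proj1 Hr)).
  assert (0 <= / rho * Cmod x) by (apply Rmult_le_pos; lra); nra.
Qed.

Lemma odd_part_sum_full k x : (1 <= k)%N -> Cmod x < 1 ->
  odd_part_sum k x = ((full_sum k x - full_sum k (- x)) / 2)%C.
Proof.
intros Hk Hx; assert (Hx' : Cmod (- x) < 1) by now rewrite Cmod_opp.
pose proof (Cis_series_pairs _ _ (Cis_series_minus _ _ _ _ (eulerian k x Hk Hx) (eulerian k (- x)%C Hk Hx'))) as H.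
pose proof (Cis_series_scal 2 _ _ (eulerian_odd k x Hk Hx)) as H2.
assert (E : (2 * odd_part_sum k x = full_sum k x - full_sum k (- x))%C).
{ apply (Cis_series_unique _ _ _ H2); refine (Cis_series_ext _ _ _ _ H); intros i; cbv beta.
  assert (e2 : ((- x) ^ (2 * i)%N = x ^ (2 * i)%N)%C).
  { rewrite !Cpow_muln; f_equal; simpl; ring. }
  rewrite addn1 !Cpow_S e2; ring. }
rewrite -E; field; intros F; injection F; lra.
Qed.

Lemma odd_part_sum_bound k rho : (1 <= k)%N -> 0 < rho < 1 ->
  exists K, 0 < K /\ forall x, Cmod x <= rho -> Cmod (odd_part_sum k x) <= K * Cmod x.
Proof.
intros Hk Hr; destruct (full_sum_bound k rho Hk Hr) as [K [K0 HK]].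
exists K; split; [exact K0|]; intros x Hx; rewrite odd_part_sum_full //; [|lra].
unfold Cdiv; rewrite Cmod_mult Cmod_inv; [|intros F; injection F; lra].
rewrite Cmod_R Rabs_pos_eq; [|lra].
pose proof (HK x Hx) as H1; pose proof (HK (- x)%C) as H2; rewrite Cmod_opp in H2; specialize (H2 Hx).
pose proof (Cmod_triangle (full_sum k x) (- full_sum k (- x))) as H3; rewrite Cmod_opp in H3.
change (full_sum k x + - full_sum k (- x))%C with (full_sum k x - full_sum k (- x))%C in H3; lra.
Qed.

Lemma pow_le_base r n : 0 <= r < 1 -> r ^ (2 * n + 1)%N <= r ^ n.
Proof.
intros Hr; replace (2 * n + 1)%N with (n + n.+1)%coq_nat by lia; rewrite pow_add.
rewrite -{2}(Rmult_1_r (r ^ n)); apply Rmult_le_compat_l; [apply pow_le; lra|].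
apply pow_le_1; lra.
Qed.

Lemma series_term_abs k q : (1 <= k)%N -> Cmod q < 1 -> Cabs_series (series_term k q).
Proof.
intros Hk Hq; pose proof (Cmod_ge_0 q).
destruct (odd_part_sum_bound k ((1 + Cmod q) / 2) Hk) as [K [K0 HK]]; [lra|].
apply (Cabs_series_le _ (fun n => K * Cmod q ^ n)).
- intros n; rewrite series_term_odd_part_sum; eapply Rle_trans.
  + apply HK; rewrite addn1; eapply Rle_trans; [apply Cmod_pow_le, Hq|lra].
  + apply Rmult_le_compat_l; [lra|]; rewrite Cmod_pow; apply pow_le_base; lra.
- apply ex_series_geom_scal; lra.
Qed.

Lemma q_series_is_series k q : (1 <= k)%N -> Cmod q < 1 -> Cis_series (series_term k q) (q_series k q).
Proof. intros Hk Hq; apply Cabs_series_CSeries, series_term_abs; assumption. Qed.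

Lemma Po_1 z : Po 1 z = (1 + z ^ 2)%C.
Proof.
assert (H : forall y, Pe 1 y = RtoC 1).
{ intros y; unfold Pe; change (2 * 1 - 1)%N with 1%N; rewrite sum_n_n.
  replace ((-1) ^ 1 * b_coef 1 1) with 1; [rewrite subnn; change (y ^ 0)%C with (RtoC 1); apply Cmult_1_l|].
  change (b_coef 1 1) with (b_coef 1 (2 * 1 - 1)%N); rewrite b_coef_top //; ring. }
unfold Po; rewrite !H; change (2 * 1)%N with 2%N.
replace (RtoC (2 ^ (2 - 1)%N)) with (1 + 1)%C by (rewrite -RtoC_plus; f_equal; simpl; ring).
rewrite !Cmult_1_r; ring.
Qed.

(** With [p = q^2] the partial products are [(1 / qratio n)^(4k)]. The product is therefore the k-th
    power of the one for [k = 1], which [lambert_series] identifies with the weight-two series up to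
    the factor [q]. *)
Lemma q_prod_q_series k q : Cmod q < 1 ->
  Cis_prod (prod_term k q) (q_prod k q) /\ (q ^ k * q_prod k q = q_series 1 q ^ k)%C.
Proof.
intros Hq; assert (Hp : Cmod (q ^ 2) < 1) by (apply Cmod_pow_lt1; auto).
destruct (qratio_lim _ Hp) as [R [R' [H1 [H2 H3]]]].
assert (HP : Cis_prod (prod_term k q) (R' ^ (4 * k)%N)%C).
{ apply (filterlim_Clim eventually).
  apply (Clim_ext eventually (fun n => (/ qratio (q ^ 2) n) ^ (4 * k)%N)%C);
    [|apply (Clim_pow eventually), H2].
  apply filter_forall; intros n; unfold Cpartial_prod; induction n as [|n IH].
  - rewrite big_geq //; unfold qratio; simpl Cprod.
    replace (/ 1)%C with (RtoC 1) by (field; intros E; injection E; lra); apply Cpow_1_l.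
  - rewrite big_nat_recr // -IH qratio_S; unfold prod_term.
    assert (nz : forall m, (1 - q ^ m.+1)%C <> RtoC 0).
    { intros m; apply one_minus_neq0, Cmod_pow_lt1; auto. }
    rewrite -!Cpow_muln.
    replace (2 * (2 * n).+2)%N with (4 * n + 3).+1 by lia.
    replace (2 * (2 * n).+1)%N with (4 * n + 1).+1 by lia.
    replace (4 * n.+1)%N with (4 * n + 3).+1 by lia.
    replace ((4 * n + 3).+1 - 2)%N with (4 * n + 1).+1 by lia.
    assert (Qn : (qratio (q ^ 2) n) <> RtoC 0) by (apply qratio_neq0, Hp).
    transitivity (((/ qratio (q ^ 2) n) * ((1 - q ^ (4 * n + 3).+1) / (1 - q ^ (4 * n + 1).+1))) ^ (4 * k)%N)%C.
    + f_equal; field; repeat split; try apply nz; exact Qn.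
    + match goal with |- _ = ?f ?a ?b => change (f a b) with (Cmult a b) end.
      rewrite Cpow_mult_l; f_equal; unfold Cdiv; rewrite Cpow_mult_l (Cpow_inv _ _ (nz _)); reflexivity. }
unfold q_prod; rewrite (CProd_unique _ _ HP); split; [exact HP|].
rewrite Cpow_muln -Cpow_mult_l; f_equal; symmetry; apply CSeries_unique.
eapply Cis_series_ext; [|apply Cis_series_scal, (lambert_series _ Hp R R' H1 H3)].
intros n; rewrite series_term_odd_part_sum; unfold odd_part_sum, lambert_coef; rewrite Po_1.
assert (nz : forall m, (1 - q ^ m.+1)%C <> RtoC 0).
{ intros m; apply one_minus_neq0, Cmod_pow_lt1; auto. }
rewrite -!Cpow_muln.
replace ((2 * n + 1) * 2)%N with (2 * (2 * n).+1)%N by lia.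
rewrite addn1 (Cpow_S q (2 * n)%N).
replace (2 * (2 * n).+1)%N with (4 * n + 1).+1 by lia.
change (2 * 1)%N with 2%N; unfold Cdiv; ring.
Qed.

(** * The complex exponential *)

Lemma Cexp_plus z w : Cexp (z + w) = (Cexp z * Cexp w)%C.
Proof.
destruct z as [x y], w as [x' y']; unfold Cexp, Cplus, Cmult, Re, Im; simpl.
rewrite exp_plus cos_plus sin_plus; f_equal; ring.
Qed.

Lemma Cexp_0 : Cexp 0 = RtoC 1.
Proof. unfold Cexp; simpl; rewrite exp_0 cos_0 sin_0; apply injective_projections; simpl; ring. Qed.

Lemma Cmod_Cexp z : Cmod (Cexp z) = exp (Re z).
Proof.
unfold Cmod, Cexp; simpl.
replace (_ + _) with ((exp (Re z)) ^ 2).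
- replace (exp (Re z) ^ 2) with (Rsqr (exp (Re z))) by (unfold Rsqr; ring).
  apply sqrt_Rsqr; left; apply exp_pos.
- pose proof (sin2_cos2 (Im z)) as H; unfold Rsqr in H.
  transitivity (exp (Re z) ^ 2 * (sin (Im z) * sin (Im z) + cos (Im z) * cos (Im z))); [rewrite H|]; simpl; ring.
Qed.

Lemma Cexp_neq0 z : Cexp z <> RtoC 0.
Proof. intros E; pose proof (exp_pos (Re z)); rewrite -Cmod_Cexp E Cmod_0 in H; lra. Qed.

Lemma Cexp_opp z : Cexp (- z) = (/ Cexp z)%C.
Proof.
apply (Cmult_cancel_l (Cexp z)); [apply Cexp_neq0|].
rewrite -Cexp_plus Cplus_opp_r Cexp_0; field; apply Cexp_neq0.
Qed.

Lemma Cexp_INR n z : Cexp (RtoC (INR n) * z) = (Cexp z ^ n)%C.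
Proof.
induction n as [|n IH].
- rewrite Cmult_0_l Cexp_0; reflexivity.
- rewrite Cpow_S -IH -Cexp_plus S_INR RtoC_plus; f_equal; ring.
Qed.

Lemma fact_factorial n : Factorial.fact n = n`!.
Proof. induction n as [|n IH]; [reflexivity|rewrite factS -IH; reflexivity]. Qed.

Lemma INR_fact_gt0 n : 0 < INR n`!.
Proof. apply lt_0_INR; pose proof (fact_gt0 n); lia. Qed.

Lemma INR_factS n : INR (n.+1)`! = INR n.+1 * INR n`!.
Proof. rewrite factS -multE mult_INR; reflexivity. Qed.

Lemma RtoC_neq0 x : x <> 0 -> RtoC x <> RtoC 0.
Proof. intros H E; injection E; exact H. Qed.

Lemma Cis_series_RtoC (a : nat -> R) l : is_series a l -> Cis_series (fun n => RtoC (a n)) (RtoC l).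
Proof.
intros H; apply Cis_series_Clim; intros eps Heps.
assert (Hl : locally l (fun y => Rabs (y - l) < eps)) by (exists (mkposreal eps Heps); intros y Hy; exact Hy).
destruct (H _ Hl) as [N HN]; exists N; intros n Hn'; pose proof (HN n Hn') as Hn.
rewrite -RtoC_sum_n -RtoC_minus Cmod_R; exact Hn.
Qed.

Lemma is_series_shift_zeros (a : nat -> R) l k : is_series a l ->
  is_series (fun n => if (k <= n)%N then a (n - k)%N else 0) l.
Proof.
intros H; induction k as [|k IH].
- refine (is_series_ext _ _ _ _ H); intros n; rewrite subn0; reflexivity.
- apply (@is_series_decr_1 R_AbsRing R_NormedModule).
  match goal with |- is_series _ ?t => replace t with l; [exact IH|] end.
  unfold plus, opp; simpl; rewrite Ropp_0; symmetry; apply Rplus_0_r.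
Qed.

Lemma Cis_series_shift_zeros (a : nat -> C) l k : Cis_series a l ->
  Cis_series (fun n => if (k <= n)%N then a (n - k)%N else RtoC 0) l.
Proof.
intros H; induction k as [|k IH].
- refine (Cis_series_ext _ _ _ _ H); intros n; rewrite subn0; reflexivity.
- rewrite -(Cplus_0_l l); exact (Cis_series_S_inv
    (fun n => if (k.+1 <= n)%N then a (n - k.+1)%N else RtoC 0) _ IH).
Qed.

(* Mertens' theorem, as a triangular instance of Fubini. *)
Lemma Cis_series_mult u v s t : Cabs_series u -> Cabs_series v -> Cis_series u s -> Cis_series v t ->
  Cis_series (fun n => Csum (fun k => u k * v (n - k)%N)%C n) (s * t)%C.
Proof.
intros Au Av Hu Hv.
set (a := fun k n => (u k * (if (k <= n)%N then v (n - k)%N else 0))%C).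
assert (Hrow : forall k, Cis_series (a k) (u k * t)%C).
{ intros k; apply Cis_series_scal, Cis_series_shift_zeros, Hv. }
assert (Habs : forall k, is_series (fun n => Cmod (a k n)) (Cmod (u k) * Series (fun n => Cmod (v n)))).
{ intros k.
  apply (is_series_ext (fun n => Cmod (u k) * (if (k <= n)%N then Cmod (v (n - k)%N) else 0))).
  - intros n; unfold a; rewrite Cmod_mult; destruct (k <= n)%N; [reflexivity|now rewrite Cmod_0].
  - apply (@is_series_scal R_AbsRing R_NormedModule).
    apply (is_series_shift_zeros (fun n => Cmod (v n))), Series_correct, Av. }
destruct (Cabs_series_fubini a (fun k => Cmod (u k) * Series (fun n => Cmod (v n)))) as [_ H].
- intros k; eexists; apply Habs.
- intros k; right; apply is_series_unique, Habs.
- destruct Au as [l Hl]; exists (l * Series (fun n => Cmod (v n))).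
  apply is_series_scal_r, Hl.
- replace (CSeries (fun i => CSeries (a i))) with (s * t)%C in H.
  + refine (Cis_series_ext _ _ _ _ H); intros n; apply CSeries_unique.
    replace (Csum (fun k => u k * v (n - k)%N)%C n) with (Csum (fun k => a k n) n).
    * apply Cis_series_finite; intros i Hi; unfold a; replace (i <= n)%N with false by lia; ring.
    * apply Csum_ext; intros i Hi; unfold a; rewrite Hi; reflexivity.
  + symmetry; apply CSeries_unique.
    apply (Cis_series_ext (fun i => t * u i)%C).
    * intros i; rewrite (CSeries_unique _ _ (Hrow i)); ring.
    * rewrite Cmult_comm; apply Cis_series_scal, Hu.
Qed.

Definition exp_term (z : C) (n : nat) : C := (z ^ n * RtoC (/ INR n`!))%C.

Lemma exp_term_abs z : Cabs_series (exp_term z).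
Proof.
destruct (exist_exp (Cmod z)) as [l Hl]; apply is_series_Reals in Hl.
exists l; refine (is_series_ext _ _ _ _ Hl); intros n.
unfold exp_term; rewrite Cmod_mult Cmod_pow Cmod_R fact_factorial Rabs_pos_eq; [apply Rmult_comm|].
left; apply Rinv_0_lt_compat, INR_fact_gt0.
Qed.

Lemma exp_term_0 : CSeries (exp_term 0) = RtoC 1.
Proof.
apply CSeries_unique; replace (RtoC 1) with (Csum (exp_term 0) 0).
- apply Cis_series_finite; intros [|i] Hi; [discriminate|].
  unfold exp_term; rewrite Cpow_S; ring.
- rewrite Csum_O; unfold exp_term; rewrite fact0 Rinv_1; apply Cmult_1_l.
Qed.

Lemma exp_term_plus z w : CSeries (exp_term (z + w)) = (CSeries (exp_term z) * CSeries (exp_term w))%C.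
Proof.
destruct (Ceq_dec w 0) as [->|Hw]; [rewrite Cplus_0_r exp_term_0 Cmult_1_r; reflexivity|].
apply CSeries_unique.
eapply Cis_series_ext; [|apply Cis_series_mult; try apply Cabs_series_CSeries; apply exp_term_abs].
intros n; unfold exp_term; cbv beta.
(* This reduces the Cauchy product to the binomial formula for [1 + z/w]; the case [w = 0] was split
   off for this reason. *)
replace (z + w)%C with (w * (1 + z / w))%C by (field; exact Hw).
rewrite Cpow_mult_l (Cbinom _ n n (leqnn n)) Cmult_comm Cmult_assoc -Csum_scal.
apply Csum_ext; intros k Hk.
assert (E : INR 'C(n, k) * (INR k`! * INR (n - k)`!) = INR n`!).
{ rewrite -!mult_INR; f_equal; rewrite !multE; apply bin_fact, Hk. }
replace (w ^ n)%C with (w ^ k * w ^ (n - k)%N)%C by (rewrite -Cpow_addn; f_equal; lia).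
unfold Cdiv; rewrite Cpow_mult_l (Cpow_inv _ _ Hw) -E.
pose proof (INR_fact_gt0 k); pose proof (INR_fact_gt0 (n - k)).
assert (B : 0 < INR 'C(n, k)) by (apply lt_0_INR; pose proof (bin_gt0 n k); lia).
rewrite !Rinv_mult !RtoC_mult.
assert (Bz : (RtoC (INR 'C(n, k)) * RtoC (/ INR 'C(n, k)) = 1)%C).
{ rewrite -RtoC_mult Rinv_r; [reflexivity|lra]. }
transitivity (z ^ k * RtoC (/ INR k`!) * (w ^ (n - k)%N * RtoC (/ INR (n - k)`!)) *
   (RtoC (INR 'C(n, k)) * RtoC (/ INR 'C(n, k))))%C; [rewrite Bz; ring|].
field; apply Cpow_nz, Hw.
Qed.

Lemma exp_term_real x : CSeries (exp_term (RtoC x)) = RtoC (exp x).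
Proof.
apply CSeries_unique.
apply (Cis_series_ext (fun n => RtoC (/ INR (Factorial.fact n) * x ^ n))).
- intros n; unfold exp_term; rewrite fact_factorial RtoC_mult RtoC_pow; ring.
- apply Cis_series_RtoC, is_series_Reals; unfold exp; destruct (exist_exp x) as [l Hl]; exact Hl.
Qed.

Lemma exp_term_imag y : CSeries (exp_term (Ci * RtoC y)) = (RtoC (cos y) + Ci * RtoC (sin y))%C.
Proof.
pose proof (Cis_series_pairs _ _ (Cabs_series_CSeries _ (exp_term_abs (Ci * RtoC y)))) as H.
refine (Cis_series_unique _ _ _ H _); clear H.
assert (Ci2 : (Ci ^ 2 = - (1))%C) by (apply injective_projections; simpl; ring).
assert (e2 : forall n, ((Ci * RtoC y) ^ (2 * n)%N = RtoC ((-1) ^ n * (Rsqr y) ^ n))%C).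
{ intros n; rewrite Cpow_muln Cpow_mult_l Ci2 Cpow_mult_l RtoC_mult !RtoC_pow RtoC_m1.
  f_equal; f_equal; unfold Rsqr; rewrite RtoC_mult; simpl; ring. }
apply (Cis_series_ext (fun n => RtoC (cos_n n * (Rsqr y) ^ n) + Ci * RtoC (y * (sin_n n * (Rsqr y) ^ n)))%C).
- intros n; unfold exp_term.
  assert (E1 : cos_n n = (-1) ^ n * / INR (2 * n)%N`!) by (rewrite -fact_factorial; reflexivity).
  assert (E2 : sin_n n = (-1) ^ n * / INR (2 * n + 1)%N`!) by (rewrite -fact_factorial; reflexivity).
  rewrite E1 E2; replace ((Ci * RtoC y) ^ (2 * n + 1)%N)%C with ((Ci * RtoC y) * (Ci * RtoC y) ^ (2 * n)%N)%C
    by (rewrite addn1; reflexivity).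
  rewrite e2 !RtoC_mult; ring.
- apply Cis_series_plus; [|apply Cis_series_scal]; apply Cis_series_RtoC, is_series_Reals.
  + unfold cos; destruct (exist_cos (Rsqr y)) as [l Hl]; exact Hl.
  + unfold sin; destruct (exist_sin (Rsqr y)) as [l Hl].
    apply is_series_Reals, (@is_series_scal R_AbsRing R_NormedModule), is_series_Reals; exact Hl.
Qed.

(** [Cexp] is defined through real functions. Additivity of the power series reduces the claim to
    the real and the imaginary axis, where exp, cos and sin are themselves given by power series. *)
Lemma Cexp_series z : Cis_series (exp_term z) (Cexp z).
Proof.
replace (Cexp z) with (CSeries (exp_term z)); [apply Cabs_series_CSeries, exp_term_abs|].
destruct z as [x y].
replace (x, y) with (RtoC x + Ci * RtoC y)%C by (apply injective_projections; simpl; ring).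
rewrite exp_term_plus exp_term_real exp_term_imag.
unfold Cexp, Re, Im; apply injective_projections; simpl;
  replace (x + (0 * y - 1 * 0)) with x by ring; replace (0 + (0 * 0 + 1 * y)) with y by ring; ring.
Qed.

(** * Complex derivatives *)

(** Keeping the value of the derivative in the relation allows two expressions of one function to be
    differentiated and compared. *)
Definition Cderiv (f : C -> C) (z d : C) : Prop :=
  forall eps, 0 < eps -> exists del, 0 < del /\
    forall h, Cmod h < del -> Cmod (f (z + h)%C - f z - d * h)%C <= eps * Cmod h.

Lemma Cderiv_ex_derive f z d : Cderiv f z d -> @ex_derive C_AbsRing C_NormedModule f z.
Proof.
intros H; exists d; split.
- apply (@is_linear_scal_l C_AbsRing C_NormedModule d).
- intros x Hx.
  assert (E : z = x) by exact (@is_filter_lim_locally_unique C_AbsRing (AbsRing_NormedModule C_AbsRing) z x Hx).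
  subst x; intros eps.
  destruct (H eps (cond_pos eps)) as [del [D0 HD]].
  apply (@locally_norm_le_locally C_AbsRing (AbsRing_NormedModule C_AbsRing)).
  exists (mkposreal del D0); intros y Hy.
  specialize (HD (y - z)%C Hy).
  assert (E : forall a b : C, (a + (b - a))%C = b) by (intros a b; ring).
  rewrite E in HD.
  rewrite (Cmult_comm d) in HD; exact HD.
Qed.

Lemma Cderiv_ext_loc f g z d r : 0 < r -> (forall h, Cmod h < r -> f (z + h)%C = g (z + h)%C)%C ->
  Cderiv f z d -> Cderiv g z d.
Proof.
intros Hr E H eps Heps; destruct (H eps Heps) as [del [D0 HD]].
exists (Rmin r del); split; [apply Rmin_glb_lt; assumption|]; intros h Hh.
assert (E0 : f z = g z).
{ rewrite -(Cplus_0_r z); apply E; rewrite Cmod_0; exact Hr. }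
rewrite -E0 -E; [|eapply Rlt_le_trans; [exact Hh|apply Rmin_l]].
apply HD; eapply Rlt_le_trans; [exact Hh|apply Rmin_r].
Qed.

Lemma Cderiv_unique f z d e : Cderiv f z d -> Cderiv f z e -> d = e.
Proof.
intros Hd He.
assert (H : forall eps, 0 < eps -> Cmod (d - e) <= eps).
{ intros eps Heps; assert (h2 : 0 < eps / 2) by lra.
  destruct (Hd _ h2) as [d1 [D1 H1]]; destruct (He _ h2) as [d2 [D2 H2]].
  set (r := Rmin d1 d2 / 2); assert (R0 : 0 < Rmin d1 d2) by (apply Rmin_glb_lt; assumption).
  assert (Hr : Cmod (RtoC r) = r) by (rewrite Cmod_R Rabs_pos_eq; unfold r; lra).
  assert (L1 : Cmod (RtoC r) < d1) by (rewrite Hr; pose proof (Rmin_l d1 d2); unfold r; lra).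
  assert (L2 : Cmod (RtoC r) < d2) by (rewrite Hr; pose proof (Rmin_r d1 d2); unfold r; lra).
  specialize (H1 _ L1); specialize (H2 _ L2); rewrite Hr in H1 H2.
  assert (H3 : Cmod ((d - e) * RtoC r) <= eps * r).
  { replace ((d - e) * RtoC r)%C with
      ((f (z + RtoC r) - f z - e * RtoC r) - (f (z + RtoC r) - f z - d * RtoC r))%C by ring.
    eapply Rle_trans; [apply Cmod_triangle|]; rewrite Cmod_opp; lra. }
  rewrite Cmod_mult Hr in H3; apply (Rmult_le_reg_r r); [unfold r; lra|exact H3]. }
assert (Z : Cmod (d - e) <= 0).
{ apply Rnot_lt_le; intros L; specialize (H (Cmod (d - e) / 2)); lra. }
replace d with ((d - e) + e)%C by ring; rewrite (Cmod_eq_0 (d - e)); [ring|].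
apply Rle_antisym; [exact Z|apply Cmod_ge_0].
Qed.

Lemma Cderiv_const c z : Cderiv (fun _ => c) z 0.
Proof.
intros eps Heps; exists 1; split; [lra|]; intros h _.
replace (c - c - 0 * h)%C with (RtoC 0) by ring; rewrite Cmod_0.
apply Rmult_le_pos; [lra|apply Cmod_ge_0].
Qed.

Lemma Cderiv_id z : Cderiv (fun x => x) z 1.
Proof.
intros eps Heps; exists 1; split; [lra|]; intros h _.
replace (z + h - z - 1 * h)%C with (RtoC 0) by ring; rewrite Cmod_0.
apply Rmult_le_pos; [lra|apply Cmod_ge_0].
Qed.

Lemma Cderiv_plus f g z d e : Cderiv f z d -> Cderiv g z e -> Cderiv (fun x => f x + g x)%C z (d + e)%C.
Proof.
intros Hf Hg eps Heps; assert (h2 : 0 < eps / 2) by lra.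
destruct (Hf _ h2) as [d1 [D1 H1]]; destruct (Hg _ h2) as [d2 [D2 H2]].
exists (Rmin d1 d2); split; [apply Rmin_glb_lt; assumption|]; intros h Hh.
assert (L1 : Cmod h < d1) by (eapply Rlt_le_trans; [exact Hh|apply Rmin_l]).
assert (L2 : Cmod h < d2) by (eapply Rlt_le_trans; [exact Hh|apply Rmin_r]).
specialize (H1 _ L1); specialize (H2 _ L2).
replace (f (z + h)%C + g (z + h)%C - (f z + g z) - (d + e) * h)%C
  with ((f (z + h)%C - f z - d * h) + (g (z + h)%C - g z - e * h))%C by ring.
eapply Rle_trans; [apply Cmod_triangle|lra].
Qed.

Lemma Cderiv_lipschitz f z d : Cderiv f z d -> exists del K, 0 < del /\ 0 < K /\
  forall h, Cmod h < del -> Cmod (f (z + h)%C - f z)%C <= K * Cmod h.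
Proof.
intros H; destruct (H 1 Rlt_0_1) as [del [D0 HD]].
exists del, (1 + Cmod d); split; [exact D0|split; [pose proof (Cmod_ge_0 d); lra|]].
intros h Hh; specialize (HD h Hh).
replace (f (z + h)%C - f z)%C with ((f (z + h)%C - f z - d * h) + d * h)%C by ring.
eapply Rle_trans; [apply Cmod_triangle|]; rewrite Cmod_mult; lra.
Qed.

Lemma Cderiv_mult f g z d e : Cderiv f z d -> Cderiv g z e ->
  Cderiv (fun x => f x * g x)%C z (d * g z + f z * e)%C.
Proof.
intros Hf Hg eps Heps.
destruct (Cderiv_lipschitz _ _ _ Hf) as [d0 [K [D0 [K0 HK]]]].
destruct (Cderiv_lipschitz _ _ _ Hg) as [d0' [K' [D0' [K0' HK']]]].
pose proof (Cmod_ge_0 (g z)) as G0; pose proof (Cmod_ge_0 (f z)) as F0.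
assert (e1 : 0 < eps / (3 * (1 + Cmod (g z)))) by (apply Rdiv_lt_0_compat; lra).
assert (e2 : 0 < eps / (3 * (1 + Cmod (f z)))) by (apply Rdiv_lt_0_compat; lra).
destruct (Hf _ e1) as [d1 [D1 H1]]; destruct (Hg _ e2) as [d2 [D2 H2]].
assert (e3 : 0 < eps / (3 * (K * K'))) by (apply Rdiv_lt_0_compat; [lra|nra]).
exists (Rmin (Rmin d0 d0') (Rmin (Rmin d1 d2) (eps / (3 * (K * K'))))); split.
{ repeat apply Rmin_glb_lt; assumption. }
intros h Hh.
assert (L : Cmod h < d0 /\ Cmod h < d0' /\ Cmod h < d1 /\ Cmod h < d2 /\ Cmod h < eps / (3 * (K * K'))).
{ repeat match goal with H : _ < Rmin ?a ?b |- _ =>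
    pose proof (Rlt_le_trans _ _ _ H (Rmin_l a b)); pose proof (Rlt_le_trans _ _ _ H (Rmin_r a b)); clear H end.
  tauto. }
destruct L as [L0 [L0' [L1 [L2 L3]]]].
specialize (HK h L0); specialize (HK' h L0'); specialize (H1 h L1); specialize (H2 h L2).
pose proof (Cmod_ge_0 h) as h0.
replace (f (z + h)%C * g (z + h)%C - f z * g z - (d * g z + f z * e) * h)%C
  with ((f (z + h)%C - f z - d * h) * g z + f z * (g (z + h)%C - g z - e * h)
        + (f (z + h)%C - f z) * (g (z + h)%C - g z))%C by ring.
eapply Rle_trans; [apply Cmod_triangle|]; eapply Rle_trans; [apply Rplus_le_compat_r, Cmod_triangle|].
rewrite !Cmod_mult.
assert (A1 : Cmod (f (z + h)%C - f z - d * h) * Cmod (g z) <= eps / 3 * Cmod h).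
{ apply Rle_trans with (eps / (3 * (1 + Cmod (g z))) * Cmod h * Cmod (g z)).
  - apply Rmult_le_compat_r; assumption.
  - apply Rle_trans with (eps / (3 * (1 + Cmod (g z))) * Cmod h * (1 + Cmod (g z))).
    + apply Rmult_le_compat_l; [apply Rmult_le_pos; lra|lra].
    + right; field; lra. }
assert (A2 : Cmod (f z) * Cmod (g (z + h)%C - g z - e * h) <= eps / 3 * Cmod h).
{ apply Rle_trans with (Cmod (f z) * (eps / (3 * (1 + Cmod (f z))) * Cmod h)).
  - apply Rmult_le_compat_l; assumption.
  - apply Rle_trans with ((1 + Cmod (f z)) * (eps / (3 * (1 + Cmod (f z))) * Cmod h)).
    + apply Rmult_le_compat_r; [apply Rmult_le_pos; lra|lra].
    + right; field; lra. }
assert (A3 : Cmod (f (z + h)%C - f z) * Cmod (g (z + h)%C - g z) <= eps / 3 * Cmod h).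
{ apply Rle_trans with ((K * Cmod h) * (K' * Cmod h)).
  - apply Rmult_le_compat; try apply Cmod_ge_0; assumption.
  - apply Rle_trans with ((K * K') * Cmod h * (eps / (3 * (K * K')))).
    + replace ((K * Cmod h) * (K' * Cmod h)) with ((K * K') * Cmod h * Cmod h) by ring.
      apply Rmult_le_compat_l; [apply Rmult_le_pos; nra|lra].
    + right; field; lra. }
lra.
Qed.

Lemma Cderiv_comp f g z d e : Cderiv f z d -> Cderiv g (f z) e -> Cderiv (fun x => g (f x)) z (e * d)%C.
Proof.
intros Hf Hg eps Heps.
destruct (Cderiv_lipschitz _ _ _ Hf) as [d0 [K [D0 [K0 HK]]]].
pose proof (Cmod_ge_0 e) as E0.
assert (e1 : 0 < eps / (2 * (1 + Cmod e))) by (apply Rdiv_lt_0_compat; lra).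
assert (e2 : 0 < eps / (2 * K)) by (apply Rdiv_lt_0_compat; lra).
destruct (Hf _ e1) as [d1 [D1 H1]]; destruct (Hg _ e2) as [d2 [D2 H2]].
assert (e3 : 0 < d2 / K) by (apply Rdiv_lt_0_compat; lra).
exists (Rmin d0 (Rmin d1 (d2 / K))); split; [repeat apply Rmin_glb_lt; assumption|].
intros h Hh.
assert (L : Cmod h < d0 /\ Cmod h < d1 /\ Cmod h < d2 / K).
{ repeat match goal with H : _ < Rmin ?a ?b |- _ =>
    pose proof (Rlt_le_trans _ _ _ H (Rmin_l a b)); pose proof (Rlt_le_trans _ _ _ H (Rmin_r a b)); clear H end.
  tauto. }
destruct L as [L0 [L1 L2]]; specialize (HK h L0); specialize (H1 h L1); pose proof (Cmod_ge_0 h) as h0.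
assert (L3 : Cmod (f (z + h)%C - f z) < d2).
{ eapply Rle_lt_trans; [exact HK|]; apply (Rmult_lt_compat_l K) in L2; [|exact K0].
  replace (K * (d2 / K)) with d2 in L2 by (field; lra); exact L2. }
specialize (H2 _ L3); replace (f z + (f (z + h)%C - f z))%C with (f (z + h)%C) in H2 by ring.
replace (g (f (z + h)%C) - g (f z) - e * d * h)%C
  with ((g (f (z + h)%C) - g (f z) - e * (f (z + h)%C - f z)) + e * (f (z + h)%C - f z - d * h))%C by ring.
eapply Rle_trans; [apply Cmod_triangle|]; rewrite (Cmod_mult e).
assert (A1 : Cmod (g (f (z + h)%C) - g (f z) - e * (f (z + h)%C - f z)) <= eps / 2 * Cmod h).
{ eapply Rle_trans; [exact H2|]; apply Rle_trans with (eps / (2 * K) * (K * Cmod h)).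
  - apply Rmult_le_compat_l; lra.
  - right; field; lra. }
assert (A2 : Cmod e * Cmod (f (z + h)%C - f z - d * h) <= eps / 2 * Cmod h).
{ apply Rle_trans with ((1 + Cmod e) * (eps / (2 * (1 + Cmod e)) * Cmod h)).
  - apply Rmult_le_compat; try lra; apply Cmod_ge_0.
  - right; field; lra. }
lra.
Qed.

Lemma Cderiv_scal c f z d : Cderiv f z d -> Cderiv (fun x => c * f x)%C z (c * d)%C.
Proof.
intros H; replace (c * d)%C with (0 * f z + c * d)%C by ring.
apply Cderiv_mult; [apply Cderiv_const|exact H].
Qed.

Lemma Cderiv_pow f z d n : Cderiv f z d -> exists e, Cderiv (fun x => f x ^ n)%C z e.
Proof.
intros H; induction n as [|n [e IH]]; [exists 0%C; apply (Cderiv_const 1)|].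
eexists; exact (Cderiv_mult _ _ _ _ _ H IH).
Qed.

(** A derivative with an explicit quadratic remainder on a fixed disk. Such remainders can be
    summed, so that series are differentiated term by term from a summable family of constants. *)
Definition quad_deriv (f : C -> C) (z d : C) (M del : R) : Prop :=
  forall h, Cmod h < del -> Cmod (f (z + h)%C - f z - d * h)%C <= M * Cmod h ^ 2.

Lemma quad_deriv_Cderiv f z d M del : 0 < del -> quad_deriv f z d M del -> Cderiv f z d.
Proof.
intros Hd H eps Heps.
assert (e1 : 0 < eps / (1 + Rabs M)) by (apply Rdiv_lt_0_compat; [lra|pose proof (Rabs_pos M); lra]).
exists (Rmin del (eps / (1 + Rabs M))); split; [apply Rmin_glb_lt; assumption|]; intros h Hh.
pose proof (Cmod_ge_0 h) as h0; pose proof (Rabs_pos M) as M0; pose proof (Rle_abs M) as M1.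
assert (L1 : Cmod h < del) by (eapply Rlt_le_trans; [exact Hh|apply Rmin_l]).
assert (L2 : Cmod h < eps / (1 + Rabs M)) by (eapply Rlt_le_trans; [exact Hh|apply Rmin_r]).
eapply Rle_trans; [apply H, L1|].
apply Rle_trans with ((1 + Rabs M) * Cmod h * (eps / (1 + Rabs M))); [|right; field; lra].
apply Rle_trans with ((1 + Rabs M) * Cmod h * Cmod h).
- simpl; rewrite Rmult_1_r Rmult_assoc; apply Rmult_le_compat_r; [apply Rmult_le_pos; assumption|lra].
- apply Rmult_le_compat_l; [apply Rmult_le_pos; lra|lra].
Qed.

Lemma quad_deriv_series (f : nat -> C -> C) (F : C -> C) z (d : nat -> C) D (M : nat -> R) del :
  0 < del -> (forall n, quad_deriv (f n) z (d n) (M n) del) -> ex_series M ->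
  (forall h, Cmod h < del -> Cis_series (fun n => f n (z + h)%C) (F (z + h)%C)) ->
  Cis_series d D -> quad_deriv F z D (Series M) del.
Proof.
intros Hd Hf HM HF HD h Hh.
assert (H0 : Cis_series (fun n => f n z) (F z)).
{ rewrite -(Cplus_0_r z); apply HF; rewrite Cmod_0; exact Hd. }
rewrite Rmult_comm -Series_scal_l.
apply (Cis_series_Cmod_le (fun n => f n (z + h) - f n z - h * d n)%C).
- rewrite (Cmult_comm D); apply Cis_series_minus; [apply Cis_series_minus; [apply HF, Hh|exact H0]|].
  apply Cis_series_scal, HD.
- intros n; rewrite (Cmult_comm h) (Rmult_comm (_ ^ 2)); apply Hf, Hh.
- apply (@ex_series_scal_l R_AbsRing R_NormedModule), HM.
Qed.

(** The remainder constant is [n^2 rho^(n-2)], written with [/ rho ^ 2] so that [n = 0] and [n = 1]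
    involve no truncated subtraction. *)
Lemma quad_deriv_monomial n z rho del : 0 < rho -> Cmod z + del <= rho ->
  quad_deriv (fun x => x ^ n)%C z (RtoC (INR n) * z ^ (n.-1))%C (INR n ^ 2 * rho ^ n * / rho ^ 2) del.
Proof.
intros Hr Hz h Hh; pose proof (Cmod_ge_0 h) as h0; pose proof (Cmod_ge_0 z) as z0.
assert (zh : Cmod (z + h) <= rho) by (eapply Rle_trans; [apply Cmod_triangle|lra]).
pose proof (Rinv_0_lt_compat _ Hr) as r1.
induction n as [|[|n] IH].
- simpl; replace (1 - 1 - 0 * 1 * h)%C with (RtoC 0) by ring; rewrite Cmod_0; lra.
- simpl INR; simpl predn; rewrite !Cpow_1_r; replace (z + h - z - 1 * z ^ 0 * h)%C with (RtoC 0) by (simpl; ring).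
  rewrite Cmod_0; apply Rmult_le_pos; [|apply pow_le; exact h0].
  apply Rmult_le_pos; [|left; apply Rinv_0_lt_compat, pow_lt, Hr]; simpl; nra.
- simpl predn in IH |- *.
  (* The remainder for [n + 2] is [z + h] times the remainder for [n + 1], plus a term in [h^2]. *)
  replace ((z + h) ^ n.+2 - z ^ n.+2 - RtoC (INR n.+2) * z ^ n.+1 * h)%C with
    ((z + h) * ((z + h) ^ n.+1 - z ^ n.+1 - RtoC (INR n.+1) * z ^ n * h)
      + RtoC (INR n.+1) * z ^ n * (h * h))%C by (rewrite (S_INR n.+1) RtoC_plus !Cpow_S; ring).
  eapply Rle_trans; [apply Cmod_triangle|]; rewrite (Cmod_mult (z + h)) !Cmod_mult Cmod_R Cmod_pow.
  rewrite Rabs_pos_eq; [|apply pos_INR].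
  assert (zn : Cmod z ^ n <= rho ^ n) by (apply pow_incr; lra).
  pose proof (pow_lt rho n Hr) as rn; pose proof (pos_INR n.+1) as n0.
  assert (h2 : 0 <= Cmod h * Cmod h) by nra.
  apply Rle_trans with (rho * (INR n.+1 ^ 2 * rho ^ n.+1 * / rho ^ 2 * Cmod h ^ 2)
     + INR n.+1 * rho ^ n * (Cmod h * Cmod h)).
  + apply Rplus_le_compat; [apply Rmult_le_compat; try apply Cmod_ge_0; assumption|].
    apply Rmult_le_compat_r; [exact h2|]; apply Rmult_le_compat_l; assumption.
  + rewrite (S_INR n.+1).
    replace (rho * (INR n.+1 ^ 2 * rho ^ n.+1 * / rho ^ 2 * Cmod h ^ 2) + INR n.+1 * rho ^ n * (Cmod h * Cmod h))
      with (rho ^ n * (Cmod h * Cmod h) * (INR n.+1 ^ 2 + INR n.+1)) by (simpl; field; lra).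
    replace ((INR n.+1 + 1) ^ 2 * rho ^ n.+2 * / rho ^ 2 * Cmod h ^ 2)
      with (rho ^ n * (Cmod h * Cmod h) * (INR n.+1 + 1) ^ 2) by (simpl; field; lra).
    apply Rmult_le_compat_l; [apply Rmult_le_pos; lra|nra].
Qed.

(** * Power series on the open unit disk *)

Definition disk_coef (a : nat -> C) : Prop :=
  forall r, 0 <= r < 1 -> ex_series (fun n => Cmod (a n) * r ^ n).

Lemma disk_coef_pow_mult a p r : disk_coef a -> 0 <= r < 1 ->
  ex_series (fun n => INR n ^ p * (Cmod (a n) * r ^ n)).
Proof.
intros Ha Hr; destruct (pow_geom_bound p r Hr) as [rho [K [H1 [HK H2]]]].
apply (@ex_series_le R_AbsRing R_CompleteNormedModule _ (fun n => K * (Cmod (a n) * rho ^ n))).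
- intros n; unfold norm; simpl; unfold abs; simpl; pose proof (Cmod_ge_0 (a n)).
  rewrite Rabs_pos_eq.
  + replace (INR n ^ p * (Cmod (a n) * r ^ n)) with (Cmod (a n) * (INR n ^ p * r ^ n)) by ring.
    replace (K * (Cmod (a n) * rho ^ n)) with (Cmod (a n) * (K * rho ^ n)) by ring.
    apply Rmult_le_compat_l; [assumption|apply H2].
  + apply Rmult_le_pos; [apply pow_le, pos_INR|apply Rmult_le_pos; [assumption|apply pow_le; lra]].
- apply (@ex_series_scal_l R_AbsRing R_NormedModule), Ha; lra.
Qed.

Definition deriv_coef (a : nat -> C) (n : nat) : C := (RtoC (INR n.+1) * a n.+1)%C.

Lemma disk_coef_deriv a : disk_coef a -> disk_coef (deriv_coef a).
Proof.
intros Ha r Hr; set (r' := (1 + r) / 2).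
pose proof (disk_coef_pow_mult a 1 r' Ha) as H; unfold r' in H.
assert (Hr' : 0 <= (1 + r) / 2 < 1) by lra; specialize (H Hr'); fold r' in H, Hr'.
apply (ex_series_incr_1 (V := R_NormedModule)) in H.
apply (@ex_series_le R_AbsRing R_CompleteNormedModule _
  (fun n => / r' * (INR n.+1 ^ 1 * (Cmod (a n.+1) * r' ^ n.+1)))).
- intros n; unfold norm; simpl; unfold abs; simpl; pose proof (Cmod_ge_0 (deriv_coef a n)) as d0.
  rewrite Rabs_pos_eq; [|apply Rmult_le_pos; [exact d0|apply pow_le; lra]].
  change (match n with 0%N => 1 | _.+1 => INR n + 1 end) with (INR n.+1).
  unfold deriv_coef; rewrite Cmod_mult Cmod_R Rabs_pos_eq; [|apply pos_INR].
  apply Rle_trans with (INR n.+1 * Cmod (a n.+1) * r' ^ n).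
  + apply Rmult_le_compat_l; [apply Rmult_le_pos; [apply pos_INR|apply Cmod_ge_0]|].
    apply pow_incr; unfold r'; lra.
  + right; simpl; field; unfold r'; lra.
- apply (@ex_series_scal_l R_AbsRing R_NormedModule), H.
Qed.

Definition Cpseries (a : nat -> C) (z : C) : C := CSeries (fun n => a n * z ^ n)%C.

Lemma Cpseries_abs a z : disk_coef a -> Cmod z < 1 -> Cabs_series (fun n => a n * z ^ n)%C.
Proof.
intros Ha Hz.
refine (ex_series_ext (fun n => Cmod (a n) * Cmod z ^ n) _ _ _).
- intros n; rewrite Cmod_mult Cmod_pow; reflexivity.
- apply Ha; split; [apply Cmod_ge_0|exact Hz].
Qed.

Lemma Cpseries_is_series a z : disk_coef a -> Cmod z < 1 ->
  Cis_series (fun n => a n * z ^ n)%C (Cpseries a z).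
Proof. intros Ha Hz; apply Cabs_series_CSeries, Cpseries_abs; assumption. Qed.

Lemma quad_deriv_scal c f z d M del : quad_deriv f z d M del ->
  quad_deriv (fun x => c * f x)%C z (c * d)%C (Cmod c * M) del.
Proof.
intros H h Hh; replace (c * f (z + h)%C - c * f z - c * d * h)%C with (c * (f (z + h)%C - f z - d * h))%C by ring.
rewrite Cmod_mult Rmult_assoc; apply Rmult_le_compat_l; [apply Cmod_ge_0|apply H, Hh].
Qed.

Lemma Cpseries_deriv a z : disk_coef a -> Cmod z < 1 ->
  Cderiv (Cpseries a) z (Cpseries (deriv_coef a) z).
Proof.
intros Ha Hz; set (del := (1 - Cmod z) / 2); set (rho := (1 + Cmod z) / 2).
pose proof (Cmod_ge_0 z) as z0.
assert (D0 : 0 < del) by (unfold del; lra).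
apply (quad_deriv_Cderiv _ _ _ (Series (fun n => Cmod (a n) * (INR n ^ 2 * rho ^ n * / rho ^ 2))) del); [exact D0|].
apply (quad_deriv_series (fun n x => a n * x ^ n)%C _ _ (fun n => a n * (RtoC (INR n) * z ^ (n.-1)))%C); [exact D0| | | |].
- intros n; apply quad_deriv_scal, quad_deriv_monomial; unfold rho, del; lra.
- refine (ex_series_ext (fun n => / rho ^ 2 * (INR n ^ 2 * (Cmod (a n) * rho ^ n))) _ _ _).
  + intros n; simpl; field; unfold rho; lra.
  + apply (@ex_series_scal_l R_AbsRing R_NormedModule), disk_coef_pow_mult; [exact Ha|unfold rho; lra].
- intros h Hh; apply Cpseries_is_series; [exact Ha|].
  eapply Rle_lt_trans; [apply Cmod_triangle|unfold del in Hh; lra].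
- replace (Cpseries (deriv_coef a) z) with (a 0%N * (RtoC (INR 0) * z ^ 0) + Cpseries (deriv_coef a) z)%C
    by (simpl; ring).
  apply (Cis_series_S_inv (fun n => a n * (RtoC (INR n) * z ^ (n.-1)))%C).
  eapply Cis_series_ext; [|apply Cpseries_is_series; [apply disk_coef_deriv, Ha|exact Hz]].
  intros n; unfold deriv_coef; simpl predn; ring.
Qed.

(** * Bernoulli numbers and polylogarithms near 1 *)

Lemma Cderiv_inv z : z <> RtoC 0 -> Cderiv Cinv z (- / (z * z))%C.
Proof.
intros Hz; assert (z0 : 0 < Cmod z) by now apply Cmod_gt_0.
apply (quad_deriv_Cderiv _ _ _ (2 * / Cmod z ^ 3) (Cmod z / 2)); [lra|]; intros h Hh.
assert (L : Cmod z / 2 <= Cmod (z + h)).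
{ pose proof (Cmod_triangle (z + h) (- h)) as T; rewrite Cmod_opp in T.
  replace (z + h + - h)%C with z in T by ring; lra. }
assert (zh : (z + h)%C <> RtoC 0) by (apply Cmod_gt_0; lra).
replace (/ (z + h) - / z - - / (z * z) * h)%C with (h ^ 2 * (/ z ^ 2 * / (z + h)))%C
  by (simpl; field; split; assumption).
rewrite (Cmod_mult (h ^ 2)) Cmod_pow (Rmult_comm (Cmod h ^ 2)); apply Rmult_le_compat_r; [apply pow_le, Cmod_ge_0|].
rewrite (Cmod_mult (/ z ^ 2)) (Cmod_inv _ zh) (Cmod_inv _ (Cpow_nz _ 2 Hz)) Cmod_pow.
replace (2 * / Cmod z ^ 3) with (/ Cmod z ^ 2 * / (Cmod z / 2)) by (simpl; field; lra).
apply Rmult_le_compat_l; [left; apply Rinv_0_lt_compat, pow_lt, z0|apply Rinv_le_contravar; lra].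
Qed.

Lemma Cexp_remainder : exists K, 0 < K /\
  forall h, Cmod h <= 1 -> Cmod (Cexp h - 1 - h)%C <= K * Cmod h ^ 2.
Proof.
assert (E : ex_series (fun n => / INR (n.+2)`!)).
{ pose proof (exp_term_abs 1) as H.
  apply (ex_series_incr_1 (V := R_NormedModule)), (ex_series_incr_1 (V := R_NormedModule)) in H.
  refine (ex_series_ext _ _ _ H); intros n; unfold exp_term.
  rewrite Cpow_1_l Cmult_1_l Cmod_R Rabs_pos_eq; [reflexivity|left; apply Rinv_0_lt_compat, INR_fact_gt0]. }
exists (Series (fun n => / INR (n.+2)`!)); split.
{ apply Rlt_le_trans with (sum_n (fun n => / INR (n.+2)`!) 0).
  - rewrite sum_O; apply Rinv_0_lt_compat, INR_fact_gt0.
  - apply sum_n_le_Series; [intros i; left; apply Rinv_0_lt_compat, INR_fact_gt0|exact E]. }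
intros h Hh; rewrite Rmult_comm -Series_scal_l.
apply (Cis_series_Cmod_le (fun n => exp_term h n.+2)).
- pose proof (Cexp_series h) as H.
  apply (Cis_series_S (fun n => exp_term h n.+1)), Cis_series_S.
  replace (Cexp h - 1 - h + exp_term h 1 + exp_term h 0)%C with (Cexp h); [exact H|].
  unfold exp_term; rewrite Cpow_1_r (fact0) (factS 0) fact0 Rinv_1; simpl Cpow; ring.
- intros n; unfold exp_term; rewrite Cmod_mult Cmod_R Rabs_pos_eq;
    [|left; apply Rinv_0_lt_compat, INR_fact_gt0].
  apply Rmult_le_compat_r; [left; apply Rinv_0_lt_compat, INR_fact_gt0|].
  rewrite Cmod_pow; simpl; pose proof (Cmod_ge_0 h).
  assert (Cmod h ^ n <= 1) by (apply pow_le_1; lra).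
  rewrite Rmult_1_r -Rmult_assoc -[X in _ <= X]Rmult_1_r; apply Rmult_le_compat_l; [nra|assumption].
- apply (@ex_series_scal_l R_AbsRing R_NormedModule), E.
Qed.

Lemma Cderiv_Cexp z : Cderiv Cexp z (Cexp z).
Proof.
destruct Cexp_remainder as [K [K0 HK]].
apply (quad_deriv_Cderiv _ _ _ (Cmod (Cexp z) * K) 1); [lra|]; intros h Hh.
replace (Cexp (z + h) - Cexp z - Cexp z * h)%C with (Cexp z * (Cexp h - 1 - h))%C by (rewrite Cexp_plus; ring).
rewrite Cmod_mult Rmult_assoc; apply Rmult_le_compat_l; [apply Cmod_ge_0|apply HK; lra].
Qed.

(** * Bernoulli numbers and their generating function *)

Lemma size_bernoulli_seq n : size (bernoulli_seq n) = n.+1.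
Proof. by elim: n => [//|n IH]; rewrite /= size_rcons IH. Qed.

Lemma nth_bernoulli_seq n i : (i <= n)%N -> nth 0 (bernoulli_seq n) i = bernoulli i.
Proof.
elim: n => [|n IH] Hi; first by have -> : i = 0%N by lia.
have [E|/eqP E] := eqVneq i n.+1; first by rewrite E.
rewrite [bernoulli_seq _]/= nth_rcons size_bernoulli_seq.
have -> : (i < n.+1)%N by lia.
by apply: IH; lia.
Qed.

Lemma bernoulli_S n :
  bernoulli n.+1 = - sum_n (fun i => INR 'C(n.+2, i) * bernoulli i) n / INR n.+2.
Proof.
rewrite /bernoulli [bernoulli_seq _]/= nth_rcons size_bernoulli_seq ltnn eqxx.
do 2 f_equal.
apply sum_n_ext_loc; intros i Hi; f_equal; apply nth_bernoulli_seq; lia.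
Qed.

Lemma sum_n_scal_R c (f : nat -> R) n : sum_n (fun i => c * f i) n = c * sum_n f n.
Proof. exact (@sum_n_mult_l R_Ring c f n). Qed.

(* Coefficients of t / (exp t - 1). *)
Definition todd (n : nat) : R := bernoulli n / INR n`!.

Lemma todd_0 : todd 0 = 1.
Proof. unfold todd, bernoulli; simpl; lra. Qed.

Lemma todd_S n : todd n.+1 = - sum_n (fun i => todd i * / INR (n.+2 - i)`!) n.
Proof.
unfold todd at 1; rewrite bernoulli_S.
pose proof (INR_fact_gt0 n.+1) as F0; pose proof (lt_0_INR n.+2 (Nat.lt_0_succ _)) as N0.
replace (sum_n (fun i => todd i * / INR (n.+2 - i)`!) n)
  with (sum_n (fun i => / INR (n.+2)`! * (INR 'C(n.+2, i) * bernoulli i)) n).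
- rewrite sum_n_scal_R (INR_factS n.+1); set (S := sum_n _ n).
  transitivity (- (/ (INR n.+2 * INR (n.+1)`!) * S)); [field; split; lra|reflexivity].
- apply sum_n_ext_loc; intros i Hi.
  assert (Hi' : (i <= n.+2)%N) by lia.
  assert (E : INR 'C(n.+2, i) * (INR i`! * INR (n.+2 - i)`!) = INR (n.+2)`!).
  { rewrite -!mult_INR; f_equal; rewrite !multE; apply bin_fact, Hi'. }
  unfold todd; rewrite -E.
  pose proof (INR_fact_gt0 i); pose proof (INR_fact_gt0 (n.+2 - i)).
  assert (B : 0 < INR 'C(n.+2, i)) by (apply lt_0_INR; pose proof (bin_gt0 n.+2 i); lia).
  match goal with |- ?a = ?b => change (@eq R a b) end; field; repeat split; lra.
Qed.

Lemma INR_fact_ge_pow2 n : 2 ^ n <= INR (n.+1)`!.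
Proof.
induction n as [|n IH]; [rewrite factS fact0; simpl; lra|].
rewrite INR_factS; change (2 ^ n.+1) with (2 * 2 ^ n).
apply Rmult_le_compat; [lra|apply pow_le; lra| |exact IH].
rewrite !S_INR; pose proof (pos_INR n); lra.
Qed.

(** A crude bound that suffices for convergence on the unit disk. As [(m+1)!] is at least [2^m], the
    recursion is dominated by the geometric sum [1/2 + 1/4 + ...], which stops before reaching 1. *)
Lemma todd_bound n : Rabs (todd n) <= 1.
Proof.
induction n as [n IH] using (well_founded_induction Wf_nat.lt_wf).
destruct n as [|n]; [rewrite todd_0 Rabs_R1; lra|].
rewrite todd_S Rabs_Ropp.
apply Rle_trans with (1 - / 2 ^ n.+1); [|pose proof (Rinv_0_lt_compat _ (pow_lt 2 n.+1 Rlt_0_2)); lra].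
assert (H : forall m, (m <= n)%N ->
  Rabs (sum_n (fun i => todd i * / INR (n.+2 - i)`!) m) <= / 2 ^ (n - m)%N - / 2 ^ n.+1).
{ induction m as [|m IHm]; intros Hm.
  - rewrite sum_O todd_0 !subn0 Rmult_1_l Rabs_pos_eq; [|left; apply Rinv_0_lt_compat, INR_fact_gt0].
    apply Rle_trans with (/ 2 ^ n.+1).
    + apply Rinv_le_contravar; [apply pow_lt; lra|apply INR_fact_ge_pow2].
    + pose proof (pow_lt 2 n Rlt_0_2); right; simpl; field; lra.
  - rewrite sum_Sn; change (plus ?x ?y) with (x + y); eapply Rle_trans; [apply Rabs_triang|].
    assert (Hm' : (m <= n)%N) by lia; specialize (IHm Hm').
    assert (T : Rabs (todd m.+1 * / INR (n.+2 - m.+1)`!) <= / 2 ^ (n - m)%N).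
    { rewrite Rabs_mult -(Rmult_1_l (/ 2 ^ _)); apply Rmult_le_compat; try apply Rabs_pos.
      - apply IH; lia.
      - rewrite Rabs_pos_eq; [|left; apply Rinv_0_lt_compat, INR_fact_gt0].
        apply Rinv_le_contravar; [apply pow_lt; lra|].
        replace (n.+2 - m.+1)%N with (n - m).+1 by lia; apply INR_fact_ge_pow2. }
    replace (n - m)%N with (n - m.+1).+1 in IHm, T by lia.
    pose proof (pow_lt 2 (n - m.+1)%N Rlt_0_2).
    replace (/ 2 ^ (n - m.+1)%N) with (/ 2 ^ (n - m.+1).+1 + / 2 ^ (n - m.+1).+1); [lra|].
    simpl; field; lra. }
specialize (H n (leqnn n)); rewrite subnn in H; simpl (2 ^ 0) in H; rewrite Rinv_1 in H; exact H.
Qed.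

Lemma disk_coef_bounded a B : (forall n, Cmod (a n) <= B) -> disk_coef a.
Proof.
intros H r Hr; apply (@ex_series_le R_AbsRing R_CompleteNormedModule _ (fun n => B * r ^ n)).
- intros n; unfold norm; simpl; unfold abs; simpl; pose proof (Cmod_ge_0 (a n)).
  pose proof (pow_le r n (proj1 Hr)); rewrite Rabs_pos_eq; [|apply Rmult_le_pos; assumption].
  apply Rmult_le_compat_r; [assumption|apply H].
- apply ex_series_geom_scal, Hr.
Qed.

Lemma todd_disk : disk_coef (fun n => RtoC (todd n)).
Proof. apply (disk_coef_bounded _ 1); intros n; rewrite Cmod_R; apply todd_bound. Qed.

(** In the Cauchy product, the recursion for the Bernoulli numbers says exactly that every
    coefficient beyond that of [t] vanishes. *)
Lemma todd_exp t : Cmod t < 1 -> (Cpseries (fun n => RtoC (todd n)) t * (Cexp t - 1) = t)%C.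
Proof.
intros Ht.
assert (He : Cis_series (fun n => t ^ n.+1 * RtoC (/ INR (n.+1)`!))%C (Cexp t - 1)%C).
{ apply (Cis_series_S (exp_term t)); unfold exp_term at 2; rewrite fact0 Rinv_1.
  replace (Cexp t - 1 + t ^ 0 * 1)%C with (Cexp t) by (simpl; ring); apply Cexp_series. }
pose proof (Cis_series_mult _ _ _ _ (Cpseries_abs _ t todd_disk Ht)
  (proj1 (ex_series_incr_1 (V := R_NormedModule) (fun n => Cmod (exp_term t n))) (exp_term_abs t))
  (Cpseries_is_series _ t todd_disk Ht) He) as H.
refine (Cis_series_unique _ _ _ H _); clear H He.
apply (Cis_series_ext (fun n => if n == 0%N then t else RtoC 0)).
- intros n; transitivity (t ^ n.+1 * Csum (fun k => RtoC (todd k * / INR (n.+1 - k)`!)) n)%C.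
  + destruct n as [|n]; [rewrite Csum_O todd_0 subn0 factS fact0 /= Rinv_1 Rmult_1_r; ring|].
    rewrite -RtoC_sum_n sum_Sn todd_S.
    replace (n.+2 - n.+1)%N with 1%N by lia; rewrite (factS 0) fact0 Rinv_1.
    match goal with |- _ = (_ * RtoC ?r)%C => replace r with 0; [simpl; ring|] end.
    change (plus ?x ?y) with (x + y); ring.
  + rewrite -Csum_scal; apply Csum_ext; intros k Hk; unfold exp_term.
    rewrite RtoC_mult; replace (n.+1 - k)%N with (n - k).+1 by lia.
    replace (t ^ n.+1)%C with (t ^ k * t ^ (n - k).+1)%C by (rewrite -Cpow_addn; f_equal; lia); ring.
- assert (F : forall i, (0 < i)%N -> (if i == 0%N then t else RtoC 0) = RtoC 0) by (intros [|i]; auto; discriminate).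
  pose proof (Cis_series_finite (fun n => if n == 0%N then t else RtoC 0) 0 F) as F'.
  rewrite Csum_O in F'; exact F'.
Qed.

(** The polylogarithm of order [-r]. For [r = 0] the convention [0^0 = 1] keeps the term [m = 0], so
    that [polylog 0 x] is [1 / (1 - x)]. *)
Definition polylog (r : nat) (x : C) : C := Cpseries (fun m => RtoC (INR m ^ r)) x.

Lemma polylog_disk r : disk_coef (fun m => RtoC (INR m ^ r)).
Proof.
intros rho Hr; refine (ex_series_ext _ _ _ (ex_series_pow_geom r rho Hr)); intros n.
rewrite Cmod_R Rabs_pos_eq; [reflexivity|apply pow_le, pos_INR].
Qed.

Lemma polylog_deriv r x : Cmod x < 1 -> (x * Cpseries (deriv_coef (fun m => RtoC (INR m ^ r))) x = polylog r.+1 x)%C.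
Proof.
intros Hx; symmetry; apply CSeries_unique.
rewrite -(Cplus_0_l (x * _)%C).
replace (RtoC 0) with (RtoC (INR 0 ^ r.+1) * x ^ 0)%C by (simpl; rewrite Rmult_0_l; ring).
apply (Cis_series_S_inv (fun m => RtoC (INR m ^ r.+1) * x ^ m)%C).
eapply Cis_series_ext; [|apply Cis_series_scal, Cpseries_is_series; [apply disk_coef_deriv, polylog_disk|exact Hx]].
intros n; unfold deriv_coef; rewrite -RtoC_mult Cpow_S; change (INR n.+1 ^ r.+1) with (INR n.+1 * INR n.+1 ^ r); ring.
Qed.

(** Taylor coefficients of [1/(1 - exp(-t)) - 1/t]. As [1/(1 - exp(-t)) = 1 + 1/(exp t - 1)], they
    are the shifted coefficients [todd n.+1] with 1 added in degree 0. *)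
Definition laurent_coef0 (n : nat) : C := (RtoC (todd n.+1) + if n == 0%N then 1 else 0)%C.

Definition laurent_coef (r : nat) : nat -> C := iter r deriv_coef laurent_coef0.

Lemma laurent_coef_disk r : disk_coef (laurent_coef r).
Proof.
induction r as [|r IH]; [|apply disk_coef_deriv, IH].
apply (disk_coef_bounded _ 2); intros n; unfold laurent_coef, laurent_coef0; simpl iter.
eapply Rle_trans; [apply Cmod_triangle|]; rewrite Cmod_R.
pose proof (todd_bound n.+1); destruct (n == 0%N); rewrite ?Cmod_1 ?Cmod_0; lra.
Qed.

Lemma Cexp_opp_lt1 t : 0 < Re t -> Cmod (Cexp (- t)) < 1.
Proof.
intros Ht; rewrite Cmod_Cexp -exp_0; apply exp_increasing.
replace (Re (- t)) with (- Re t) by (destruct t; reflexivity); lra.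
Qed.

Lemma Re_neq0 t : 0 < Re t -> t <> RtoC 0.
Proof. intros H E; rewrite E in H; simpl in H; lra. Qed.

Lemma polylog_0_laurent t : 0 < Re t -> Cmod t < 1 ->
  polylog 0 (Cexp (- t)) = (/ t + Cpseries laurent_coef0 t)%C.
Proof.
intros Hr Ht; pose proof (Re_neq0 t Hr) as tz; pose proof (Cexp_opp_lt1 t Hr) as Hx.
assert (A : polylog 0 (Cexp (- t)) = (/ (1 - Cexp (- t)))%C).
{ apply CSeries_unique; pose proof (Cis_series_binomial _ 0 Hx) as H.
  replace (/ (1 - Cexp (- t)))%C with (Cexp (- t) ^ 0 / (1 - Cexp (- t)) ^ 1)%C
    by (rewrite Cpow_1_r; apply Cmult_1_l).
  refine (Cis_series_ext _ _ _ _ H); intros n; rewrite bin0; reflexivity. }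
assert (B : (Cpseries (fun n => RtoC (todd n)) t = 1 + t * (Cpseries laurent_coef0 t - 1))%C).
{ apply CSeries_unique.
  replace (RtoC 1) with (RtoC (todd 0) * t ^ 0)%C at 1 by (rewrite todd_0; apply Cmult_1_l).
  apply (Cis_series_S_inv (fun n => RtoC (todd n) * t ^ n)%C).
  assert (F : forall i, (0 < i)%N -> (if i == 0%N then RtoC 1 else RtoC 0) = RtoC 0) by (intros [|i]; auto; discriminate).
  pose proof (Cis_series_finite (fun n => if n == 0%N then RtoC 1 else RtoC 0) 0 F) as F'.
  rewrite Csum_O in F'; simpl in F'.
  pose proof (Cis_series_scal t _ _ (Cis_series_minus _ _ _ _
    (Cpseries_is_series _ t (laurent_coef_disk 0) Ht) F')) as G.
  refine (Cis_series_ext _ _ _ _ G); intros [|n]; unfold laurent_coef, laurent_coef0; simpl iter;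
    [change (0%N == 0%N) with true; cbv iota; ring|change (n.+1 == 0%N) with false; cbv iota; rewrite !Cpow_S; ring]. }
pose proof (todd_exp t Ht) as D; rewrite B in D.
set (L := Cpseries laurent_coef0 t) in *.
assert (E1 : (Cexp t - 1)%C <> RtoC 0).
{ intros E; rewrite E Cmult_0_r in D; apply tz; symmetry; exact D. }
rewrite A Cexp_opp.
transitivity (1 + / (Cexp t - 1))%C; [field; repeat split; try apply Cexp_neq0; try assumption|].
apply (Cmult_cancel_l (t * (Cexp t - 1))%C); [apply Cmult_neq_0; assumption|].
transitivity (t * (Cexp t - 1) + t)%C; [field; exact E1|].
transitivity (t * (Cexp t - 1) + (1 + t * (L - 1)) * (Cexp t - 1))%C; [rewrite D; reflexivity|field; exact tz].
Qed.

(** By induction on [r], differentiating in [t]: on the left [-d/dt] raises the order, on the right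
    it acts on the pole and on the power series separately. Uniqueness of the derivative compares
    the two. *)
Lemma polylog_laurent r t : 0 < Re t -> Cmod t < 1 ->
  polylog r (Cexp (- t)) =
   (RtoC (INR r`!) * (/ t) ^ r.+1 + (-1) ^ r * Cpseries (laurent_coef r) t)%C.
Proof.
revert t; induction r as [|r IH]; intros t Hr Ht.
- rewrite polylog_0_laurent // fact0 Cpow_1_r; unfold laurent_coef; simpl iter.
  change (INR 1) with 1; change ((-1) ^ 0)%C with (RtoC 1); ring.
- pose proof (Re_neq0 t Hr) as tz; pose proof (Cexp_opp_lt1 t Hr) as Hx.
  assert (D1 : Cderiv (fun t => polylog r (Cexp (- t))) t (- polylog r.+1 (Cexp (- t)))%C).
  { rewrite -(polylog_deriv r _ Hx).
    replace (- (Cexp (- t) * Cpseries (deriv_coef (fun m => RtoC (INR m ^ r))) (Cexp (- t))))%C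
      with (Cpseries (deriv_coef (fun m => RtoC (INR m ^ r))) (Cexp (- t)) * (Cexp (- t) * (- (1) * 1)))%C by ring.
    apply (Cderiv_comp (fun t => Cexp (- t)) (polylog r)); [|apply Cpseries_deriv; [apply polylog_disk|exact Hx]].
    apply (Cderiv_comp (fun t => - t)%C Cexp); [|apply Cderiv_Cexp].
    apply (Cderiv_ext_loc (fun x => - (1) * x)%C _ _ _ 1); [lra|intros h _; ring|].
    apply Cderiv_scal, Cderiv_id. }
  assert (Pw : forall n, Cderiv (fun t => (/ t) ^ n)%C t (- RtoC (INR n) * (/ t) ^ n.+1)%C).
  { induction n as [|n IHn].
    - replace (- RtoC (INR 0) * (/ t) ^ 1)%C with (RtoC 0) by (simpl; ring); apply (Cderiv_const 1).
    - pose proof (Cderiv_mult _ _ _ _ _ (Cderiv_inv t tz) IHn) as H.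
      replace (- RtoC (INR n.+1) * (/ t) ^ n.+2)%C
        with (- / (t * t) * (/ t) ^ n + / t * (- RtoC (INR n) * (/ t) ^ n.+1))%C; [exact H|].
      rewrite S_INR RtoC_plus !Cpow_S; field; exact tz. }
  assert (D2 : Cderiv (fun t => RtoC (INR r`!) * (/ t) ^ r.+1 + (-1) ^ r * Cpseries (laurent_coef r) t)%C t
    (RtoC (INR r`!) * (- RtoC (INR r.+1) * (/ t) ^ r.+2) + (-1) ^ r * Cpseries (laurent_coef r.+1) t)%C).
  { apply Cderiv_plus; apply Cderiv_scal; [apply Pw|apply Cpseries_deriv; [apply laurent_coef_disk|exact Ht]]. }
  (* A disk of this radius stays inside [Re t > 0] and [|t| < 1], where the induction hypothesis is
     available. *)
  set (rad := Rmin (Re t) (1 - Cmod t)).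
  assert (R0 : 0 < rad) by (apply Rmin_glb_lt; lra).
  assert (D3 : Cderiv (fun t => polylog r (Cexp (- t))) t
    (RtoC (INR r`!) * (- RtoC (INR r.+1) * (/ t) ^ r.+2) + (-1) ^ r * Cpseries (laurent_coef r.+1) t)%C).
  { refine (Cderiv_ext_loc _ _ _ _ rad R0 _ D2); intros h Hh; symmetry; apply IH.
    - assert (Cmod h < Re t) by (eapply Rlt_le_trans; [exact Hh|apply Rmin_l]).
      pose proof (re_le_Cmod h) as Q; apply Rabs_le_between in Q.
      replace (Re (t + h)) with (Re t + Re h) by (destruct t, h; reflexivity); lra.
    - assert (Cmod h < 1 - Cmod t) by (eapply Rlt_le_trans; [exact Hh|apply Rmin_r]).
      eapply Rle_lt_trans; [apply Cmod_triangle|lra]. }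
  pose proof (Cderiv_unique _ _ _ _ D1 D3) as E.
  transitivity (- (- polylog r.+1 (Cexp (- t))))%C; [ring|]; rewrite E INR_factS RtoC_mult (Cpow_S (-1)) RtoC_m1; ring.
Qed.

(** The value is [bernoulli r.+1 / (r+1)]; with [r = 2k - 1] it is the Bernoulli number that enters
    [zeta_even]. *)
Lemma laurent_coef_const r : (0 < r)%N -> laurent_coef r 0 = RtoC (INR r`! * todd r.+1).
Proof.
assert (H : forall m n, (RtoC (INR n`!) * laurent_coef m n = RtoC (INR (n + m)`!) * laurent_coef0 (n + m)%N)%C).
{ induction m as [|m IH]; intros n; [rewrite addn0; reflexivity|].
  unfold laurent_coef; simpl iter; fold (laurent_coef m); unfold deriv_coef.
  rewrite addnS -addSn -IH INR_factS RtoC_mult; ring. }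
intros Hr; specialize (H r 0%N); rewrite fact0 add0n in H; rewrite -(Cmult_1_l (laurent_coef r 0)) H.
unfold laurent_coef0; replace (r == 0%N) with false by lia; rewrite RtoC_mult; ring.
Qed.

(** * The Lipschitz formula *)

Lemma ex_series_le_R (a b : nat -> R) : (forall n, 0 <= a n <= b n) -> ex_series b -> ex_series a.
Proof.
intros H; apply (@ex_series_le R_AbsRing R_CompleteNormedModule).
intros n; change (Rabs (a n) <= b n); rewrite Rabs_pos_eq; apply H.
Qed.

Lemma Cis_series_telescope (u : nat -> C) : Clim eventually u 0 ->
  Cis_series (fun j => u j - u j.+1)%C (u 0%N).
Proof.
intros H; apply Cis_series_Clim, (Clim_ext eventually (fun n => u 0%N + - u n.+1)%C).
- apply filter_forall; intros n; induction n as [|n IH]; [rewrite Csum_O; reflexivity|].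
  rewrite Csum_S -IH; ring.
- replace (u 0%N) with (u 0%N + - 0)%C at 1 by ring.
  apply (Clim_plus eventually); [apply (Clim_const eventually)|apply (Clim_opp eventually)].
  apply (Clim_comp_eventually u); [exact H|intros N; exists N; intros n; lia].
Qed.

Lemma Clim_inv_INR : Clim eventually (fun n => RtoC (/ INR n.+1)) 0.
Proof.
intros eps Heps; destruct (archimed_cor1 eps Heps) as [N [H1 H2]].
exists N; intros n Hn; replace (RtoC (/ INR n.+1) - 0)%C with (RtoC (/ INR n.+1)) by ring.
assert (0 < INR N) by (apply lt_0_INR; lia).
assert (INR N <= INR n.+1) by (apply le_INR; lia).
rewrite Cmod_R Rabs_pos_eq; [|left; apply Rinv_0_lt_compat; lra].
eapply Rle_lt_trans; [apply Rinv_le_contravar; eassumption|exact H1].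
Qed.

(** Telescoping of [1/m - 1/(m+1)]. It controls the sum of inverse squares and, through its explicit
    value, the double series of the inversion formula. *)
Lemma is_series_inv_consecutive n : is_series (fun p => / (INR (n.+1 + p) * INR (n.+1 + p).+1)) (/ INR n.+1).
Proof.
assert (H : Cis_series (fun p => RtoC (/ (INR (n.+1 + p) * INR (n.+1 + p).+1))) (RtoC (/ INR n.+1))).
{ pose proof (Cis_series_telescope (fun p => RtoC (/ INR (n.+1 + p)))) as T.
  rewrite addn0 in T; refine (Cis_series_ext _ _ _ _ (T _)).
  - intros p; rewrite -RtoC_minus; f_equal; rewrite addnS S_INR.
    assert (0 < INR (n.+1 + p)) by (apply lt_0_INR; lia); field; lra.
  - apply (Clim_comp_eventually (fun m => RtoC (/ INR m.+1)) _ (fun p => (n + p)%N) Clim_inv_INR).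
    intros N; exists N; intros m; lia. }
apply Cis_series_Clim in H; intros P [eps HP].
destruct (H eps (cond_pos eps)) as [N HN]; exists N; intros m Hm; apply HP.
specialize (HN m Hm); rewrite -RtoC_sum_n -RtoC_minus Cmod_R in HN; exact HN.
Qed.

Lemma ex_series_inv_sq : ex_series (fun n => / INR n.+1 ^ 2).
Proof.
apply (ex_series_le_R _ (fun n => 2 * / (INR (1 + n) * INR (1 + n).+1))).
- intros n; rewrite add1n.
  pose proof (lt_0_INR n.+1 (Nat.lt_0_succ _)) as N0.
  split; [left; apply Rinv_0_lt_compat, pow_lt, N0|].
  assert (N1 : 1 <= INR n.+1) by (rewrite S_INR; pose proof (pos_INR n); lra).
  rewrite (S_INR n.+1); apply Rle_trans with (/ (INR n.+1 * (INR n.+1 + 1) / 2)).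
  + generalize (INR n.+1) N0 N1; intros x X0 X1; assert (0 <= x * (x - 1)) by (apply Rmult_le_pos; lra).
    apply Rinv_le_contravar; simpl; nra.
  + right; field; lra.
- apply (@ex_series_scal_l R_AbsRing R_NormedModule); eexists; apply (is_series_inv_consecutive 0).
Qed.

(** The imaginary part of [n tau + x] bounds [n], and then the triangle inequality bounds [x]; the
    constant depends on [tau] alone. *)
Lemma lattice_bound tau : 0 < Im tau -> exists c, 0 < c /\ forall (n : nat) (x : R),
  c * (INR n + Rabs x) <= Cmod (RtoC (INR n) * tau + RtoC x)%C.
Proof.
intros Ht; pose proof (Cmod_ge_0 tau) as T0.
set (K := 1 + (1 + Cmod tau) / Im tau).
assert (K0 : 0 < K) by (unfold K; pose proof (Rdiv_lt_0_compat (1 + Cmod tau) (Im tau)); lra).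
exists (/ K); split; [apply Rinv_0_lt_compat, K0|]; intros n x.
apply (Rmult_le_reg_l K); [exact K0|]; rewrite -Rmult_assoc Rinv_r; [|lra]; rewrite Rmult_1_l.
set (z := (RtoC (INR n) * tau + RtoC x)%C).
assert (H1 : INR n * Im tau <= Cmod z).
{ replace (INR n * Im tau) with (Im z) by (unfold z; destruct tau as [a b]; simpl; ring).
  eapply Rle_trans; [apply Rle_abs|]; eapply Rle_trans; [apply Rmax_r|apply Rmax_Cmod]. }
assert (H2 : Rabs x <= Cmod z + INR n * Cmod tau).
{ rewrite -Cmod_R; replace (RtoC x) with (z + - (RtoC (INR n) * tau))%C by (unfold z; ring).
  eapply Rle_trans; [apply Cmod_triangle|]; rewrite Cmod_opp Cmod_mult Cmod_R Rabs_pos_eq; [lra|apply pos_INR]. }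
assert (H3 : INR n <= Cmod z / Im tau).
{ apply (Rmult_le_reg_r (Im tau)); [exact Ht|]; unfold Rdiv; rewrite Rmult_assoc Rinv_l; lra. }
assert (H4 : INR n * (1 + Cmod tau) <= Cmod z / Im tau * (1 + Cmod tau)) by (apply Rmult_le_compat_r; lra).
unfold K; replace ((1 + (1 + Cmod tau) / Im tau) * Cmod z) with (Cmod z + Cmod z / Im tau * (1 + Cmod tau)); [lra|].
field; lra.
Qed.

Lemma Im_neq0 tau : 0 < Im tau -> tau <> RtoC 0.
Proof. intros H E; rewrite E in H; simpl in H; lra. Qed.

Lemma Im_plus_R tau x : Im (tau + RtoC x)%C = Im tau.
Proof. destruct tau; simpl; ring. Qed.

(* The terms of index [j] and [- j - 1] of the series of [(w + n) ^ - 2k] over all integers [n]. *)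
Definition lip_term (k : nat) (w : C) (j : nat) : C :=
  (/ (w + RtoC (INR j)) ^ (2 * k)%N + / (w - RtoC (INR j.+1)) ^ (2 * k)%N)%C.

Definition lip (k : nat) (w : C) : C := CSeries (lip_term k w).

(** Every exponent [s >= 2] is compared with 2, so that the series of inverse squares is a majorant
    in all weights. *)
Lemma Cpow_inv_bound (s : nat) z d : (2 <= s)%N -> 0 < d <= 1 -> forall m, d * INR m.+1 <= Cmod z ->
  Cmod (/ z ^ s) <= (/ d) ^ s * / INR m.+1 ^ 2.
Proof.
intros Hs Hd m Hz.
pose proof (lt_0_INR m.+1 (Nat.lt_0_succ _)) as M0.
assert (M1 : 1 <= INR m.+1) by (rewrite S_INR; pose proof (pos_INR m); lra).
assert (D0 : 0 < d * INR m.+1) by nra.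
assert (Z0 : 0 < Cmod z) by lra.
rewrite Cmod_inv; [|apply Cpow_nz, Cmod_gt_0, Z0]; rewrite Cmod_pow pow_inv -Rinv_mult.
apply Rinv_le_contravar.
- apply Rmult_lt_0_compat; apply pow_lt; lra.
- apply Rle_trans with ((d * INR m.+1) ^ s); [|apply pow_incr; lra].
  rewrite Rpow_mult_distr; apply Rmult_le_compat_l; [apply pow_le; lra|].
  apply Rle_pow; [exact M1|lia].
Qed.

Lemma lattice_bound_le1 tau : 0 < Im tau -> exists c, 0 < c <= 1 /\ forall (n : nat) (x : R),
  c * (INR n + Rabs x) <= Cmod (RtoC (INR n) * tau + RtoC x)%C.
Proof.
intros Ht; destruct (lattice_bound tau Ht) as [c [C0 H]].
exists (Rmin c 1); split; [split; [apply Rmin_glb_lt; lra|apply Rmin_r]|]; intros n x.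
eapply Rle_trans; [|apply H]; apply Rmult_le_compat_r; [|apply Rmin_l].
pose proof (pos_INR n); pose proof (Rabs_pos x); lra.
Qed.

Lemma inv_pow_shift_bound k w : (1 <= k)%N -> 0 < Im w -> exists K, forall (x : R) m, INR m <= Rabs x ->
  Cmod (/ (w + RtoC x) ^ (2 * k)%N) <= K * / INR m.+1 ^ 2.
Proof.
intros Hk Hw; destruct (lattice_bound_le1 w Hw) as [c [C0 H]].
exists ((/ c) ^ (2 * k)%N); intros x m Hm.
apply Cpow_inv_bound; [lia|exact C0|].
specialize (H 1%N x); rewrite Cmult_1_l in H; eapply Rle_trans; [|exact H].
apply Rmult_le_compat_l; [lra|]; rewrite S_INR; simpl (INR 1); lra.
Qed.

Lemma lip_term_abs k w : (1 <= k)%N -> 0 < Im w -> Cabs_series (lip_term k w).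
Proof.
intros Hk Hw; destruct (inv_pow_shift_bound k w Hk Hw) as [K HK].
apply (Cabs_series_le _ (fun j => (2 * K) * / INR j.+1 ^ 2)).
- intros j; eapply Rle_trans; [apply Cmod_triangle|].
  assert (H1 := HK (INR j) j); assert (H2 := HK (- INR j.+1) j).
  rewrite RtoC_opp in H2; fold (w - RtoC (INR j.+1))%C in H2.
  rewrite Rabs_Ropp !Rabs_pos_eq in H1 H2; try apply pos_INR.
  rewrite S_INR in H2; rewrite -S_INR in H2.
  specialize (H1 (Rle_refl _)); assert (INR j <= INR j.+1) by (rewrite S_INR; lra).
  specialize (H2 H); lra.
- apply (@ex_series_scal_l R_AbsRing R_NormedModule), ex_series_inv_sq.
Qed.

Lemma lip_is_series k w : (1 <= k)%N -> 0 < Im w -> Cis_series (lip_term k w) (lip k w).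
Proof. intros Hk Hw; apply Cabs_series_CSeries, lip_term_abs; assumption. Qed.

Lemma inv_pow_shift_lim k w (x : nat -> R) : (1 <= k)%N -> 0 < Im w -> (forall j, INR j <= Rabs (x j)) ->
  Clim eventually (fun j => / (w + RtoC (x j)) ^ (2 * k)%N)%C 0.
Proof.
intros Hk Hw Hx; destruct (inv_pow_shift_bound k w Hk Hw) as [K HK].
apply (Clim_squeeze eventually _ _ (fun j => Rabs K * / INR j.+1)).
- apply filter_forall; intros j; specialize (HK (x j) j (Hx j)).
  replace (/ (w + RtoC (x j)) ^ (2 * k)%N - 0)%C with (/ (w + RtoC (x j)) ^ (2 * k)%N)%C by ring.
  eapply Rle_trans; [exact HK|].
  pose proof (lt_0_INR j.+1 (Nat.lt_0_succ _)) as M0.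
  assert (M1 : 1 <= INR j.+1) by (rewrite S_INR; pose proof (pos_INR j); lra).
  assert (I0 : / INR j.+1 ^ 2 <= / INR j.+1) by (generalize (INR j.+1) M0 M1; intros y Y0 Y1; apply Rinv_le_contravar; [exact Y0|simpl; nra]).
  pose proof (Rinv_0_lt_compat _ (pow_lt _ 2 M0)).
  apply Rle_trans with (Rabs K * / INR j.+1 ^ 2);
    [apply Rmult_le_compat_r; [lra|apply Rle_abs]|apply Rmult_le_compat_l; [apply Rabs_pos|exact I0]].
- intros eps Heps; assert (e1 : 0 < eps / (1 + Rabs K)) by (apply Rdiv_lt_0_compat; pose proof (Rabs_pos K); lra).
  destruct (Clim_inv_INR _ e1) as [N HN]; exists N; intros n Hn; specialize (HN n Hn).
  replace (RtoC (/ INR n.+1) - 0)%C with (RtoC (/ INR n.+1)) in HN by ring.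
  rewrite Cmod_R in HN; pose proof (Rle_abs (/ INR n.+1)).
  pose proof (Rinv_0_lt_compat _ (lt_0_INR n.+1 (Nat.lt_0_succ _))) as P0; pose proof (Rabs_pos K) as K0.
  apply Rle_lt_trans with ((1 + Rabs K) * / INR n.+1); [rewrite Rmult_plus_distr_r; lra|].
  apply (Rmult_lt_reg_r (/ (1 + Rabs K))); [apply Rinv_0_lt_compat; lra|].
  replace ((1 + Rabs K) * / INR n.+1 * / (1 + Rabs K)) with (/ INR n.+1) by (field; split; [lra|apply not_0_INR; lia]).
  unfold Rdiv in HN; lra.
Qed.

(** The halves over nonnegative and over negative integers telescope separately; both leave the
    boundary term [1 / w^(2k)], with opposite signs. *)
Lemma lip_periodic k w : (1 <= k)%N -> 0 < Im w -> lip k (w + 1) = lip k w.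
Proof.
intros Hk Hw; assert (Hw' : 0 < Im (w + 1)) by now rewrite Im_plus_R.
pose proof (Cis_series_minus _ _ _ _ (lip_is_series k w Hk Hw) (lip_is_series k _ Hk Hw')) as H.
pose proof (Cis_series_telescope _ (inv_pow_shift_lim k w (fun j => INR j) Hk Hw
  (fun j => Rle_abs (INR j)))) as T1.
assert (B : forall j, INR j <= Rabs (- INR j)) by (intros j; rewrite Rabs_Ropp; apply Rle_abs).
pose proof (Cis_series_telescope _ (inv_pow_shift_lim k w (fun j => - INR j) Hk Hw B)) as T2.
pose proof (Cis_series_minus _ _ _ _ T1 T2) as T; cbv beta in T.
assert (E : (lip k w - lip k (w + 1) = 0)%C).
{ replace (RtoC 0) with (/ (w + RtoC (INR 0)) ^ (2 * k)%N - / (w + RtoC (- INR 0)) ^ (2 * k)%N)%C.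
  - apply (Cis_series_unique _ _ _ H); refine (Cis_series_ext _ _ _ _ T); intros j; cbv beta.
    unfold lip_term; rewrite !RtoC_opp.
    replace (w + 1 + RtoC (INR j))%C with (w + RtoC (INR j.+1))%C by (rewrite S_INR RtoC_plus; ring).
    replace (w + 1 - RtoC (INR j.+1))%C with (w + - RtoC (INR j))%C by (rewrite S_INR RtoC_plus; ring).
    unfold Cminus; ring.
  - simpl (INR 0); rewrite Ropp_0; ring. }
transitivity (lip k w - (lip k w - lip k (w + 1)))%C; [ring|rewrite E; ring].
Qed.

Lemma Im_div2 w : Im (w / 2)%C = Im w / 2.
Proof. destruct w; simpl; field. Qed.

Lemma RtoC2_neq0 : RtoC 2 <> RtoC 0.
Proof. apply RtoC_neq0; lra. Qed.

Lemma Cinv_pow_half z s : z <> RtoC 0 -> (/ (z / 2) ^ s = RtoC (2 ^ s) * / z ^ s)%C.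
Proof.
intros Hz; rewrite RtoC_pow; unfold Cdiv; rewrite Cpow_mult_l (Cpow_inv _ _ RtoC2_neq0).
field; split; apply Cpow_nz; [exact Hz|exact RtoC2_neq0].
Qed.

Lemma shift_neq0 w x : 0 < Im w -> (w + RtoC x)%C <> RtoC 0.
Proof. intros Hw; apply Im_neq0; rewrite Im_plus_R; exact Hw. Qed.

(** Even integers come from [w / 2] and odd ones from [(w + 1) / 2]. The pairing of [j] with [-j-1]
    turns into that of [2j] with [-2j-2], respectively of [2j+1] with [-2j-1]. *)
Lemma lip_term_pair k w j : 0 < Im w ->
  (lip_term k (w / 2) j = RtoC (2 ^ (2 * k)%N) *
     (/ (w + RtoC (INR (2 * j)%N)) ^ (2 * k)%N + / (w - RtoC (INR (2 * j + 1)%N.+1)) ^ (2 * k)%N))%C /\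
  (lip_term k ((w + 1) / 2) j = RtoC (2 ^ (2 * k)%N) *
     (/ (w + RtoC (INR (2 * j + 1)%N)) ^ (2 * k)%N + / (w - RtoC (INR (2 * j).+1)) ^ (2 * k)%N))%C.
Proof.
intros Hw.
assert (N2 : forall n, INR (2 * n)%N = 2 * INR n) by (intros n; rewrite mulnE mult_INR; simpl; ring).
assert (N1 : forall n, INR (2 * n + 1)%N = 2 * INR n + 1) by (intros n; rewrite addn1 S_INR N2; ring).
assert (M : forall x, (w - RtoC x)%C = (w + RtoC (- x))%C) by (intros x; rewrite RtoC_opp; reflexivity).
unfold lip_term; rewrite !S_INR !N1 !N2; split; rewrite Cmult_plus_distr_l; f_equal;
  rewrite ?M -Cinv_pow_half; try apply shift_neq0, Hw; do 2 f_equal;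
  rewrite ?RtoC_opp ?RtoC_plus ?RtoC_mult; rewrite ?RtoC_plus ?RtoC_mult; field; apply RtoC2_neq0.
Qed.

Lemma lip_half k w : (1 <= k)%N -> 0 < Im w ->
  (lip k (w / 2) + lip k ((w + 1) / 2) = RtoC (2 ^ (2 * k)%N) * lip k w)%C.
Proof.
intros Hk Hw.
assert (H1 : 0 < Im (w / 2)) by (rewrite Im_div2; lra).
assert (H2 : 0 < Im ((w + 1) / 2)) by (rewrite Im_div2 Im_plus_R; lra).
pose proof (Cis_series_plus _ _ _ _ (lip_is_series k _ Hk H1) (lip_is_series k _ Hk H2)) as A.
pose proof (Cis_series_scal (RtoC (2 ^ (2 * k)%N)) _ _ (Cis_series_pairs _ _ (lip_is_series k _ Hk Hw))) as B.
apply (Cis_series_unique _ _ _ A); refine (Cis_series_ext _ _ _ _ B); intros j.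
destruct (lip_term_pair k w j Hw) as [-> ->]; unfold lip_term; ring.
Qed.

Lemma full_sum_sq k x : (1 <= k)%N -> Cmod x < 1 ->
  (full_sum k x + full_sum k (- x) = RtoC (2 ^ (2 * k)%N) * full_sum k (x ^ 2))%C.
Proof.
intros Hk Hx; assert (Hx' : Cmod (- x) < 1) by now rewrite Cmod_opp.
assert (Hx2 : Cmod (x ^ 2)%C < 1) by (apply Cmod_pow_lt1; auto).
pose proof (Cis_series_pairs _ _ (Cis_series_plus _ _ _ _ (eulerian k x Hk Hx) (eulerian k (- x)%C Hk Hx'))) as A.
pose proof (Cis_series_scal (RtoC (2 ^ (2 * k)%N)) _ _ (eulerian k _ Hk Hx2)) as B.
apply (Cis_series_unique _ _ _ A); refine (Cis_series_ext _ _ _ _ B); intros i; cbv beta.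
assert (e2 : ((- x) ^ (2 * i)%N = x ^ (2 * i)%N)%C) by (rewrite !Cpow_muln; f_equal; simpl; ring).
rewrite addn1 (Cpow_S x (2 * i)%N) (Cpow_S (- x)%C (2 * i)%N) e2 -Cpow_muln.
replace (INR (2 * i)%N) with (2 * INR i) by (rewrite mulnE mult_INR; simpl; ring).
replace (2 ^ (2 * k)%N) with (2 * 2 ^ (2 * k - 1)%N); [rewrite Rpow_mult_distr !RtoC_mult; ring|].
replace (2 * k)%N with (2 * k - 1).+1 at 2 by lia; reflexivity.
Qed.

(** * The nome, and the defect of the Lipschitz formula *)

Lemma nome_plus z w : nome (z + w) = (nome z * nome w)%C.
Proof. unfold nome; rewrite -Cexp_plus; f_equal; ring. Qed.

Lemma nome_1 : nome 1 = RtoC 1.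
Proof.
unfold nome; replace (RtoC (2 * PI) * Ci * 1)%C with ((0, 2 * PI) : C)
  by (apply injective_projections; simpl; ring).
unfold Cexp; simpl; rewrite exp_0 cos_2PI sin_2PI; apply injective_projections; simpl; ring.
Qed.

Lemma nome_half : nome (1 / 2) = (- (1))%C.
Proof.
unfold nome; replace (RtoC (2 * PI) * Ci * (1 / 2))%C with ((0, PI) : C)
  by (apply injective_projections; simpl; field).
unfold Cexp; simpl; rewrite exp_0 cos_PI sin_PI; apply injective_projections; simpl; ring.
Qed.

Lemma Cmod_nome w : Cmod (nome w) = exp (- (2 * PI * Im w)).
Proof. unfold nome; rewrite Cmod_Cexp; f_equal; destruct w; simpl; ring. Qed.

Lemma nome_lt1 w : 0 < Im w -> Cmod (nome w) < 1.
Proof.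
intros Hw; rewrite Cmod_nome -exp_0; apply exp_increasing; pose proof PI_RGT_0; nra.
Qed.

(* [(2 pi i)^(2k) / (2k - 1)!] *)
Definition lip_const (k : nat) : R := (-1) ^ k * (2 * PI) ^ (2 * k)%N / INR (2 * k - 1)`!.

Definition lip_defect (k : nat) (w : C) : C := (lip k w - RtoC (lip_const k) * full_sum k (nome w))%C.

Lemma lip_defect_periodic k w : (1 <= k)%N -> 0 < Im w -> lip_defect k (w + 1) = lip_defect k w.
Proof.
intros Hk Hw; unfold lip_defect; rewrite lip_periodic // nome_plus nome_1 Cmult_1_r; reflexivity.
Qed.

Lemma lip_defect_half k w : (1 <= k)%N -> 0 < Im w ->
  (lip_defect k (w / 2) + lip_defect k ((w + 1) / 2) = RtoC (2 ^ (2 * k)%N) * lip_defect k w)%C.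
Proof.
intros Hk Hw; unfold lip_defect.
assert (H1 : 0 < Im (w / 2)) by (rewrite Im_div2; lra).
replace (nome ((w + 1) / 2)) with (- nome (w / 2))%C.
- replace (nome w) with (nome (w / 2) ^ 2)%C.
  + pose proof (lip_half k w Hk Hw) as L; pose proof (full_sum_sq k _ Hk (nome_lt1 _ H1)) as F.
    transitivity (lip k (w / 2) + lip k ((w + 1) / 2) - RtoC (lip_const k) *
      (full_sum k (nome (w / 2)) + full_sum k (- nome (w / 2))))%C; [ring|rewrite L F; ring].
  + replace w with (w / 2 + w / 2)%C at 2 by (field; apply RtoC2_neq0); rewrite nome_plus; simpl; ring.
- replace ((w + 1) / 2)%C with (w / 2 + 1 / 2)%C by (field; apply RtoC2_neq0).
  rewrite nome_plus nome_half; ring.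
Qed.

Lemma lip_defect_periodic_Z k w m : (1 <= k)%N -> 0 < Im w ->
  lip_defect k (w + RtoC (IZR m)) = lip_defect k w.
Proof.
intros Hk Hw.
assert (N : forall n w, 0 < Im w -> lip_defect k (w + RtoC (INR n)) = lip_defect k w).
{ clear w Hw; induction n as [|n IH]; intros w Hw; [f_equal; simpl; ring|].
  rewrite S_INR RtoC_plus Cplus_assoc lip_defect_periodic //; [apply IH, Hw|rewrite Im_plus_R; exact Hw]. }
destruct (Z_le_gt_dec 0 m) as [Hm|Hm].
- rewrite -(Z2Nat.id m Hm) -INR_IZR_INZ; apply N, Hw.
- rewrite -(N (Z.to_nat (- m)) (w + RtoC (IZR m))%C); [|rewrite Im_plus_R; exact Hw].
  f_equal; rewrite INR_IZR_INZ Z2Nat.id; [|lia]; rewrite opp_IZR RtoC_opp; ring.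
Qed.

(** [lip_term] with the pole [1 / w^(2k)] removed. What remains is bounded uniformly on the strip
    [|Re w| <= 1/2], including [w = 0], where it sums to [2 zeta(2k)]. *)
Definition lip_rest_term (k : nat) (w : C) (j : nat) : C :=
  ((if j == 0%N then RtoC 0 else / (w + RtoC (INR j)) ^ (2 * k)%N)
   + / (w - RtoC (INR j.+1)) ^ (2 * k)%N)%C.

Lemma Cmod_shift_ge w x : Rabs x - Rabs (Re w) <= Cmod (w + RtoC x).
Proof.
eapply Rle_trans; [|apply re_le_Cmod].
replace (Re (w + RtoC x)) with (x - - Re w) by (destruct w; simpl; ring).
eapply Rle_trans; [|apply Rabs_triang_inv]; rewrite Rabs_Ropp; lra.
Qed.

(** On the strip [|w + x|] is at least [|x| - 1/2]; the ratio [1/4] is what the tightest case,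
    [j = 1] with [x = 1], permits. *)
Lemma lip_rest_term_bound k w j : (1 <= k)%N -> Rabs (Re w) <= 1 / 2 ->
  Cmod (lip_rest_term k w j) <= (2 * (/ (1 / 4)) ^ (2 * k)%N) * / INR j.+1 ^ 2.
Proof.
intros Hk Hw; eapply Rle_trans; [apply Cmod_triangle|].
assert (K0 : 0 <= (/ (1 / 4)) ^ (2 * k)%N) by (apply pow_le; lra).
assert (I0 : 0 < / INR j.+1 ^ 2) by (apply Rinv_0_lt_compat, pow_lt, lt_0_INR; lia).
assert (A : Cmod (if j == 0%N then RtoC 0 else / (w + RtoC (INR j)) ^ (2 * k)%N)%C <= (/ (1 / 4)) ^ (2 * k)%N * / INR j.+1 ^ 2).
{ destruct j as [|j]; [rewrite eqxx Cmod_0; apply Rmult_le_pos; lra|].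
  change (j.+1 == 0%N) with false; cbv iota.
  apply Cpow_inv_bound; [lia|lra|].
  eapply Rle_trans; [|apply Cmod_shift_ge]; rewrite Rabs_pos_eq; [|apply pos_INR].
  rewrite !S_INR; pose proof (pos_INR j); lra. }
assert (B : Cmod (/ (w - RtoC (INR j.+1)) ^ (2 * k)%N)%C <= (/ (1 / 4)) ^ (2 * k)%N * / INR j.+1 ^ 2).
{ apply Cpow_inv_bound; [lia|lra|].
  replace (w - RtoC (INR j.+1))%C with (w + RtoC (- INR j.+1))%C by (rewrite RtoC_opp; reflexivity).
  eapply Rle_trans; [|apply Cmod_shift_ge]; rewrite Rabs_Ropp Rabs_pos_eq; [|apply pos_INR].
  rewrite !S_INR; pose proof (pos_INR j); lra. }
lra.
Qed.

Lemma lip_rest_series k w : (1 <= k)%N -> 0 < Im w ->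
  Cis_series (lip_rest_term k w) (lip k w - / w ^ (2 * k)%N)%C.
Proof.
intros Hk Hw.
assert (F : forall i, (0 < i)%N -> (if i == 0%N then (/ w ^ (2 * k)%N)%C else RtoC 0) = RtoC 0) by (intros [|i]; auto; discriminate).
pose proof (Cis_series_finite (fun i => if i == 0%N then (/ w ^ (2 * k)%N)%C else RtoC 0) 0 F) as F'.
rewrite Csum_O in F'; simpl in F'.
refine (Cis_series_ext _ _ _ _ (Cis_series_minus _ _ _ _ (lip_is_series k w Hk Hw) F')).
intros [|j]; unfold lip_term, lip_rest_term.
- rewrite !eqxx; simpl (INR 0); replace (w + RtoC 0)%C with w by ring; ring.
- change (j.+1 == 0%N) with false; cbv iota; ring.
Qed.

Definition lip_rest_bound (k : nat) : R := Series (fun j => (2 * (/ (1 / 4)) ^ (2 * k)%N) * / INR j.+1 ^ 2).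

Lemma ex_lip_rest_bound k : ex_series (fun j => (2 * (/ (1 / 4)) ^ (2 * k)%N) * / INR j.+1 ^ 2).
Proof. apply (@ex_series_scal_l R_AbsRing R_NormedModule), ex_series_inv_sq. Qed.

Lemma lip_rest_le k w : (1 <= k)%N -> 0 < Im w -> Rabs (Re w) <= 1 / 2 ->
  Cmod (lip k w - / w ^ (2 * k)%N) <= lip_rest_bound k.
Proof.
intros Hk Hw Hr; apply (Cis_series_Cmod_le _ _ _ (lip_rest_series k w Hk Hw)); [|apply ex_lip_rest_bound].
intros j; apply lip_rest_term_bound; assumption.
Qed.

Lemma full_sum_polylog k x : (1 <= k)%N -> Cmod x < 1 -> full_sum k x = polylog (2 * k - 1) x.
Proof.
intros Hk Hx; symmetry; apply CSeries_unique.
exact (eulerian k x Hk Hx).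
Qed.

Lemma nome_Cexp_opp w : nome w = Cexp (- (RtoC (- (2 * PI)) * Ci * w)).
Proof. unfold nome; f_equal; rewrite RtoC_opp; ring. Qed.

Lemma Cpow_opp_even z k : ((- z) ^ (2 * k)%N = z ^ (2 * k)%N)%C.
Proof. rewrite !Cpow_muln; f_equal; simpl; ring. Qed.

(** This normalises [lip_const]: the pole of the polylogarithm at [w = 0] acquires exactly the
    coefficient of the lattice term [1 / w^(2k)]. *)
Lemma lip_const_inv_pow k w : (1 <= k)%N -> w <> RtoC 0 ->
  (RtoC (lip_const k) * (RtoC (INR (2 * k - 1)`!) * (/ (RtoC (- (2 * PI)) * Ci * w)) ^ (2 * k)%N) = / w ^ (2 * k)%N)%C.
Proof.
intros Hk Hw; pose proof PI_RGT_0 as P0.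
assert (T : (RtoC (- (2 * PI)) * Ci)%C <> RtoC 0).
{ apply Cmult_neq_0; [apply RtoC_neq0; lra|intros E; injection E; lra]. }
rewrite Cpow_inv; [|apply Cmult_neq_0; assumption].
assert (E : ((RtoC (- (2 * PI)) * Ci) ^ (2 * k)%N = RtoC ((-1) ^ k * (2 * PI) ^ (2 * k)%N))%C).
{ transitivity (RtoC ((2 * PI) ^ (2 * k)%N) * RtoC ((-1) ^ k))%C; [|rewrite -RtoC_mult; f_equal; ring].
  rewrite Cpow_mult_l; f_equal; [rewrite RtoC_opp Cpow_opp_even RtoC_pow; reflexivity|].
  rewrite Cpow_muln RtoC_pow; f_equal; apply injective_projections; simpl; ring. }
rewrite Cpow_mult_l E; unfold lip_const.
pose proof (INR_fact_gt0 (2 * k - 1)%N) as F0.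
assert (S0 : (-1) ^ k * (2 * PI) ^ (2 * k)%N <> 0).
{ apply Rmult_integral_contrapositive_currified; apply pow_nonzero; lra. }
set (X := (-1) ^ k * (2 * PI) ^ (2 * k)%N) in *.
unfold Rdiv; rewrite RtoC_mult RtoC_inv; [|lra].
field; repeat split; [apply Cpow_nz, Hw|apply RtoC_neq0, S0|apply RtoC_neq0; lra].
Qed.

Lemma laurent_arg w : 0 < Im w -> Cmod w < / (4 * PI) ->
  0 < Re (RtoC (- (2 * PI)) * Ci * w)%C /\ Cmod (RtoC (- (2 * PI)) * Ci * w)%C < 1 / 2.
Proof.
intros Hw Hs; pose proof PI_RGT_0 as P0; split.
- replace (Re (RtoC (- (2 * PI)) * Ci * w)%C) with (2 * PI * Im w) by (destruct w; simpl; ring); nra.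
- rewrite !Cmod_mult Cmod_R Cmod_Ci Rabs_Ropp Rabs_pos_eq; [|lra].
  apply (Rmult_lt_compat_l (2 * PI)) in Hs; [|lra].
  replace (2 * PI * / (4 * PI)) with (1 / 2) in Hs by (field; lra); lra.
Qed.

(** The pole at [w = 0] is isolated, so that in the defect it cancels against that of [lip]. The
    radius [1 / (4 PI)] keeps the argument [-2 pi i w] of the power series below [1/2]. *)
Lemma full_sum_laurent k w : (1 <= k)%N -> 0 < Im w -> Cmod w < / (4 * PI) ->
  (RtoC (lip_const k) * full_sum k (nome w) = / w ^ (2 * k)%N
    - RtoC (lip_const k) * Cpseries (laurent_coef (2 * k - 1)) (RtoC (- (2 * PI)) * Ci * w))%C.
Proof.
intros Hk Hw Hs; destruct (laurent_arg w Hw Hs) as [A B].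
rewrite full_sum_polylog //; [|apply nome_lt1, Hw].
rewrite nome_Cexp_opp polylog_laurent //; [|lra].
assert (E : ((-1) ^ (2 * k - 1)%N = - (1))%C).
{ rewrite -RtoC_pow; replace (2 * k - 1)%N with (2 * (k - 1)).+1 by lia.
  rewrite -multE pow_1_odd; apply RtoC_m1. }
rewrite E; replace (2 * k - 1).+1 with (2 * k)%N by lia.
rewrite -(lip_const_inv_pow k w Hk (Im_neq0 w Hw)); ring.
Qed.

Lemma Cpseries_half_bound a : disk_coef a -> exists B, forall t, Cmod t <= 1 / 2 -> Cmod (Cpseries a t) <= B.
Proof.
intros Ha; exists (Series (fun n => Cmod (a n) * (1 / 2) ^ n)); intros t Ht.
assert (Ht1 : Cmod t < 1) by lra.
apply (Cis_series_Cmod_le _ _ _ (Cpseries_is_series a t Ha Ht1)); [|apply Ha; lra].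
intros n; rewrite Cmod_mult Cmod_pow; apply Rmult_le_compat_l; [apply Cmod_ge_0|].
apply pow_incr; split; [apply Cmod_ge_0|exact Ht].
Qed.

Lemma Pe_bounded k : (1 <= k)%N -> exists B, forall x, Cmod x <= 1 -> Cmod (x * Pe k x) <= B.
Proof.
intros Hk; exists (sum_n (fun l => Rabs ((-1) ^ l * b_coef k l)) (2 * k - 1)%N); intros x Hx.
rewrite Pe_Csum // b_coef_0 //.
replace (Csum _ _ - 0)%C with
  (Csum (fun l => RtoC ((-1) ^ l * b_coef k l) * x ^ l)%C (2 * k - 1)%N) by ring.
eapply Rle_trans; [apply Cmod_Csum|].
generalize (2 * k - 1)%N; intros n.
assert (T : forall l, Cmod (RtoC ((-1) ^ l * b_coef k l) * x ^ l)%C <= Rabs ((-1) ^ l * b_coef k l)).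
{ intros l; rewrite Cmod_mult Cmod_R Cmod_pow -{2}(Rmult_1_r (Rabs _)).
  apply Rmult_le_compat_l; [apply Rabs_pos|apply pow_le_1; split; [apply Cmod_ge_0|exact Hx]]. }
induction n as [|n IH]; [rewrite !sum_O; apply T|].
rewrite !sum_Sn; apply Rplus_le_compat; [exact IH|apply T].
Qed.

(** Away from 0 in the strip, either [Im w] is at least [delta / 2] and the nome is small in
    modulus, or [|Re w|] is at least [delta / 2] and the angle [2 pi |Re w|] lies between [pi delta]
    and [pi]. *)
Lemma nome_away_from_1 delta : 0 < delta <= 1 -> exists eta, 0 < eta /\ forall w, 0 < Im w ->
  Rabs (Re w) <= 1 / 2 -> delta <= Cmod w -> eta <= Cmod (1 - nome w).
Proof.
intros Hd; pose proof PI_RGT_0 as P0; pose proof PI_4 as P4.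
set (c := cos (PI * delta)); set (e := exp (- (PI * delta))).
assert (C1 : c < 1).
{ unfold c; rewrite -cos_0; apply cos_decreasing_1; nra. }
assert (E1 : e < 1) by (unfold e; rewrite -exp_0; apply exp_increasing; nra).
(* The three candidates cover a nonpositive cosine, a positive cosine bounded by [c], and a modulus
   bounded by [e]. *)
exists (Rmin 1 (Rmin (1 - c) (1 - e))); split; [repeat apply Rmin_glb_lt; lra|].
intros w Hw Hr Hm.
destruct (Rle_lt_dec (delta / 2) (Im w)) as [Hy|Hy].
- apply Rle_trans with (1 - e); [eapply Rle_trans; [apply Rmin_r|apply Rmin_r]|].
  eapply Rle_trans; [|apply Cmod_one_minus_ge]; rewrite Cmod_nome.
  assert (exp (- (2 * PI * Im w)) <= e) by (apply exp_le_mono; nra); lra.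
- assert (Hx : delta / 2 <= Rabs (Re w)).
  { assert (Cmod w <= Rabs (Re w) + Im w); [|lra].
    replace w with (RtoC (Re w) + Ci * RtoC (Im w))%C at 1 by (destruct w; apply injective_projections; simpl; ring).
    eapply Rle_trans; [apply Cmod_triangle|]; rewrite Cmod_mult Cmod_Ci !Cmod_R (Rabs_pos_eq (Im w)); lra. }
  eapply Rle_trans; [|apply re_le_Cmod]; eapply Rle_trans; [|apply Rle_abs].
  assert (N : Re (1 - nome w) = 1 - exp (- (2 * PI * Im w)) * cos (2 * PI * Rabs (Re w))).
  { unfold nome, Cexp.
    replace (cos (2 * PI * Rabs (Re w))) with (cos (2 * PI * Re w)).
    - destruct w as [a b]; simpl.
      replace ((2 * PI * 0 - 0 * 1) * a - (2 * PI * 1 + 0 * 0) * b) with (- (2 * PI * b)) by ring.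
      replace ((2 * PI * 0 - 0 * 1) * b + (2 * PI * 1 + 0 * 0) * a) with (2 * PI * a) by ring; ring.
    - unfold Rabs; destruct (Rcase_abs (Re w)); [|reflexivity].
      rewrite -(cos_neg (2 * PI * Re w)); f_equal; ring. }
  rewrite N.
  assert (Q : cos (2 * PI * Rabs (Re w)) <= c).
  { unfold c; destruct (Req_dec (PI * delta) (2 * PI * Rabs (Re w))) as [->|Hne]; [lra|].
    left; apply cos_decreasing_1; nra. }
  assert (R1 : exp (- (2 * PI * Im w)) <= 1) by (rewrite -exp_0; apply exp_le_mono; nra).
  pose proof (exp_pos (- (2 * PI * Im w))) as R0.
  set (r := exp _) in *; set (cc := cos (2 * PI * Rabs (Re w))) in *.
  destruct (Rle_lt_dec cc 0) as [L|L].
  + eapply Rle_trans; [apply Rmin_l|]; nra.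
  + apply Rle_trans with (1 - c); [eapply Rle_trans; [apply Rmin_r|apply Rmin_l]|]; nra.
Qed.

(** Near 0 the two poles cancel and a convergent power series remains. Elsewhere both sides are
    bounded separately, the nome keeping a distance [eta] from the pole of [full_sum] at 1. *)
Lemma lip_defect_strip_bounded k : (1 <= k)%N -> exists M, forall w, 0 < Im w -> Rabs (Re w) <= 1 / 2 ->
  Cmod (lip_defect k w) <= M.
Proof.
intros Hk; pose proof PI_RGT_0 as P0; set (delta := / (4 * PI)).
assert (D0 : 0 < delta <= 1).
{ unfold delta; split; [apply Rinv_0_lt_compat; lra|].
  rewrite -Rinv_1; apply Rinv_le_contravar; [lra|pose proof PI2_1; lra]. }
destruct (nome_away_from_1 delta D0) as [eta [E0 HE]].
destruct (Pe_bounded k Hk) as [BP HP].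
destruct (Cpseries_half_bound _ (laurent_coef_disk (2 * k - 1)%N)) as [BL HL].
set (A := Rabs (lip_const k)).
exists (Rmax (lip_rest_bound k + A * BL) (lip_rest_bound k + (/ delta) ^ (2 * k)%N + A * (BP * (/ eta) ^ (2 * k)%N))).
intros w Hw Hr; pose proof (lip_rest_le k w Hk Hw Hr) as L.
assert (A0 : 0 <= A) by apply Rabs_pos.
destruct (Rlt_le_dec (Cmod w) delta) as [Hs|Hs].
- eapply Rle_trans; [|apply Rmax_l]; unfold lip_defect; rewrite full_sum_laurent //.
  replace (lip k w - (/ w ^ (2 * k)%N - RtoC (lip_const k) * Cpseries (laurent_coef (2 * k - 1)) (RtoC (- (2 * PI)) * Ci * w)))%C
   with ((lip k w - / w ^ (2 * k)%N) + RtoC (lip_const k) * Cpseries (laurent_coef (2 * k - 1)) (RtoC (- (2 * PI)) * Ci * w))%C by ring.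
  eapply Rle_trans; [apply Cmod_triangle|]; rewrite Cmod_mult Cmod_R; fold A.
  destruct (laurent_arg w Hw Hs) as [_ B].
  assert (Cmod (Cpseries (laurent_coef (2 * k - 1)) (RtoC (- (2 * PI)) * Ci * w)) <= BL) by (apply HL; lra).
  apply Rplus_le_compat; [exact L|apply Rmult_le_compat_l; assumption].
- eapply Rle_trans; [|apply Rmax_r]; unfold lip_defect.
  replace (lip k w - RtoC (lip_const k) * full_sum k (nome w))%C
   with ((lip k w - / w ^ (2 * k)%N) + / w ^ (2 * k)%N + - (RtoC (lip_const k) * full_sum k (nome w)))%C by ring.
  eapply Rle_trans; [apply Cmod_triangle|]; rewrite Cmod_opp Cmod_mult Cmod_R; fold A.
  specialize (HE w Hw Hr Hs); pose proof (nome_lt1 w Hw) as N1.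
  assert (W : Cmod (/ w ^ (2 * k)%N) <= (/ delta) ^ (2 * k)%N).
  { rewrite Cmod_inv; [|apply Cpow_nz, Im_neq0, Hw]; rewrite Cmod_pow -pow_inv.
    apply pow_incr; split; [left; apply Rinv_0_lt_compat; lra|apply Rinv_le_contravar; lra]. }
  assert (Q : Cmod (full_sum k (nome w)) <= BP * (/ eta) ^ (2 * k)%N).
  { unfold full_sum, Cdiv; rewrite Cmod_mult; apply Rmult_le_compat; try apply Cmod_ge_0; [apply HP; lra|].
    rewrite Cmod_inv; [|apply Cpow_nz, one_minus_neq0, N1]; rewrite Cmod_pow -pow_inv.
    apply pow_incr; split; [left; apply Rinv_0_lt_compat; lra|apply Rinv_le_contravar; lra]. }
  apply Rplus_le_compat; [|apply Rmult_le_compat_l; assumption].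
  eapply Rle_trans; [apply Cmod_triangle|lra].
Qed.

Lemma lip_defect_bounded k : (1 <= k)%N -> exists M, forall w, 0 < Im w -> Cmod (lip_defect k w) <= M.
Proof.
intros Hk; destruct (lip_defect_strip_bounded k Hk) as [M HM]; exists M; intros w Hw.
set (m := Int_part (Re w + 1 / 2)).
rewrite -(lip_defect_periodic_Z k w (- m) Hk Hw); apply HM; [rewrite Im_plus_R; exact Hw|].
replace (Re (w + RtoC (IZR (- m)))) with (Re w - IZR m) by (rewrite opp_IZR; destruct w; simpl; ring).
destruct (base_Int_part (Re w + 1 / 2)) as [H1 H2]; fold m in H1, H2.
apply Rabs_le_between; lra.
Qed.

(* The duplication formula halves any bound on the defect, so that it vanishes. *)
Lemma lipschitz k w : (1 <= k)%N -> 0 < Im w -> lip k w = (RtoC (lip_const k) * full_sum k (nome w))%C.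
Proof.
intros Hk; destruct (lip_defect_bounded k Hk) as [M HM].
assert (H : forall n w, 0 < Im w -> Cmod (lip_defect k w) <= M * (1 / 2) ^ n).
{ induction n as [|n IH]; intros z Hz; [simpl; rewrite Rmult_1_r; apply HM, Hz|].
  assert (H1 : 0 < Im (z / 2)) by (rewrite Im_div2; lra).
  assert (H2 : 0 < Im ((z + 1) / 2)) by (rewrite Im_div2 Im_plus_R; lra).
  pose proof (IH _ H1) as I1; pose proof (IH _ H2) as I2.
  pose proof (lip_defect_half k z Hk Hz) as E.
  pose proof (Cmod_triangle (lip_defect k (z / 2)) (lip_defect k ((z + 1) / 2))) as T.
  rewrite E Cmod_mult Cmod_R Rabs_pos_eq in T; [|apply pow_le; lra].
  assert (F : 4 <= 2 ^ (2 * k)%N).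
  { replace 4 with (2 ^ 2) by (simpl; ring); apply Rle_pow; [lra|lia]. }
  pose proof (Cmod_ge_0 (lip_defect k z)) as D0.
  change ((1 / 2) ^ n.+1) with (1 / 2 * (1 / 2) ^ n).
  assert (4 * Cmod (lip_defect k z) <= 2 ^ (2 * k)%N * Cmod (lip_defect k z)) by (apply Rmult_le_compat_r; assumption).
  lra. }
intros Hw; assert (Z : Cmod (lip_defect k w) <= 0).
{ apply Rnot_lt_le; intros L.
  assert (M0 : 0 < M) by (specialize (HM w Hw); lra).
  destruct (pow_lt_1_zero (1 / 2)) with (y := Cmod (lip_defect k w) / M) as [N HN].
  - rewrite Rabs_pos_eq; lra.
  - apply Rdiv_lt_0_compat; lra.
  - specialize (HN N (le_n N)); rewrite Rabs_pos_eq in HN; [|apply pow_le; lra].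
    specialize (H N w Hw); apply (Rmult_lt_compat_l M) in HN; [|exact M0].
    replace (M * (Cmod (lip_defect k w) / M)) with (Cmod (lip_defect k w)) in HN by (field; lra); lra. }
assert (E : lip_defect k w = RtoC 0) by (apply Cmod_eq_0, Rle_antisym; [exact Z|apply Cmod_ge_0]).
unfold lip_defect in E.
transitivity (lip k w - RtoC (lip_const k) * full_sum k (nome w) + RtoC (lip_const k) * full_sum k (nome w))%C;
  [ring|rewrite E; ring].
Qed.

(** * Zeta at even integers *)

Lemma Clim_Cderiv {T} (F : (T -> Prop) -> Prop) {FF : Filter F} f g l d :
  Cderiv g l d -> Clim F f l -> Clim F (fun x => g (f x)) (g l).
Proof.
intros Hg Hf eps Heps; destruct (Cderiv_lipschitz _ _ _ Hg) as [del [K [D0 [K0 H]]]].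
assert (e0 : 0 < Rmin del (eps / K)) by (apply Rmin_glb_lt; [exact D0|apply Rdiv_lt_0_compat; lra]).
generalize (Hf _ e0); apply filter_imp; intros x Hx.
assert (L1 : Cmod (f x - l) < del) by (eapply Rlt_le_trans; [exact Hx|apply Rmin_l]).
assert (L2 : Cmod (f x - l) < eps / K) by (eapply Rlt_le_trans; [exact Hx|apply Rmin_r]).
specialize (H _ L1); replace (l + (f x - l))%C with (f x) in H by ring.
eapply Rle_lt_trans; [exact H|].
apply (Rmult_lt_compat_l K) in L2; [|exact K0]; replace (K * (eps / K)) with eps in L2 by (field; lra); exact L2.
Qed.

Lemma Clim_inv {T} (F : (T -> Prop) -> Prop) {FF : Filter F} f l :
  l <> RtoC 0 -> Clim F f l -> Clim F (fun x => / f x)%C (/ l)%C.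
Proof. intros Hl; exact (Clim_Cderiv F f Cinv l _ (Cderiv_inv l Hl)). Qed.

Lemma Cpseries_0 a : Cpseries a 0 = a 0%N.
Proof.
apply CSeries_unique.
assert (F : forall i, (0 < i)%N -> (a i * RtoC 0 ^ i)%C = RtoC 0) by (intros [|i] Hi; [discriminate|rewrite Cpow_S; ring]).
pose proof (Cis_series_finite (fun n => a n * RtoC 0 ^ n)%C 0 F) as H.
rewrite Csum_O in H; replace (a 0%N * RtoC 0 ^ 0)%C with (a 0%N) in H by (simpl; ring); exact H.
Qed.

Lemma ex_series_zeta s : (2 <= s)%N -> ex_series (fun n => / INR n.+1 ^ s).
Proof.
intros Hs; apply (ex_series_le_R _ (fun n => / INR n.+1 ^ 2)); [|apply ex_series_inv_sq].
intros n; pose proof (lt_0_INR n.+1 (Nat.lt_0_succ _)) as N0.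
split; [left; apply Rinv_0_lt_compat, pow_lt, N0|].
apply Rinv_le_contravar; [apply pow_lt, N0|apply Rle_pow; [|lia]].
rewrite S_INR; pose proof (pos_INR n); lra.
Qed.

Lemma zeta_is_series s : (2 <= s)%N -> Cis_series (fun n => / RtoC (INR n.+1) ^ s)%C (RtoC (zeta s)).
Proof.
intros Hs; apply (Cis_series_ext (fun n => RtoC (/ INR n.+1 ^ s))).
- intros n; rewrite RtoC_inv; [rewrite RtoC_pow; reflexivity|apply pow_nonzero, not_0_INR; lia].
- apply Cis_series_RtoC, Series_correct, ex_series_zeta, Hs.
Qed.

Lemma lip_rest_0 k : (1 <= k)%N -> Cis_series (lip_rest_term k 0) (RtoC (2 * zeta (2 * k)%N)).
Proof.
intros Hk; assert (Hs : (2 <= 2 * k)%N) by lia; pose proof (zeta_is_series _ Hs) as Z.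
pose proof (Cis_series_S_inv (fun j => if j is n.+1 then / RtoC (INR n.+1) ^ (2 * k)%N else 0)%C _ Z) as Z'.
pose proof (Cis_series_plus _ _ _ _ Z' Z) as H; cbv beta iota in H.
replace (RtoC (2 * zeta (2 * k)%N)) with (0 + RtoC (zeta (2 * k)%N) + RtoC (zeta (2 * k)%N))%C.
- refine (Cis_series_ext _ _ _ _ H); intros j; unfold lip_rest_term; f_equal.
  + destruct j as [|j]; [reflexivity|]; change (j.+1 == 0%N) with false; cbv iota.
    do 2 f_equal; ring.
  + f_equal; replace (0 - RtoC (INR j.+1))%C with (- RtoC (INR j.+1))%C by ring; rewrite Cpow_opp_even; reflexivity.
- rewrite RtoC_mult; ring.
Qed.

(** The limit of [lip k w - 1 / w^(2k)] at [w = 0] is computed twice: dominated convergence gives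
    [2 zeta(2k)], and the Lipschitz formula gives minus [lip_const] times the constant Laurent
    coefficient, a Bernoulli number over [2k]. *)
Lemma zeta_even k : (1 <= k)%N ->
  zeta (2 * k)%N = (-1) ^ (k + 1)%N * 2 ^ (2 * k)%N * bernoulli (2 * k)%N * PI ^ (2 * k)%N / (2 * INR (2 * k)`!).
Proof.
intros Hk; pose proof PI_RGT_0 as P0.
(* Points of the imaginary axis stay in the strip and in the upper half-plane while they tend to
   0. *)
set (w := fun n => (Ci * RtoC (/ INR n.+1))%C).
assert (Wi : forall n, Im (w n) = / INR n.+1) by (intros n; unfold w; simpl; ring).
assert (W0 : forall n, 0 < Im (w n)) by (intros n; rewrite Wi; apply Rinv_0_lt_compat, lt_0_INR; lia).
assert (Wr : forall n, Rabs (Re (w n)) <= 1 / 2).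
{ intros n; replace (Re (w n)) with 0 by (unfold w; simpl; ring); rewrite Rabs_R0; lra. }
assert (WL : Clim eventually w 0).
{ unfold w; replace (RtoC 0) with (Ci * 0)%C by ring.
  apply (Clim_mult eventually); [apply (Clim_const eventually)|apply Clim_inv_INR]. }
assert (WS : eventually (fun n => Cmod (w n) < / (4 * PI))).
{ assert (e0 : 0 < / (4 * PI)) by (apply Rinv_0_lt_compat; lra).
  generalize (WL _ e0); apply filter_imp; intros n; replace (w n - 0)%C with (w n) by ring; auto. }
assert (L1 : Clim eventually (fun n => lip k (w n) - / w n ^ (2 * k)%N)%C (RtoC (2 * zeta (2 * k)%N))).
{ apply (tannery eventually (fun n => lip_rest_term k (w n)) (lip_rest_term k 0)
    (fun j => (2 * (/ (1 / 4)) ^ (2 * k)%N) * / INR j.+1 ^ 2)).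
  - assert (S : forall x, x <> 0 -> Clim eventually (fun n => / (w n + RtoC x) ^ (2 * k)%N)%C (/ (0 + RtoC x) ^ (2 * k)%N)%C).
    { intros x Hx; apply (Clim_inv eventually).
      - apply Cpow_nz; rewrite Cplus_0_l; apply RtoC_neq0, Hx.
      - apply (Clim_pow eventually), (Clim_plus eventually); [exact WL|apply (Clim_const eventually)]. }
    assert (S' : forall j, Clim eventually (fun n => / (w n - RtoC (INR j.+1)) ^ (2 * k)%N)%C (/ (0 - RtoC (INR j.+1)) ^ (2 * k)%N)%C).
    { intros j; unfold Cminus; rewrite -RtoC_opp; apply S.
      pose proof (lt_0_INR j.+1 (Nat.lt_0_succ _)); lra. }
    intros j; apply (Clim_plus eventually); [|apply S'].
    destruct j as [|j]; [exact (Clim_const eventually (RtoC 0))|apply S, not_0_INR; lia].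
  - apply filter_forall; intros n j; apply lip_rest_term_bound; [exact Hk|apply Wr].
  - intros j; apply lip_rest_term_bound; [exact Hk|simpl; rewrite Rabs_R0; lra].
  - apply ex_lip_rest_bound.
  - apply filter_forall; intros n; apply lip_rest_series; [exact Hk|apply W0].
  - apply lip_rest_0, Hk. }
set (a := laurent_coef (2 * k - 1)).
assert (L2 : Clim eventually (fun n => lip k (w n) - / w n ^ (2 * k)%N)%C (- (RtoC (lip_const k) * a 0%N))%C).
{ apply (Clim_ext eventually (fun n => - (RtoC (lip_const k) * Cpseries a (RtoC (- (2 * PI)) * Ci * w n)))%C).
  - generalize WS; apply filter_imp; intros n Hn; rewrite lipschitz // full_sum_laurent //; fold a; ring.
  - apply (Clim_opp eventually), (Clim_mult eventually); [apply (Clim_const eventually)|].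
    rewrite -Cpseries_0; apply (Clim_Cderiv eventually _ _ _ (Cpseries (deriv_coef a) 0)).
    + apply Cpseries_deriv; [apply laurent_coef_disk|rewrite Cmod_0; lra].
    + replace (RtoC 0) with (RtoC (- (2 * PI)) * Ci * 0)%C by ring.
      apply (Clim_mult eventually); [apply (Clim_const eventually)|exact WL]. }
pose proof (Clim_uniq eventually _ _ _ L1 L2) as E; unfold a in E.
rewrite laurent_coef_const in E; [|lia].
rewrite -RtoC_mult -RtoC_opp in E; apply RtoC_inj in E.
replace (2 * k - 1).+1 with (2 * k)%N in E by lia; unfold lip_const, todd in E.
pose proof (INR_fact_gt0 (2 * k - 1)%N); pose proof (INR_fact_gt0 (2 * k)%N).
rewrite Rpow_mult_distr in E; rewrite addn1; change ((-1) ^ k.+1) with (-1 * (-1) ^ k).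
apply (Rmult_eq_reg_l 2); [|lra]; rewrite E; field; split; lra.
Qed.

(** * The inversion formula *)

(** The terms [j = 2p, -2p-2] and, with a minus sign, [j = 2p+1, -2p-1] of the series of
    [(-1)^j / (w+j)^(2k)]. Each even index stands next to an odd one, so that their difference gains
    one power of decay. *)
Definition alt_term (k : nat) (w : C) (p : nat) : C :=
  (/ (w + RtoC (INR (2 * p)%N)) ^ (2 * k)%N + / (w - RtoC (INR (2 * p + 1)%N.+1)) ^ (2 * k)%N
   - (/ (w + RtoC (INR (2 * p + 1)%N)) ^ (2 * k)%N + / (w - RtoC (INR (2 * p).+1)) ^ (2 * k)%N))%C.

Definition odd_const (k : nat) : R := 2 ^ (2 * k)%N / (2 * lip_const k).

Lemma lip_const_neq0 k : lip_const k <> 0.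
Proof.
pose proof PI_RGT_0; unfold lip_const, Rdiv; repeat apply Rmult_integral_contrapositive_currified.
- apply pow_nonzero; lra.
- apply pow_nonzero; lra.
- apply Rinv_neq_0_compat, Rgt_not_eq, INR_fact_gt0.
Qed.

Lemma pow2_neq0 n : 2 ^ n <> 0.
Proof. apply pow_nonzero; lra. Qed.

Lemma nome_half_shift w : nome ((w + 1) / 2) = (- nome (w / 2))%C.
Proof.
replace ((w + 1) / 2)%C with (w / 2 + 1 / 2)%C by (field; apply RtoC2_neq0).
rewrite nome_plus nome_half; ring.
Qed.

(** The difference, instead of the sum, of [lip] at [w / 2] and [(w + 1) / 2] attaches the signs
    [(-1)^j]. The nomes at these points are opposite, so the Lipschitz formula produces the odd
    part; the factors make up [odd_const]. *)
Lemma alt_term_series k w : (1 <= k)%N -> 0 < Im w ->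
  Cis_series (alt_term k w) (odd_part_sum k (nome (w / 2)) / RtoC (odd_const k))%C.
Proof.
intros Hk Hw.
assert (H1 : 0 < Im (w / 2)) by (rewrite Im_div2; lra).
assert (H2 : 0 < Im ((w + 1) / 2)) by (rewrite Im_div2 Im_plus_R; lra).
pose proof (Cis_series_scal (/ RtoC (2 ^ (2 * k)%N)) _ _
  (Cis_series_minus _ _ _ _ (lip_is_series k _ Hk H1) (lip_is_series k _ Hk H2))) as H.
pose proof (RtoC_neq0 _ (pow2_neq0 (2 * k)%N)) as P2; pose proof (RtoC_neq0 _ (lip_const_neq0 k)) as L.
match goal with |- Cis_series _ ?s => match type of H with Cis_series _ ?t => replace s with t end end.
- refine (Cis_series_ext _ _ _ _ H); intros p; cbv beta.
  destruct (lip_term_pair k w p Hw) as [-> ->]; unfold alt_term.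
  match goal with |- (_ * (_ * ?a - _ * ?b))%C = _ => generalize a b end; intros a b; field; exact P2.
- rewrite !lipschitz // nome_half_shift odd_part_sum_full //; [|apply nome_lt1, H1].
  unfold odd_const, Rdiv; rewrite RtoC_mult RtoC_inv; [|apply Rmult_integral_contrapositive_currified; [lra|apply lip_const_neq0]].
  rewrite RtoC_mult; field; repeat split; try assumption; try apply RtoC2_neq0.
Qed.

(** By induction on [s], peeling off one factor; the gain over [b^s] comes from
    [1/u - 1/v = -(u-v)/(uv)]. *)
Lemma inv_pow_diff_bound s u v b : 0 <= b -> u <> RtoC 0 -> v <> RtoC 0 -> Cmod (u - v) = 1 ->
  Cmod (/ u) <= b -> Cmod (/ v) <= b -> Cmod (/ u ^ s - / v ^ s) <= INR s * b ^ s.+1.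
Proof.
intros Hb Hu Hv Huv Bu Bv; induction s as [|s IH].
- simpl Cpow; replace (/ 1 - / 1)%C with (RtoC 0) by ring; rewrite Cmod_0; simpl; lra.
- replace (/ u ^ s.+1 - / v ^ s.+1)%C with (/ u * (/ u ^ s - / v ^ s) + / v ^ s * ((- (u - v)) * (/ u * / v)))%C.
  + eapply Rle_trans; [apply Cmod_triangle|]; rewrite S_INR Rmult_plus_distr_r Rmult_1_l.
    apply Rplus_le_compat.
    * rewrite Cmod_mult; apply Rle_trans with (b * (INR s * b ^ s.+1)); [|right; simpl; ring].
      apply Rmult_le_compat; try apply Cmod_ge_0; assumption.
    * rewrite !Cmod_mult Cmod_opp Huv Rmult_1_l.
      apply Rle_trans with (b ^ s * (b * b)); [|right; simpl; ring].
      apply Rmult_le_compat; try apply Cmod_ge_0; [apply Rmult_le_pos; apply Cmod_ge_0| |].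
      -- rewrite -Cpow_inv // Cmod_pow; apply pow_incr; split; [apply Cmod_ge_0|exact Bv].
      -- apply Rmult_le_compat; try apply Cmod_ge_0; assumption.
  + rewrite !Cpow_S; field; repeat split; try assumption; apply Cpow_nz; assumption.
Qed.

Lemma inv_le_scaled z d X : 0 < d -> 0 < X -> d * X <= Cmod z -> z <> RtoC 0 /\ Cmod (/ z) <= / d * / X.
Proof.
intros Hd HX H; assert (P : 0 < d * X) by (apply Rmult_lt_0_compat; assumption).
assert (Z : z <> RtoC 0) by (apply Cmod_gt_0; lra).
split; [exact Z|]; rewrite (Cmod_inv _ Z) -Rinv_mult; apply Rinv_le_contravar; assumption.
Qed.

(** With [X = n + 1 + p] each pair of neighbours is [O(X^(-2k-1))], hence [O(X^(-3))], and [X^(-3)]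
    is at most [2 / ((n+1) X (X+1))]. Summed over [p] this telescopes to [O(1/(n+1)^2)], which is
    summable even in weight two. *)
Lemma alt_term_bound k sigma : (1 <= k)%N -> 0 < Im sigma -> exists K, 0 < K /\ forall n p,
  Cmod (alt_term k (RtoC (INR (2 * n + 1)%N) * sigma) p)
   <= K * / INR n.+1 * / (INR (n.+1 + p) * INR (n.+1 + p).+1).
Proof.
intros Hk Hs; destruct (lattice_bound_le1 sigma Hs) as [c [C0 H]].
set (s := (2 * k)%N); assert (c1 : 1 <= / c) by (rewrite -Rinv_1; apply Rinv_le_contravar; lra).
assert (cp : 0 < (/ c) ^ s.+1) by (apply pow_lt; lra).
assert (s0 : 0 < INR s) by (apply lt_0_INR; unfold s; lia).
exists (4 * INR s * (/ c) ^ s.+1); split; [apply Rmult_lt_0_compat; [apply Rmult_lt_0_compat; lra|exact cp]|]; intros n p.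
set (N := (2 * n + 1)%N); set (X := INR (n.+1 + p)).
assert (X1 : 1 <= X) by (unfold X; rewrite -INR_1; apply le_INR; lia).
assert (Xn : INR n.+1 <= X) by (apply le_INR; lia).
assert (n1 : 0 < INR n.+1) by (apply lt_0_INR; lia).
assert (B : forall x, INR (2 * p)%N <= Rabs x -> (RtoC (INR N) * sigma + RtoC x)%C <> RtoC 0 /\
   Cmod (/ (RtoC (INR N) * sigma + RtoC x)) <= / c * / X).
{ intros x Hx; apply inv_le_scaled; [lra|lra|]; eapply Rle_trans; [|apply H].
  apply Rmult_le_compat_l; [lra|].
  apply Rle_trans with (INR N + INR (2 * p)%N); [|lra].
  rewrite -plus_INR; apply le_INR; unfold N; lia. }
assert (b0 : 0 <= / c * / X) by (apply Rmult_le_pos; [lra|left; apply Rinv_0_lt_compat; lra]).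
assert (D : forall x y, INR (2 * p)%N <= Rabs x -> INR (2 * p)%N <= Rabs y -> Rabs (x - y) = 1 ->
  Cmod (/ (RtoC (INR N) * sigma + RtoC x) ^ s - / (RtoC (INR N) * sigma + RtoC y) ^ s)
   <= INR s * (/ c) ^ s.+1 * (2 * / INR n.+1 * / (X * (X + 1)))).
{ intros x y Hx Hy Hxy; destruct (B x Hx) as [U1 U2]; destruct (B y Hy) as [V1 V2].
  eapply Rle_trans; [apply (inv_pow_diff_bound s _ _ (/ c * / X)); try assumption|].
  - replace (RtoC (INR N) * sigma + RtoC x - (RtoC (INR N) * sigma + RtoC y))%C with (RtoC (x - y))
      by (rewrite RtoC_minus; ring).
    rewrite Cmod_R; exact Hxy.
  - rewrite Rpow_mult_distr -Rmult_assoc; apply Rmult_le_compat_l; [apply Rmult_le_pos; lra|].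
    apply Rle_trans with (/ X ^ 3).
    + rewrite pow_inv; apply Rinv_le_contravar; [apply pow_lt; lra|apply Rle_pow; [exact X1|unfold s; lia]].
    + rewrite Rmult_assoc -Rinv_mult; apply Rle_trans with (/ (INR n.+1 * (X * (X + 1)) / 2)).
      * apply Rinv_le_contravar; [apply Rdiv_lt_0_compat; [apply Rmult_lt_0_compat; nra|lra]|].
        apply Rle_trans with (X * (X * (X + X)) / 2); [|right; simpl; field].
        apply Rmult_le_compat_r; [lra|]; apply Rmult_le_compat; nra.
      * right; field; split; nra. }
assert (E2 : INR (2 * p).+1 = INR (2 * p)%N + 1) by apply S_INR.
assert (E3 : INR (2 * p + 1)%N = INR (2 * p)%N + 1) by (rewrite addn1; apply S_INR).
assert (E4 : INR (2 * p + 1)%N.+1 = INR (2 * p)%N + 2) by (rewrite S_INR E3; ring).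
pose proof (pos_INR (2 * p)%N) as Q0.
assert (A1 : Rabs (INR (2 * p)%N - (INR (2 * p)%N + 1)) = 1).
{ replace (INR (2 * p)%N - (INR (2 * p)%N + 1)) with (- (1)) by ring; rewrite Rabs_Ropp Rabs_R1; reflexivity. }
assert (A2 : Rabs (- (INR (2 * p)%N + 2) - - (INR (2 * p)%N + 1)) = 1).
{ replace (- (INR (2 * p)%N + 2) - - (INR (2 * p)%N + 1)) with (- (1)) by ring; rewrite Rabs_Ropp Rabs_R1; reflexivity. }
assert (G : forall t, INR (2 * p)%N <= t -> INR (2 * p)%N <= Rabs t).
{ intros t Ht; pose proof (Rle_abs t); lra. }
assert (G' : forall t, INR (2 * p)%N <= t -> INR (2 * p)%N <= Rabs (- t)).
{ intros t Ht; rewrite Rabs_Ropp; apply G, Ht. }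
pose proof (D _ _ (G (INR (2 * p)%N) ltac:(lra)) (G (INR (2 * p)%N + 1) ltac:(lra)) A1) as D1.
pose proof (D _ _ (G' (INR (2 * p)%N + 2) ltac:(lra)) (G' (INR (2 * p)%N + 1) ltac:(lra)) A2) as D2.
unfold alt_term; fold s; fold N; rewrite E2 E3 E4 (S_INR (n.+1 + p)); fold X.
rewrite (RtoC_opp (INR (2 * p)%N + 2)) (RtoC_opp (INR (2 * p)%N + 1)) in D2.
set (w := (RtoC (INR N) * sigma)%C) in *.
match type of D1 with Cmod ?d <= _ => match type of D2 with Cmod ?e <= _ =>
  replace (/ (w + RtoC (INR (2 * p)%N)) ^ s + / (w - RtoC (INR (2 * p)%N + 2)) ^ s
   - (/ (w + RtoC (INR (2 * p)%N + 1)) ^ s + / (w - RtoC (INR (2 * p)%N + 1)) ^ s))%C with (d + e)%C by (unfold Cminus; ring) end end.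
eapply Rle_trans; [apply Cmod_triangle|].
replace (4 * INR s * (/ c) ^ s.+1 * / INR n.+1 * / (X * (X + 1))) with
 (INR s * (/ c) ^ s.+1 * (2 * / INR n.+1 * / (X * (X + 1))) + INR s * (/ c) ^ s.+1 * (2 * / INR n.+1 * / (X * (X + 1)))) by ring.
apply Rplus_le_compat; assumption.
Qed.

(* Summing over odd multiples of [sigma] first or over integers first: the pairing of opposite signs
   makes the double series absolutely convergent even in weight two. *)
Lemma alt_term_fubini k sigma : (1 <= k)%N -> 0 < Im sigma ->
  Cis_series (fun p => CSeries (fun n => alt_term k (RtoC (INR (2 * n + 1)%N) * sigma) p))
    (q_series k (nome (sigma / 2)) / RtoC (odd_const k))%C.
Proof.
intros Hk Hs; destruct (alt_term_bound k sigma Hk Hs) as [K [K0 HK]].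
set (a := fun n p => alt_term k (RtoC (INR (2 * n + 1)%N) * sigma) p).
assert (Hn : forall n, 0 < Im (RtoC (INR (2 * n + 1)%N) * sigma)).
{ intros n; replace (Im _) with (INR (2 * n + 1)%N * Im sigma) by (destruct sigma; simpl; ring).
  apply Rmult_lt_0_compat; [apply lt_0_INR; lia|exact Hs]. }
assert (Bex : forall n, is_series (fun p => K * / INR n.+1 * / (INR (n.+1 + p) * INR (n.+1 + p).+1)) (K * / INR n.+1 * / INR n.+1)).
{ intros n; apply (@is_series_scal R_AbsRing R_NormedModule (K * / INR n.+1)), is_series_inv_consecutive. }
assert (Ha : forall n, Cabs_series (a n)).
{ intros n; apply (Cabs_series_le _ _ (HK n)); eexists; apply Bex. }
destruct (Cabs_series_fubini a (fun n => K * / INR n.+1 ^ 2) Ha) as [_ F].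
- intros n; apply Rle_trans with (Series (fun p => K * / INR n.+1 * / (INR (n.+1 + p) * INR (n.+1 + p).+1))).
  + apply Series_le; [intros p; split; [apply Cmod_ge_0|apply HK]|eexists; apply Bex].
  + rewrite (is_series_unique _ _ (Bex n)); right; generalize (INR n.+1) (not_0_INR n.+1 (Nat.neq_succ_0 n)); intros x Hx; field; exact Hx.
- apply (@ex_series_scal_l R_AbsRing R_NormedModule), ex_series_inv_sq.
- replace (q_series k (nome (sigma / 2)) / RtoC (odd_const k))%C with (CSeries (fun i => CSeries (a i))); [exact F|].
  apply CSeries_unique.
  assert (Hs2 : 0 < Im (sigma / 2)) by (rewrite Im_div2; lra).
  apply (Cis_series_ext (fun n => / RtoC (odd_const k) * series_term k (nome (sigma / 2)) n)%C).
  + intros n; rewrite (CSeries_unique _ _ (alt_term_series k _ Hk (Hn n))) series_term_odd_part_sum.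
    replace (nome (RtoC (INR (2 * n + 1)%N) * sigma / 2)) with (nome (sigma / 2) ^ (2 * n + 1)%N)%C.
    * unfold Cdiv; ring.
    * unfold nome; rewrite -Cexp_INR; f_equal; field; apply RtoC2_neq0.
  + replace (q_series k (nome (sigma / 2)) / RtoC (odd_const k))%C
      with (/ RtoC (odd_const k) * q_series k (nome (sigma / 2)))%C by apply Cmult_comm.
    apply Cis_series_scal, q_series_is_series; [exact Hk|apply nome_lt1, Hs2].
Qed.

(** The expansion at the cusp 0 without its constant term: half the sum over [j >= 1] of [(-1)^j]
    times [full_sum k] at [-x^j], taken in consecutive pairs. *)
Definition cusp_tail (k : nat) (x : C) : C :=
  CSeries (fun p => (full_sum k (- x ^ (2 * p + 2)%N) - full_sum k (- x ^ (2 * p + 1)%N)) / 2)%C.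

Lemma cusp_tail_term_bound k rho : (1 <= k)%N -> 0 < rho < 1 -> exists K, 0 < K /\ forall x p, Cmod x <= rho ->
  Cmod ((full_sum k (- x ^ (2 * p + 2)%N) - full_sum k (- x ^ (2 * p + 1)%N)) / 2)%C <= K * Cmod x * rho ^ p.
Proof.
intros Hk Hr; destruct (full_sum_bound k rho Hk Hr) as [K [K0 HK]].
exists K; split; [exact K0|]; intros x p Hx; pose proof (Cmod_ge_0 x) as x0.
assert (B : forall i, Cmod (full_sum k (- x ^ (2 * p + i.+1)%N)) <= K * (Cmod x * rho ^ p)).
{ intros i; assert (P : Cmod (- x ^ (2 * p + i.+1)%N) <= Cmod x * rho ^ p).
  { rewrite Cmod_opp Cmod_pow; replace (2 * p + i.+1)%N with (p + (p + i)).+1 by lia.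
    change (Cmod x ^ (p + (p + i)).+1) with (Cmod x * Cmod x ^ (p + (p + i))%N).
    apply Rmult_le_compat_l; [exact x0|].
    rewrite -plusE pow_add -(Rmult_1_r (rho ^ p)); apply Rmult_le_compat; try (apply pow_le; exact x0).
    - apply pow_incr; lra.
    - apply pow_le_1; lra. }
  assert (Q : Cmod (- x ^ (2 * p + i.+1)%N) <= rho).
  { eapply Rle_trans; [exact P|]; assert (rho ^ p <= 1) by (apply pow_le_1; lra); nra. }
  eapply Rle_trans; [apply HK, Q|apply Rmult_le_compat_l; lra]. }
unfold Cdiv; rewrite Cmod_mult (Cmod_inv _ RtoC2_neq0) Cmod_R (Rabs_pos_eq 2); [|lra].
pose proof (B 1%N) as B1; pose proof (B 0%N) as B2.
pose proof (Cmod_triangle (full_sum k (- x ^ (2 * p + 2)%N)) (- full_sum k (- x ^ (2 * p + 1)%N))) as T.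
rewrite Cmod_opp in T; unfold Cminus; lra.
Qed.

Lemma cusp_tail_is_series k x : (1 <= k)%N -> Cmod x < 1 ->
  Cis_series (fun p => (full_sum k (- x ^ (2 * p + 2)%N) - full_sum k (- x ^ (2 * p + 1)%N)) / 2)%C (cusp_tail k x).
Proof.
intros Hk Hx; pose proof (Cmod_ge_0 x).
destruct (cusp_tail_term_bound k ((1 + Cmod x) / 2) Hk) as [K [K0 HK]]; [lra|].
apply Cabs_series_CSeries, (Cabs_series_le _ (fun p => K * Cmod x * ((1 + Cmod x) / 2) ^ p)).
- intros p; apply HK; lra.
- apply ex_series_geom_scal; lra.
Qed.

Lemma cusp_tail_bound k : (1 <= k)%N -> exists K, 0 < K /\ forall x, Cmod x <= 1 / 2 -> Cmod (cusp_tail k x) <= K * Cmod x.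
Proof.
intros Hk; destruct (cusp_tail_term_bound k (1 / 2) Hk) as [K [K0 HK]]; [lra|].
exists (K * 2); split; [lra|]; intros x Hx.
assert (Hx1 : Cmod x < 1) by lra.
replace (K * 2 * Cmod x) with (Series (fun p => (K * Cmod x) * (1 / 2) ^ p)).
- apply (Cis_series_Cmod_le _ _ _ (cusp_tail_is_series k x Hk Hx1)).
  + intros p; apply HK, Hx.
  + apply ex_series_geom_scal; lra.
- rewrite Series_scal_l Series_geom; [field|rewrite Rabs_pos_eq; lra].
Qed.

Section ColumnSums.
Variables (k : nat) (tau : C).
Hypotheses (Hk : (1 <= k)%N) (Ht : 0 < Im tau).

(** Row [j] of the lattice is cut in two, [e] being the sign of the odd integers. The grouping of
    [alt_term] mixes half rows of different [j], so the halves are tracked separately. *)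
Definition half_row (j : nat) (e : R) (n : nat) : C :=
  (/ (RtoC (INR j) * tau + RtoC (e * INR (2 * n + 1)%N)) ^ (2 * k)%N)%C.

Lemma half_row_bound : exists K, 0 < K /\ forall j e n, Rabs e = 1 ->
  (RtoC (INR j) * tau + RtoC (e * INR (2 * n + 1)%N))%C <> RtoC 0 /\
  Cmod (half_row j e n) <= K * / INR (j + n).+1 ^ 2.
Proof.
destruct (lattice_bound_le1 tau Ht) as [c [C0 H]].
exists ((/ c) ^ (2 * k)%N); split; [apply pow_lt, Rinv_0_lt_compat; lra|]; intros j e n He.
assert (B : c * INR (j + n).+1 <= Cmod (RtoC (INR j) * tau + RtoC (e * INR (2 * n + 1)%N))).
{ eapply Rle_trans; [|apply H]; apply Rmult_le_compat_l; [lra|].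
  rewrite Rabs_mult He Rmult_1_l Rabs_pos_eq; [|apply pos_INR].
  rewrite -plus_INR; apply le_INR; lia. }
pose proof (lt_0_INR (j + n).+1 (Nat.lt_0_succ _)) as P.
split; [apply Cmod_gt_0; assert (0 < c * INR (j + n).+1) by nra; lra|].
apply Cpow_inv_bound; [lia|lra|exact B].
Qed.

Lemma half_row_le j e n K : 0 < K -> Cmod (half_row j e n) <= K * / INR (j + n).+1 ^ 2 ->
  Cmod (half_row j e n) <= K * / INR n.+1 ^ 2 /\ Cmod (half_row j e n) <= K * / INR j.+1 ^ 2.
Proof.
intros K0 H; split; (eapply Rle_trans; [exact H|]; apply Rmult_le_compat_l; [lra|];
  apply Rinv_le_contravar; [apply pow_lt, lt_0_INR; lia|apply pow_incr; split; [apply pos_INR|apply le_INR; lia]]).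
Qed.

Definition half_row_sum (j : nat) (e : R) : C := CSeries (half_row j e).

Lemma half_row_is_series j e : Rabs e = 1 -> Cis_series (half_row j e) (half_row_sum j e).
Proof.
intros He; destruct half_row_bound as [K [K0 HK]].
apply Cabs_series_CSeries, (Cabs_series_le _ (fun n => K * / INR n.+1 ^ 2)).
- intros n; apply half_row_le; [exact K0|apply HK, He].
- apply (@ex_series_scal_l R_AbsRing R_NormedModule), ex_series_inv_sq.
Qed.

(** Needed for the telescoping of half rows: each term tends to 0 in [j], and inverse squares in [n]
    dominate uniformly in [j]. *)
Lemma half_row_sum_lim e : Rabs e = 1 -> Clim eventually (fun j => half_row_sum j e) 0.
Proof.
intros He; destruct half_row_bound as [K [K0 HK]].
apply (tannery eventually (fun j n => half_row j e n) (fun _ => RtoC 0) (fun n => K * / INR n.+1 ^ 2)).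
- intros n; apply (Clim_squeeze eventually _ _ (fun j => K * / INR j.+1)).
  + apply filter_forall; intros j; replace (half_row j e n - 0)%C with (half_row j e n) by ring.
    eapply Rle_trans; [apply (half_row_le j e n K K0), HK, He|].
    apply Rmult_le_compat_l; [lra|].
    pose proof (lt_0_INR j.+1 (Nat.lt_0_succ _)) as P.
    assert (P1 : 1 <= INR j.+1) by (rewrite S_INR; pose proof (pos_INR j); lra).
    apply Rinv_le_contravar; [exact P|]; generalize (INR j.+1) P P1; intros y Y0 Y1; simpl; nra.
  + intros eps Heps; assert (e0 : 0 < eps / K) by (apply Rdiv_lt_0_compat; lra).
    destruct (Clim_inv_INR _ e0) as [N HN]; exists N; intros j Hj; specialize (HN j Hj).
    replace (RtoC (/ INR j.+1) - 0)%C with (RtoC (/ INR j.+1)) in HN by ring.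
    rewrite Cmod_R in HN; pose proof (Rle_abs (/ INR j.+1)).
    assert (L : / INR j.+1 < eps / K) by lra; apply (Rmult_lt_compat_l K) in L; [|lra].
    replace (K * (eps / K)) with eps in L by (field; lra); exact L.
- apply filter_forall; intros j n; apply half_row_le; [exact K0|apply HK, He].
- intros n; rewrite Cmod_0; apply Rmult_le_pos; [lra|left; apply Rinv_0_lt_compat, pow_lt, lt_0_INR; lia].
- apply (@ex_series_scal_l R_AbsRing R_NormedModule), ex_series_inv_sq.
- apply filter_forall; intros j; apply half_row_is_series, He.
- apply Cis_series_0; reflexivity.
Qed.

Lemma Rabs_m1 : Rabs (-1) = 1.
Proof. rewrite Rabs_left; lra. Qed.

(** A full row runs over all odd integers, which up to a factor are the terms of [lip] at
    [(w + 1) / 2]; the Lipschitz formula then applies. *)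
Lemma full_row_sum j : (1 <= j)%N ->
  (half_row_sum j (-1) + half_row_sum j 1
   = RtoC (lip_const k / 2 ^ (2 * k)%N) * full_sum k (- nome (tau / 2) ^ j))%C.
Proof.
intros Hj; set (w := (RtoC (INR j) * tau)%C).
assert (Hw : 0 < Im w).
{ unfold w; replace (Im _) with (INR j * Im tau) by (destruct tau; simpl; ring).
  apply Rmult_lt_0_compat; [apply lt_0_INR; lia|exact Ht]. }
assert (H2 : 0 < Im ((w + 1) / 2)) by (rewrite Im_div2 Im_plus_R; lra).
pose proof (Cis_series_plus _ _ _ _ (half_row_is_series j _ Rabs_m1) (half_row_is_series j _ Rabs_R1)) as H.
replace (- nome (tau / 2) ^ j)%C with (nome ((w + 1) / 2)).
- pose proof (Cis_series_scal (/ RtoC (2 ^ (2 * k)%N)) _ _ (lip_is_series k _ Hk H2)) as L.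
  rewrite lipschitz // in L.
  unfold Rdiv; rewrite RtoC_mult RtoC_inv; [|apply pow2_neq0].
  rewrite -Cmult_assoc Cmult_assoc (Cmult_comm (RtoC (lip_const k))) -Cmult_assoc.
  apply (Cis_series_unique _ _ _ H); refine (Cis_series_ext _ _ _ _ L); intros n; cbv beta.
  destruct (lip_term_pair k w n Hw) as [_ ->]; unfold half_row; fold w.
  replace (-1 * INR (2 * n + 1)%N) with (- INR (2 * n).+1) by (rewrite addn1; ring).
  rewrite Rmult_1_l RtoC_opp; fold (w - RtoC (INR (2 * n).+1))%C.
  match goal with |- (_ * (_ * (?a + ?b)))%C = _ => generalize a b end; intros a b.
  field; apply RtoC_neq0, pow2_neq0.
- rewrite nome_half_shift; f_equal; unfold nome, w; rewrite -Cexp_INR; f_equal; field; apply RtoC2_neq0.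
Qed.

Lemma half_row_sum_0 : half_row_sum 0 (-1) = RtoC ((1 - / 2 ^ (2 * k)%N) * zeta (2 * k)%N).
Proof.
assert (Hs : (2 <= 2 * k)%N) by lia.
pose proof (Cis_series_pairs _ _ (zeta_is_series _ Hs)) as Z1.
pose proof (Cis_series_scal (RtoC (/ 2 ^ (2 * k)%N)) _ _ (zeta_is_series _ Hs)) as Z2.
pose proof (Cis_series_minus _ _ _ _ Z1 Z2) as Z.
replace (RtoC ((1 - / 2 ^ (2 * k)%N) * zeta (2 * k)%N)) with
  (RtoC (zeta (2 * k)%N) - RtoC (/ 2 ^ (2 * k)%N) * RtoC (zeta (2 * k)%N))%C
  by (rewrite -RtoC_mult -RtoC_minus; f_equal; ring).
apply (Cis_series_unique _ _ _ (half_row_is_series 0 _ Rabs_m1)).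
refine (Cis_series_ext _ _ _ _ Z); intros n; cbv beta; unfold half_row.
replace (RtoC (INR 0) * tau + RtoC (-1 * INR (2 * n + 1)%N))%C with (- RtoC (INR (2 * n).+1))%C.
- rewrite Cpow_opp_even.
  assert (E : RtoC (INR (2 * n + 1)%N.+1) = (RtoC 2 * RtoC (INR n.+1))%C).
  { rewrite -RtoC_mult; f_equal; replace (2 * n + 1)%N.+1 with (2 * n.+1)%N by lia.
    rewrite mulnE mult_INR; simpl (INR 2); ring. }
  rewrite E Cpow_mult_l RtoC_inv; [|apply pow2_neq0]; rewrite RtoC_pow.
  field; repeat split; apply Cpow_nz; try apply RtoC2_neq0; apply RtoC_neq0, not_0_INR; lia.
- simpl (INR 0); rewrite addn1 RtoC_mult RtoC_m1; ring.
Qed.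

(** Since [-N/tau + j = (j tau - N)/tau], the terms with a fixed integer [j] become a half row of
    index [|j|], whose sign is opposite to that of [j]. *)
Lemma alt_term_inversion n p :
  alt_term k (RtoC (INR (2 * n + 1)%N) * (- / tau)) p = (tau ^ (2 * k)%N *
    (half_row (2 * p) (-1) n + half_row (2 * p + 2) 1 n
      - (half_row (2 * p + 1) (-1) n + half_row (2 * p + 1) 1 n)))%C.
Proof.
pose proof (Im_neq0 _ Ht) as T0; destruct half_row_bound as [K [_ HK]].
set (N := RtoC (INR (2 * n + 1)%N)).
assert (A : forall j, (/ (N * - / tau + RtoC (INR j)) ^ (2 * k)%N = tau ^ (2 * k)%N * half_row j (-1) n)%C).
{ intros j; unfold half_row; destruct (HK j (-1) n Rabs_m1) as [Z _]; revert Z.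
  replace (RtoC (-1 * INR (2 * n + 1)%N)) with (- N)%C by (unfold N; rewrite RtoC_mult RtoC_m1; ring).
  intros Z; replace (N * - / tau + RtoC (INR j))%C with (/ tau * (RtoC (INR j) * tau + - N))%C by (field; exact T0).
  rewrite Cpow_mult_l Cpow_inv //; field; split; apply Cpow_nz; assumption. }
assert (B : forall j, (/ (N * - / tau - RtoC (INR j)) ^ (2 * k)%N = tau ^ (2 * k)%N * half_row j 1 n)%C).
{ intros j; unfold half_row; destruct (HK j 1 n Rabs_R1) as [Z _]; revert Z; rewrite Rmult_1_l; fold N.
  intros Z; replace (N * - / tau - RtoC (INR j))%C with (- (/ tau * (RtoC (INR j) * tau + N)))%C by (field; exact T0).
  rewrite Cpow_opp_even Cpow_mult_l Cpow_inv //; field; split; apply Cpow_nz; assumption. }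
unfold alt_term; rewrite !A !B; replace (2 * p + 1).+1 with (2 * p + 2)%N by lia.
replace (2 * p).+1 with (2 * p + 1)%N by lia; ring.
Qed.

Definition cusp_value : R := odd_const k * ((1 - / 2 ^ (2 * k)%N) * zeta (2 * k)%N).

Lemma Im_inversion : 0 < Im (- / tau).
Proof.
destruct tau as [x y]; simpl in *.
replace (- (- y / (x * (x * 1) + y * (y * 1)))) with (y / (x * x + y * y)) by (field; nra).
apply Rdiv_lt_0_compat; [exact Ht|nra].
Qed.

(** After the exchange of summations the [p]-th sum contains the half rows [(2p, -1)] and
    [(2p+2, 1)] with a plus sign. Completing the row [2p + 2] leaves the difference of the half rows
    [(2p, -1)] and [(2p+2, -1)]. These differences telescope to the half row [j = 0], the constant
    term, while the full rows give [cusp_tail]. *)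
Lemma q_series_inversion :
  q_series k (nome (- / tau / 2)) = (tau ^ (2 * k)%N * (RtoC cusp_value + cusp_tail k (nome (tau / 2))))%C.
Proof.
pose proof (alt_term_fubini k _ Hk Im_inversion) as F.
assert (Ht2 : 0 < Im (tau / 2)) by (rewrite Im_div2; lra).
pose proof (lip_const_neq0 k) as L0; pose proof (pow2_neq0 (2 * k)%N) as P0.
pose proof (Cis_series_telescope (fun p => half_row_sum (2 * p) (-1))) as T.
rewrite muln0 half_row_sum_0 in T.
assert (TL : Clim eventually (fun p => half_row_sum (2 * p) (-1)) 0).
{ apply (Clim_comp_eventually (fun j => half_row_sum j (-1))); [apply half_row_sum_lim, Rabs_m1|].
  intros N; exists N; intros n; lia. }
specialize (T TL).
pose proof (Cis_series_scal (RtoC (2 * (lip_const k / 2 ^ (2 * k)%N))) _ _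
  (cusp_tail_is_series k _ Hk (nome_lt1 _ Ht2))) as S.
pose proof (Cis_series_scal (tau ^ (2 * k)%N)%C _ _ (Cis_series_plus _ _ _ _ T S)) as TS; cbv beta in TS.
assert (E : (q_series k (nome (- / tau / 2)) / RtoC (odd_const k) = tau ^ (2 * k)%N *
   (RtoC ((1 - / 2 ^ (2 * k)%N) * zeta (2 * k)%N) +
     RtoC (2 * (lip_const k / 2 ^ (2 * k)%N)) * cusp_tail k (nome (tau / 2))))%C).
{ apply (Cis_series_unique _ _ _ F); refine (Cis_series_ext _ _ _ _ TS); intros p; cbv beta.
  symmetry; apply CSeries_unique.
  pose proof (Cis_series_scal (tau ^ (2 * k)%N)%C _ _ (Cis_series_minus _ _ _ _
    (Cis_series_plus _ _ _ _ (half_row_is_series (2 * p)%N _ Rabs_m1) (half_row_is_series (2 * p + 2)%N _ Rabs_R1))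
    (Cis_series_plus _ _ _ _ (half_row_is_series (2 * p + 1)%N _ Rabs_m1) (half_row_is_series (2 * p + 1)%N _ Rabs_R1)))) as H.
  match goal with |- Cis_series _ ?s => match type of H with Cis_series _ ?t => replace s with t end end.
  - refine (Cis_series_ext _ _ _ _ H); intros n; rewrite alt_term_inversion; reflexivity.
  - f_equal; replace (2 * p.+1)%N with (2 * p + 2)%N by lia.
    assert (R1 := full_row_sum (2 * p + 1)%N); assert (R2 := full_row_sum (2 * p + 2)%N).
    rewrite R1; [|lia].
    replace (half_row_sum (2 * p + 2) 1) with
      (half_row_sum (2 * p + 2) (-1) + half_row_sum (2 * p + 2) 1 - half_row_sum (2 * p + 2) (-1))%C by ring.
    rewrite R2; [|lia]; rewrite (RtoC_mult 2); field; apply RtoC2_neq0. }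
assert (O0 : odd_const k <> 0).
{ unfold odd_const, Rdiv; apply Rmult_integral_contrapositive_currified; [exact P0|].
  apply Rinv_neq_0_compat, Rmult_integral_contrapositive_currified; [lra|exact L0]. }
transitivity (RtoC (odd_const k) * (q_series k (nome (- / tau / 2)) / RtoC (odd_const k)))%C;
  [field; apply RtoC_neq0, O0|rewrite E].
unfold cusp_value; rewrite (RtoC_mult (odd_const k)).
assert (U : (RtoC (odd_const k) * RtoC (2 * (lip_const k / 2 ^ (2 * k)%N)) = 1)%C).
{ rewrite -RtoC_mult; f_equal; unfold odd_const; field; split; assumption. }
transitivity (tau ^ (2 * k)%N * (RtoC (odd_const k) * RtoC ((1 - / 2 ^ (2 * k)%N) * zeta (2 * k)%N)
  + (RtoC (odd_const k) * RtoC (2 * (lip_const k / 2 ^ (2 * k)%N))) * cusp_tail k (nome (tau / 2))))%C;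
  [ring|rewrite U; ring].
Qed.
End ColumnSums.

(** The powers of pi in Euler's formula and in [lip_const] cancel, so that the constant term is
    rational. *)
Lemma cusp_value_bernoulli k : (1 <= k)%N ->
  cusp_value k = - ((4 ^ k - 1) * bernoulli (2 * k)%N / (8 * INR k)).
Proof.
intros Hk; pose proof PI_RGT_0 as P0; unfold cusp_value, odd_const, lip_const; rewrite zeta_even //.
pose proof (INR_fact_gt0 (2 * k - 1)%N) as F0.
assert (Ef : INR (2 * k)`! = 2 * INR k * INR (2 * k - 1)`!).
{ replace (2 * k)%N with (2 * k - 1).+1 at 1 by lia; rewrite INR_factS; f_equal.
  replace (2 * k - 1).+1 with (2 * k)%N by lia; rewrite mulnE mult_INR; simpl; ring. }
assert (E4 : 2 ^ (2 * k)%N = 4 ^ k).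
{ rewrite -multE pow_mult; f_equal; simpl; ring. }
rewrite Ef addn1; change ((-1) ^ k.+1) with (-1 * (-1) ^ k); rewrite Rpow_mult_distr E4.
assert (S : (-1) ^ k <> 0) by (apply pow_nonzero; lra).
assert (K0 : INR k <> 0) by (apply not_0_INR; lia).
assert (P4 : 4 ^ k <> 0) by (apply pow_nonzero; lra).
assert (PP : PI ^ (2 * k)%N <> 0) by (apply pow_nonzero; lra).
field; repeat split; try assumption; lra.
Qed.

Lemma bernoulli_2 : bernoulli 2 = / 6.
Proof.
rewrite (bernoulli_S 1) sum_Sn sum_O (bernoulli_S 0) sum_O; unfold bernoulli; simpl nth.
change (plus ?x ?y) with (x + y); rewrite !bin0 !bin1; simpl; field.
Qed.

Lemma cusp_value_1 : cusp_value 1 = - / 16.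
Proof.
rewrite cusp_value_bernoulli //; change (2 * 1)%N with 2%N; rewrite bernoulli_2; simpl; field.
Qed.

(** This is the origin of [d_coef]: since [cusp_value 1 = -1/16], the factor [(-16)^k] undoes its
    k-th power, and F_k and d_k F_1^k have equal constant terms at the cusp 0. *)
Lemma cusp_value_d_coef k : (1 <= k)%N -> cusp_value k = d_coef k * cusp_value 1 ^ k.
Proof.
intros Hk; rewrite cusp_value_1 cusp_value_bernoulli // /d_coef.
assert (K0 : INR k <> 0) by (apply not_0_INR; lia).
assert (E : (-16) ^ k * (- / 16) ^ k = 1).
{ rewrite -Rpow_mult_distr; replace (-16 * - / 16) with 1 by field; apply pow1. }
transitivity (- ((((-16) ^ k * (- / 16) ^ k)) * (4 ^ k - 1) * bernoulli (2 * k)%N / (8 * INR k)));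
  [rewrite E|]; field; exact K0.
Qed.

(** * Action of the modular group *)

Lemma Tq_eq k q : Cmod q < 1 -> Tq k q = (q_series k q - RtoC (d_coef k) * q_series 1 q ^ k)%C.
Proof.
intros Hq; destruct (q_prod_q_series k q Hq) as [_ E]; unfold Tq; rewrite -E; ring.
Qed.

Lemma q_series_opp k q : (1 <= k)%N -> Cmod q < 1 -> q_series k (- q) = (- q_series k q)%C.
Proof.
intros Hk Hq; apply CSeries_unique.
replace (- q_series k q)%C with (- (1) * q_series k q)%C by ring.
refine (Cis_series_ext _ _ _ _ (Cis_series_scal _ _ _ (q_series_is_series k q Hk Hq))); intros n.
assert (P : Cmod (q ^ (2 * n + 1)%N) < 1) by (apply Cmod_pow_lt1; [exact Hq|lia]).
rewrite !series_term_odd_part_sum.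
replace ((- q) ^ (2 * n + 1)%N)%C with (- q ^ (2 * n + 1)%N)%C.
- rewrite !odd_part_sum_full ?Cmod_opp //.
  replace (- - q ^ (2 * n + 1)%N)%C with (q ^ (2 * n + 1)%N)%C by ring; field; apply RtoC2_neq0.
- rewrite addn1 !Cpow_S Cpow_opp_even; ring.
Qed.

Lemma q_series_bound k : (1 <= k)%N -> exists K, 0 < K /\ forall q, Cmod q <= 1 / 2 -> Cmod (q_series k q) <= K * Cmod q.
Proof.
intros Hk; destruct (odd_part_sum_bound k (1 / 2) Hk) as [K [K0 HK]]; [lra|].
exists (K * 2); split; [lra|]; intros q Hq; pose proof (Cmod_ge_0 q) as q0.
assert (Hq1 : Cmod q < 1) by lra.
replace (K * 2 * Cmod q) with (Series (fun p => (K * Cmod q) * (1 / 2) ^ p)).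
- apply (Cis_series_Cmod_le _ _ _ (q_series_is_series k q Hk Hq1)).
  + intros n; rewrite series_term_odd_part_sum.
    assert (B : Cmod (q ^ (2 * n + 1)%N) <= Cmod q * (1 / 2) ^ n).
    { rewrite Cmod_pow; replace (2 * n + 1)%N with (n + n).+1 by lia.
      change (Cmod q ^ (n + n).+1) with (Cmod q * Cmod q ^ (n + n)%N); apply Rmult_le_compat_l; [exact q0|].
      rewrite -plusE pow_add -(Rmult_1_r ((1 / 2) ^ n)); apply Rmult_le_compat; try (apply pow_le; exact q0).
      - apply pow_incr; lra.
      - apply pow_le_1; lra. }
    eapply Rle_trans; [apply HK; eapply Rle_trans; [exact B|]|].
    * assert ((1 / 2) ^ n <= 1) by (apply pow_le_1; lra); nra.
    * rewrite Rmult_assoc; apply Rmult_le_compat_l; [lra|exact B].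
  + apply ex_series_geom_scal; lra.
- rewrite Series_scal_l Series_geom; [field|rewrite Rabs_pos_eq; lra].
Qed.

(** Used with [a = cusp_value 1] at the cusp 0 and with [a = 0] at infinity. *)
Lemma Cpow_diff_bound n a B : exists K, 0 < K /\ forall x, Cmod x <= B -> Cmod ((a + x) ^ n - a ^ n)%C <= K * Cmod x.
Proof.
induction n as [|n [K [K0 IH]]].
- exists 1; split; [lra|]; intros x _; simpl Cpow; replace (1 - 1)%C with (RtoC 0) by ring.
  rewrite Cmod_0; pose proof (Cmod_ge_0 x); lra.
- pose proof (Cmod_ge_0 a) as a0; pose proof (pow_le _ n a0) as an.
  pose proof (Rle_abs B); pose proof (Rabs_pos B).
  exists ((Cmod a + Rabs B) * K + Cmod a ^ n + 1); split; [nra|]; intros x Hx; specialize (IH x Hx).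
  pose proof (Cmod_ge_0 x) as x0.
  replace ((a + x) ^ n.+1 - a ^ n.+1)%C with ((a + x) * ((a + x) ^ n - a ^ n) + x * a ^ n)%C by (rewrite !Cpow_S; ring).
  eapply Rle_trans; [apply Cmod_triangle|]; rewrite !Cmod_mult Cmod_pow.
  assert (T : Cmod (a + x) <= Cmod a + Rabs B) by (eapply Rle_trans; [apply Cmod_triangle|lra]).
  apply Rle_trans with ((Cmod a + Rabs B) * (K * Cmod x) + Cmod x * Cmod a ^ n); [|nra].
  apply Rplus_le_compat_r, Rmult_le_compat; try apply Cmod_ge_0; assumption.
Qed.

(* The form [T_2k] in the variable doubled, on which all of SL2(Z) acts through three functions. *)
Definition form_infty (k : nat) (tau : C) : C := Tq k (nome (tau / 2)).

(** The expansion of the form at the cusp 0. The constant terms, equal by [cusp_value_d_coef], are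
    already removed from both summands, which makes the vanishing at [x = 0] visible. *)
Definition form_zero_q (k : nat) (x : C) : C :=
  (cusp_tail k x - RtoC (d_coef k) *
    ((RtoC (cusp_value 1) + cusp_tail 1 x) ^ k - RtoC (cusp_value 1) ^ k))%C.

Definition form_zero (k : nat) (tau : C) : C := form_zero_q k (nome (tau / 2)).

Lemma form_zero_q_bound k : (1 <= k)%N -> exists K, 0 < K /\ forall x, Cmod x <= 1 / 2 -> Cmod (form_zero_q k x) <= K * Cmod x.
Proof.
intros Hk; destruct (cusp_tail_bound k Hk) as [K1 [K10 H1]].
destruct (cusp_tail_bound 1 isT) as [K2 [K20 H2]].
destruct (Cpow_diff_bound k (RtoC (cusp_value 1)) (K2 * (1 / 2))) as [K3 [K30 H3]].
pose proof (Rabs_pos (d_coef k)) as D0.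
exists (K1 + Rabs (d_coef k) * (K3 * K2)); split; [assert (0 < K3 * K2) by nra; nra|].
intros x Hx; unfold form_zero_q; eapply Rle_trans; [apply Cmod_triangle|].
rewrite Cmod_opp Cmod_mult Cmod_R Rmult_plus_distr_r.
apply Rplus_le_compat; [apply H1, Hx|].
rewrite Rmult_assoc; apply Rmult_le_compat_l; [exact D0|].
specialize (H2 x Hx); eapply Rle_trans; [apply H3; nra|].
rewrite Rmult_assoc; apply Rmult_le_compat_l; [lra|exact H2].
Qed.

Lemma Tq_bound k : (1 <= k)%N -> exists K, 0 < K /\ forall q, Cmod q <= 1 / 2 -> Cmod (Tq k q) <= K * Cmod q.
Proof.
intros Hk; destruct (q_series_bound k Hk) as [K1 [K10 H1]].
destruct (q_series_bound 1 isT) as [K2 [K20 H2]].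
destruct (Cpow_diff_bound k 0 (K2 * (1 / 2))) as [K3 [K30 H3]].
pose proof (Rabs_pos (d_coef k)) as D0.
exists (K1 + Rabs (d_coef k) * (K3 * K2)); split; [assert (0 < K3 * K2) by nra; nra|].
intros x Hx; rewrite Tq_eq; [|lra]; eapply Rle_trans; [apply Cmod_triangle|].
rewrite Cmod_opp Cmod_mult Cmod_R Rmult_plus_distr_r.
apply Rplus_le_compat; [apply H1, Hx|].
rewrite Rmult_assoc; apply Rmult_le_compat_l; [exact D0|].
specialize (H2 x Hx); assert (Q : Cmod (q_series 1 x) <= K2 * (1 / 2)) by nra.
specialize (H3 _ Q); destruct k as [|k]; [discriminate|].
replace ((0 + q_series 1 x) ^ k.+1 - 0 ^ k.+1)%C with (q_series 1 x ^ k.+1)%C in H3.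
- eapply Rle_trans; [exact H3|]; rewrite Rmult_assoc; apply Rmult_le_compat_l; [lra|exact H2].
- rewrite Cplus_0_l (Cpow_S 0); ring.
Qed.

Lemma aut_neq0 (c d : Z) tau : 0 < Im tau -> (c <> 0 \/ d <> 0)%Z -> (RtoC (IZR c) * tau + RtoC (IZR d))%C <> RtoC 0.
Proof.
intros Ht Hcd E.
assert (Ei : Im (RtoC (IZR c) * tau + RtoC (IZR d))%C = IZR c * Im tau) by (destruct tau; simpl; ring).
assert (Er : Re (RtoC (IZR c) * tau + RtoC (IZR d))%C = IZR c * Re tau + IZR d) by (destruct tau; simpl; ring).
rewrite E in Ei Er; simpl in Ei, Er.
assert (C0 : IZR c = 0) by (symmetry in Ei; apply Rmult_integral in Ei; destruct Ei; [assumption|lra]).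
rewrite C0 in Er; assert (D0 : IZR d = 0) by lra.
apply eq_IZR in C0; apply eq_IZR in D0; lia.
Qed.

Lemma det_row c d a b : (a * d - b * c = 1)%Z -> (c <> 0 \/ d <> 0)%Z.
Proof. nia. Qed.

Lemma det_odd a b c d : (a * d - b * c = 1)%Z -> (Z.odd a && Z.odd d) (+) (Z.odd b && Z.odd c) = true.
Proof.
intros H; pose proof (f_equal Z.odd H) as E.
rewrite Z.odd_sub !Z.odd_mul in E; change (Z.odd 1) with true in E; rewrite -E; destruct (Z.odd a), (Z.odd b), (Z.odd c), (Z.odd d); reflexivity.
Qed.

Section Weight.
Variable k : nat.
Hypotheses (Hk : (1 <= k)%N) (Hodd : odd k).

(** Translation by 1 changes the sign of the nome. The series contain odd powers only, and the k-th
    power inherits the sign because k is odd. *)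
Lemma form_infty_T tau : 0 < Im tau -> form_infty k (tau + 1) = (- form_infty k tau)%C.
Proof.
intros Ht; unfold form_infty; rewrite nome_half_shift.
assert (N : Cmod (nome (tau / 2)) < 1) by (apply nome_lt1; rewrite Im_div2; lra).
rewrite !Tq_eq ?Cmod_opp // !q_series_opp //.
assert (E : ((- q_series 1 (nome (tau / 2))) ^ k = - q_series 1 (nome (tau / 2)) ^ k)%C).
{ rewrite -(odd_double_half k) Hodd add1n !Cpow_S -muln2 mulnC Cpow_opp_even; ring. }
rewrite E; ring.
Qed.

Lemma form_infty_S tau : 0 < Im tau -> form_infty k (- / tau) = (tau ^ (2 * k)%N * form_zero k tau)%C.
Proof.
intros Ht; unfold form_infty, form_zero, form_zero_q.
pose proof (Im_inversion tau Ht) as Hi.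
rewrite Tq_eq; [|apply nome_lt1; rewrite Im_div2; lra].
rewrite !q_series_inversion // cusp_value_d_coef // Cpow_mult_l -Cpow_muln RtoC_mult RtoC_pow.
replace (2 * 1 * k)%N with (2 * k)%N by lia; ring.
Qed.

Lemma form_zero_T2 tau : form_zero k (tau + 2) = form_zero k tau.
Proof.
unfold form_zero; replace ((tau + 2) / 2)%C with (tau / 2 + 1)%C by (field; apply RtoC2_neq0).
rewrite nome_plus nome_1 Cmult_1_r; reflexivity.
Qed.

(* The three functions are indexed by the parities of the lower row [c, d] of a matrix,
   that is by the cusps of the principal congruence group of level 2. *)
Definition form_at (c d : bool) (tau : C) : C :=
  match c, d with
  | false, false => 0
  | false, true => form_infty k tau
  | true, false => - form_zero k tau
  | true, true => form_zero k (tau + 1)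
  end%C.

Lemma form_at_T c d tau : 0 < Im tau -> form_at c d (tau + 1) = (- form_at c (c (+) d) tau)%C.
Proof.
intros Ht; destruct c, d; simpl.
- replace (tau + 1 + 1)%C with (tau + 2)%C by (rewrite -Cplus_assoc; f_equal; rewrite -RtoC_plus; f_equal; ring).
  rewrite form_zero_T2; ring.
- reflexivity.
- apply form_infty_T, Ht.
- ring.
Qed.

Lemma form_at_T_inv c d tau : 0 < Im tau -> form_at c d (tau - 1) = (- form_at c (c (+) d) tau)%C.
Proof.
intros Ht; assert (H : 0 < Im (tau - 1)).
{ replace (tau - 1)%C with (tau + RtoC (-1))%C by (rewrite RtoC_m1; reflexivity); rewrite Im_plus_R; exact Ht. }
assert (E : (tau - 1 + 1)%C = tau) by ring.
replace d with (c (+) (c (+) d)) at 1 by (destruct c, d; reflexivity).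
pose proof (form_at_T c (c (+) d) _ H) as A; rewrite E in A; rewrite A; ring.
Qed.

(** The essential case is the row (odd, odd), which rests on the relation [S T S = T^(-1) S T^(-1)]
    up to sign: with [z = (tau-1)/tau] one has [-1/z = -1/(tau-1) - 1], and the translation sign
    together with the period 2 of [form_zero] gives the claim. *)
Lemma form_at_S c d tau : 0 < Im tau -> form_at c d (- / tau) = (- (tau ^ (2 * k)%N * form_at d c tau))%C.
Proof.
intros Ht; pose proof (Im_neq0 _ Ht) as T0; pose proof (Im_inversion _ Ht) as Hi.
assert (Z : forall z, 0 < Im z -> form_zero k z = (form_infty k (- / z) / z ^ (2 * k)%N)%C).
{ intros z Hz; rewrite form_infty_S //; field; apply Cpow_nz, Im_neq0, Hz. }
destruct c, d; simpl form_at.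
- assert (H1 : 0 < Im (- / tau + 1)) by now rewrite Im_plus_R.
  assert (E1 : (- / tau + 1 = (tau - 1) / tau)%C) by (field; exact T0).
  assert (H2 : 0 < Im (tau - 1)).
  { replace (tau - 1)%C with (tau + RtoC (-1))%C by (rewrite RtoC_m1; reflexivity); rewrite Im_plus_R; exact Ht. }
  pose proof (Im_neq0 _ H2) as T1; pose proof (Im_inversion _ H2) as H3.
  rewrite (Z _ H1) E1.
  replace (- / ((tau - 1) / tau))%C with (- / (tau - 1) - 1)%C by (field; split; assumption).
  assert (E2 : form_infty k (- / (tau - 1) - 1) = (- form_infty k (- / (tau - 1)))%C).
  { exact (form_at_T_inv false true _ H3). }
  rewrite E2 (form_infty_S (tau - 1) H2) -(form_zero_T2 (tau - 1)).
  replace (tau - 1 + 2)%C with (tau + 1)%C by (replace (RtoC 2) with (1 + 1)%C by (rewrite -RtoC_plus; f_equal; ring); ring).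
  unfold Cdiv; rewrite Cpow_mult_l (Cpow_inv _ _ T0); field; split; apply Cpow_nz; assumption.
- rewrite (Z _ Hi); replace (- / - / tau)%C with tau by (field; exact T0).
  rewrite Cpow_opp_even Cpow_inv //; field; apply Cpow_nz, T0.
- rewrite form_infty_S //; ring.
- ring.
Qed.

(** Modulo 2 a matrix of determinant 1 is a permutation of three letters: odd trace means order 3,
    even off-diagonal entries mean the identity, and the others are the transpositions. The value is
    the sign of that permutation. *)
Definition parity_sign (a b c d : Z) : R :=
  if Z.odd (a + d) || ~~ (Z.odd b || Z.odd c) then 1 else -1.

Definition transforms (a b c d : Z) : Prop := forall tau, 0 < Im tau ->
  form_infty k ((RtoC (IZR a) * tau + RtoC (IZR b)) / (RtoC (IZR c) * tau + RtoC (IZR d)))%C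
  = ((RtoC (IZR c) * tau + RtoC (IZR d)) ^ (2 * k)%N *
      (RtoC (parity_sign a b c d) * form_at (Z.odd c) (Z.odd d) tau))%C.

(** Substituting [tau + 1] multiplies the matrix on the right by a generator. The compatibility of
    signs depends on parities alone, and [det_odd] discards the patterns that determinant 1
    excludes. *)
Lemma transforms_T a b c d : (a * d - b * c = 1)%Z -> transforms a b c d -> transforms a (b + a) c (d + c).
Proof.
intros Hdet H tau Ht; pose proof (det_odd _ _ _ _ Hdet) as Ho.
assert (Ht1 : 0 < Im (tau + 1)) by now rewrite Im_plus_R.
specialize (H _ Ht1); rewrite form_at_T // in H.
replace (RtoC (IZR a) * (tau + 1) + RtoC (IZR b))%C with (RtoC (IZR a) * tau + RtoC (IZR (b + a)))%C in H
  by (rewrite plus_IZR RtoC_plus; ring).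
replace (RtoC (IZR c) * (tau + 1) + RtoC (IZR d))%C with (RtoC (IZR c) * tau + RtoC (IZR (d + c)))%C in H
  by (rewrite plus_IZR RtoC_plus; ring).
rewrite H; f_equal; unfold parity_sign; rewrite !Z.odd_add.
destruct (Z.odd a), (Z.odd b), (Z.odd c), (Z.odd d); simpl in *; try discriminate; rewrite ?RtoC_m1; ring.
Qed.

Lemma transforms_T_inv a b c d : (a * d - b * c = 1)%Z -> transforms a b c d -> transforms a (b - a) c (d - c).
Proof.
intros Hdet H tau Ht; pose proof (det_odd _ _ _ _ Hdet) as Ho.
assert (Ht1 : 0 < Im (tau - 1)).
{ replace (tau - 1)%C with (tau + RtoC (-1))%C by (rewrite RtoC_m1; reflexivity); rewrite Im_plus_R; exact Ht. }
specialize (H _ Ht1); rewrite form_at_T_inv // in H.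
replace (RtoC (IZR a) * (tau - 1) + RtoC (IZR b))%C with (RtoC (IZR a) * tau + RtoC (IZR (b - a)))%C in H
  by (rewrite minus_IZR RtoC_minus; ring).
replace (RtoC (IZR c) * (tau - 1) + RtoC (IZR d))%C with (RtoC (IZR c) * tau + RtoC (IZR (d - c)))%C in H
  by (rewrite minus_IZR RtoC_minus; ring).
rewrite H; f_equal; unfold parity_sign; rewrite !Z.odd_sub ?Z.odd_add ?Z.odd_opp.
destruct (Z.odd a), (Z.odd b), (Z.odd c), (Z.odd d); simpl in *; try discriminate; rewrite ?RtoC_m1; ring.
Qed.

Lemma transforms_S a b c d : (a * d - b * c = 1)%Z -> transforms a b c d -> transforms b (- a) d (- c).
Proof.
intros Hdet H tau Ht; pose proof (det_odd _ _ _ _ Hdet) as Ho; pose proof (Im_neq0 _ Ht) as T0.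
specialize (H _ (Im_inversion _ Ht)); rewrite form_at_S // in H.
assert (N : (RtoC (IZR d) * tau + RtoC (IZR (- c)))%C <> RtoC 0) by (apply aut_neq0; [exact Ht|nia]).
assert (E : (RtoC (IZR c) * - / tau + RtoC (IZR d))%C = ((RtoC (IZR d) * tau + RtoC (IZR (- c))) / tau)%C).
{ rewrite opp_IZR RtoC_opp; field; exact T0. }
rewrite E in H.
replace ((RtoC (IZR a) * - / tau + RtoC (IZR b)) / ((RtoC (IZR d) * tau + RtoC (IZR (- c))) / tau))%C
  with ((RtoC (IZR b) * tau + RtoC (IZR (- a))) / (RtoC (IZR d) * tau + RtoC (IZR (- c))))%C in H.
- rewrite H; unfold Cdiv; rewrite Cpow_mult_l (Cpow_inv _ _ T0).
  transitivity ((RtoC (IZR d) * tau + RtoC (IZR (- c))) ^ (2 * k)%N *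
    (RtoC (parity_sign a b c d) * - form_at (Z.odd d) (Z.odd c) tau))%C; [field; apply Cpow_nz, T0|].
  f_equal; unfold parity_sign; rewrite !Z.odd_add !Z.odd_opp.
  destruct (Z.odd a), (Z.odd b), (Z.odd c), (Z.odd d); simpl in *; try discriminate; rewrite ?RtoC_m1; ring.
- rewrite (opp_IZR a) RtoC_opp; field; split; assumption.
Qed.

(** The weight is even, so minus the identity acts trivially. *)
Lemma transforms_opp a b c d : (c <> 0 \/ d <> 0)%Z -> transforms a b c d -> transforms (- a) (- b) (- c) (- d).
Proof.
intros Hcd H tau Ht; specialize (H _ Ht); pose proof (aut_neq0 c d tau Ht Hcd) as N.
rewrite !opp_IZR !RtoC_opp.
replace (- RtoC (IZR c) * tau + - RtoC (IZR d))%C with (- (RtoC (IZR c) * tau + RtoC (IZR d)))%C by ring.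
rewrite Cpow_opp_even.
replace (- RtoC (IZR a) * tau + - RtoC (IZR b))%C with (- (RtoC (IZR a) * tau + RtoC (IZR b)))%C by ring.
revert H N; generalize (RtoC (IZR a) * tau + RtoC (IZR b))%C (RtoC (IZR c) * tau + RtoC (IZR d))%C.
intros u v H N; replace (- u / - v)%C with (u / v)%C by (field; exact N).
rewrite H; unfold parity_sign; rewrite !Z.odd_add !Z.odd_opp; reflexivity.
Qed.

Lemma transforms_T_pow n a b c d : (a * d - b * c = 1)%Z -> transforms a b c d ->
  transforms a (b + n * a) c (d + n * c).
Proof.
assert (P : forall (m : nat) a b c d, (a * d - b * c = 1)%Z -> transforms a b c d ->
  transforms a (b + Z.of_nat m * a) c (d + Z.of_nat m * c) /\
  transforms a (b - Z.of_nat m * a) c (d - Z.of_nat m * c)).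
{ clear a b c d n; induction m as [|m IH]; intros a b c d Hdet H.
  - rewrite !Z.mul_0_l !Z.add_0_r !Z.sub_0_r; split; exact H.
  - destruct (IH a b c d Hdet H) as [H1 H2]; split.
    + apply transforms_T in H1; [|nia].
      replace (b + Z.of_nat m.+1 * a)%Z with (b + Z.of_nat m * a + a)%Z by lia.
      replace (d + Z.of_nat m.+1 * c)%Z with (d + Z.of_nat m * c + c)%Z by lia; exact H1.
    + apply transforms_T_inv in H2; [|nia].
      replace (b - Z.of_nat m.+1 * a)%Z with (b - Z.of_nat m * a - a)%Z by lia.
      replace (d - Z.of_nat m.+1 * c)%Z with (d - Z.of_nat m * c - c)%Z by lia; exact H2. }
intros Hdet H; destruct (Z_le_gt_dec 0 n) as [Hn|Hn].
- destruct (P (Z.to_nat n) a b c d Hdet H) as [H1 _]; rewrite Z2Nat.id // in H1.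
- destruct (P (Z.to_nat (- n)) a b c d Hdet H) as [_ H1]; rewrite Z2Nat.id in H1; [|lia].
  replace (b + n * a)%Z with (b - - n * a)%Z by lia; replace (d + n * c)%Z with (d - - n * c)%Z by lia; exact H1.
Qed.

(* Euclid's algorithm on the lower row. *)
Lemma transforms_all a b c d : (a * d - b * c = 1)%Z -> transforms a b c d.
Proof.
assert (base : transforms 1 0 0 1).
{ intros tau Ht; unfold parity_sign; simpl.
  replace ((1 * tau + 0) / (0 * tau + 1))%C with tau by (field; intros E; injection E; lra).
  replace (0 * tau + 1)%C with (RtoC 1) by ring; rewrite Cpow_1_l; ring. }
assert (main : forall n a b c d, (Z.abs c <= Z.of_nat n)%Z -> (a * d - b * c = 1)%Z -> transforms a b c d).
{ clear a b c d; induction n as [|n IH]; intros a b c d Hn Hdet.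
  - assert (c = 0%Z) by lia; subst c.
    assert (Had : (a = 1 /\ d = 1 \/ a = -1 /\ d = -1)%Z).
    { assert (Had1 : (a * d = 1)%Z) by lia; destruct (Z.mul_eq_1 a d Had1) as [E|E]; rewrite E in Had1 |- *; lia. }
    destruct Had as [[-> ->]|[-> ->]].
    + pose proof (transforms_T_pow b 1 0 0 1 Logic.eq_refl base) as H.
      replace (0 + b * 1)%Z with b in H by lia; replace (1 + b * 0)%Z with 1%Z in H by lia; exact H.
    + pose proof (transforms_T_pow (- b) 1 0 0 1 Logic.eq_refl base) as H.
      replace (0 + - b * 1)%Z with (- b)%Z in H by lia; replace (1 + - b * 0)%Z with 1%Z in H by lia.
      apply transforms_opp in H; [|lia].
      replace (- - b)%Z with b in H by lia; exact H.
  - destruct (Z.eq_dec c 0) as [->|Hc]; [apply IH; [lia|exact Hdet]|].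
    pose proof (Z.div_mod d c Hc) as Hdm.
    assert (Hr : (Z.abs (d mod c) <= Z.of_nat n)%Z).
    { pose proof (Z.mod_pos_bound d c); pose proof (Z.mod_neg_bound d c); lia. }
    set (q := (d / c)%Z) in *; set (r := (d mod c)%Z) in *.
    assert (H : transforms (b - q * a) (- a) r (- c)) by (apply IH; nia).
    apply transforms_S in H; [|nia]; apply transforms_opp in H; [|lia].
    rewrite !Z.opp_involutive in H.
    apply (transforms_T_pow q) in H; [|nia].
    replace (b - q * a + q * a)%Z with b in H by lia.
    replace (r + q * c)%Z with d in H by lia; exact H. }
intros H; apply (main (Z.to_nat (Z.abs c))); [lia|exact H].
Qed.
End Weight.

(** * The cusp form *)

Lemma quad_deriv_weaken f z d M M' del : M <= M' -> quad_deriv f z d M del -> quad_deriv f z d M' del.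
Proof.
intros HM H h Hh; eapply Rle_trans; [apply H, Hh|].
apply Rmult_le_compat_r; [apply pow_le, Cmod_ge_0|exact HM].
Qed.

Lemma ex_series_odd_pow_geom p r : 0 <= r < 1 ->
  ex_series (fun i => INR (2 * i + 1)%N ^ p * r ^ (2 * i + 1)%N).
Proof.
intros Hr; destruct (pow_geom_bound p r Hr) as [rho [K [H1 [HK H2]]]].
apply (ex_series_le_R _ (fun i => K * rho ^ i)); [|apply ex_series_geom_scal; lra].
intros i; split; [apply Rmult_le_pos; apply pow_le; [apply pos_INR|lra]|].
eapply Rle_trans; [apply H2|]; apply Rmult_le_compat_l; [lra|apply pow_le_base; lra].
Qed.

(** Two nested termwise differentiations, over [i] inside each odd part and then over [n]. The
    exponent [(2n+1)(2i+1)] couples the indices, so a majorant that factors as [wt i * ct n] is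
    sought. *)
Lemma q_series_Cderiv k z : (1 <= k)%N -> Cmod z < 1 -> exists d, Cderiv (q_series k) z d.
Proof.
intros Hk Hz; pose proof (Cmod_ge_0 z) as z0.
set (del := (1 - Cmod z) / 2); set (rho := (1 + Cmod z) / 2).
assert (D0 : 0 < del) by (unfold del; lra).
assert (R0 : 0 < rho < 1) by (unfold rho; lra).
(* The square root separates the indices: twice [(2n+1)(2i+1)] is at least the sum of the two
   factors, so [rho] to that product is at most [r^(2n+1) r^(2i+1)]. *)
set (r := sqrt rho); assert (rr : r * r = rho) by (apply sqrt_sqrt; lra).
assert (r0 : 0 < r) by (apply sqrt_lt_R0; lra).
assert (r1 : r < 1) by nra.
set (s := (2 * k - 1)%N).
set (wt := fun i => / rho ^ 2 * (INR (2 * i + 1)%N ^ s.+2 * r ^ (2 * i + 1)%N)).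
set (ct := fun n => INR (2 * n + 1)%N ^ 2 * r ^ (2 * n + 1)%N).
assert (Ewt : ex_series wt).
{ apply (@ex_series_scal_l R_AbsRing R_NormedModule), ex_series_odd_pow_geom; lra. }
assert (Ect : ex_series ct) by (apply ex_series_odd_pow_geom; lra).
set (N := fun n i => ((2 * n + 1) * (2 * i + 1))%N).
set (a := fun i => RtoC (INR (2 * i + 1)%N ^ s)).
assert (dom : forall n i, INR (2 * i + 1)%N ^ s * (INR (N n i) ^ 2 * rho ^ N n i * / rho ^ 2) <= wt i * ct n).
{ intros n i; unfold wt, ct.
  assert (EN : INR (N n i) = INR (2 * n + 1)%N * INR (2 * i + 1)%N) by (unfold N; rewrite -mult_INR multE; reflexivity).
  assert (EP : rho ^ N n i <= r ^ (2 * n + 1)%N * r ^ (2 * i + 1)%N).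
  { rewrite -rr Rpow_mult_distr -!pow_add.
    assert (Hle : exists e, (N n i + N n i)%coq_nat = ((2 * n + 1 + (2 * i + 1)) + e)%N).
    { exists (N n i + N n i - (2 * n + 1 + (2 * i + 1)))%N; unfold N; nia. }
    destruct Hle as [e ->]; rewrite -plusE pow_add.
    rewrite -[X in _ <= X]Rmult_1_r; apply Rmult_le_compat_l; [apply pow_le; lra|apply pow_le_1; lra]. }
  rewrite EN; set (I := INR (2 * i + 1)%N); set (J := INR (2 * n + 1)%N).
  assert (I0 : 0 <= I) by apply pos_INR; assert (J0 : 0 <= J) by apply pos_INR.
  assert (Is : 0 <= I ^ s) by now apply pow_le.
  assert (P2 : 0 < / rho ^ 2) by (apply Rinv_0_lt_compat, pow_lt; lra).
  replace (/ rho ^ 2 * (I ^ s.+2 * r ^ (2 * i + 1)%N) * (J ^ 2 * r ^ (2 * n + 1)%N))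
    with (I ^ s * ((J * I) ^ 2 * (r ^ (2 * n + 1)%N * r ^ (2 * i + 1)%N) * / rho ^ 2)) by (simpl; ring).
  apply Rmult_le_compat_l; [exact Is|]; apply Rmult_le_compat_r; [lra|].
  apply Rmult_le_compat_l; [apply pow_le, Rmult_le_pos; assumption|exact EP]. }
assert (Npos : forall n i, (1 <= N n i)%N) by (intros n i; unfold N; nia).
set (dt := fun n i => (a i * (RtoC (INR (N n i)) * z ^ (N n i).-1))%C).
assert (Qt : forall n i, quad_deriv (fun x => a i * x ^ N n i)%C z (dt n i) (wt i * ct n) del).
{ intros n i; eapply quad_deriv_weaken; [|apply quad_deriv_scal, (quad_deriv_monomial _ z rho del); unfold rho, del; lra].
  unfold a; rewrite Cmod_R Rabs_pos_eq; [apply dom|apply pow_le, pos_INR]. }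
assert (Dt : forall n i, Cmod (dt n i) <= wt i * ct n).
{ intros n i; eapply Rle_trans; [|apply dom]; unfold dt, a.
  rewrite !Cmod_mult !Cmod_R Cmod_pow !Rabs_pos_eq; try apply pos_INR; [|apply pow_le, pos_INR].
  apply Rmult_le_compat_l; [apply pow_le, pos_INR|].
  specialize (Npos n i); destruct (N n i) as [|m]; [discriminate|]; simpl predn.
  assert (M1 : 1 <= INR m.+1) by (rewrite S_INR; pose proof (pos_INR m); lra).
  assert (P1 : Cmod z ^ m <= rho ^ m) by (apply pow_incr; unfold rho; lra).
  assert (Pm : 0 < rho ^ m) by (apply pow_lt; lra).
  apply Rle_trans with (INR m.+1 * rho ^ m); [apply Rmult_le_compat_l; [lra|exact P1]|].
  replace (INR m.+1 ^ 2 * rho ^ m.+1 * / rho ^ 2) with ((INR m.+1 * rho ^ m) * (INR m.+1 * / rho))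
    by (generalize (INR m.+1); intros y; simpl; field; lra).
  rewrite -{1}(Rmult_1_r (INR m.+1 * rho ^ m)); apply Rmult_le_compat_l; [nra|].
  assert (1 <= / rho) by (rewrite -Rinv_1; apply Rinv_le_contravar; lra); nra. }
assert (Ei : forall n, ex_series (fun i => wt i * ct n)).
{ intros n; destruct Ewt as [l Hl]; exists (l * ct n); apply is_series_scal_r, Hl. }
assert (Ds : forall n, Cis_series (dt n) (CSeries (dt n))).
{ intros n; apply Cabs_series_CSeries, (Cabs_series_le _ _ (Dt n)), Ei. }
assert (Qn : forall n, quad_deriv (fun x => series_term k x n) z (CSeries (dt n)) (Series (fun i => wt i * ct n)) del).
{ intros n; apply (quad_deriv_series (fun i x => a i * x ^ N n i)%C _ _ (dt n)); [exact D0|apply Qt|apply Ei| |apply Ds].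
  intros h Hh; rewrite series_term_odd_part_sum.
  assert (Hzh : Cmod (z + h) < 1) by (eapply Rle_lt_trans; [apply Cmod_triangle|unfold del in Hh; lra]).
  assert (Hp : Cmod ((z + h) ^ (2 * n + 1)%N) < 1) by (apply Cmod_pow_lt1; [exact Hzh|lia]).
  refine (Cis_series_ext _ _ _ _ (eulerian_odd k _ Hk Hp)); intros i; unfold a, N; rewrite (Cpow_muln (z + h)); reflexivity. }
exists (CSeries (fun n => CSeries (dt n))).
apply (quad_deriv_Cderiv _ _ _ (Series (fun n => Series (fun i => wt i * ct n))) del D0).
assert (Em : ex_series (fun n => Series (fun i => wt i * ct n))).
{ refine (ex_series_ext (fun n => Series wt * ct n) _ _ _); [intros n; rewrite Series_scal_r; reflexivity|].
  apply (@ex_series_scal_l R_AbsRing R_NormedModule), Ect. }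
apply (quad_deriv_series (fun n x => series_term k x n) _ _ (fun n => CSeries (dt n))); [exact D0|exact Qn|exact Em| |].
- intros h Hh; apply q_series_is_series; [exact Hk|].
  eapply Rle_lt_trans; [apply Cmod_triangle|unfold del in Hh; lra].
- apply Cabs_series_CSeries, (Cabs_series_le _ (fun n => Series (fun i => wt i * ct n))); [|exact Em].
  intros n; apply (Cis_series_Cmod_le _ _ _ (Ds n) (Dt n) (Ei n)).
Qed.

Lemma Cderiv_nome tau : exists d, Cderiv nome tau d.
Proof.
eexists; apply (Cderiv_comp (fun t => RtoC (2 * PI) * Ci * t)%C Cexp).
- apply Cderiv_scal, Cderiv_id.
- apply Cderiv_Cexp.
Qed.

Lemma T2k_ex_derive k tau : (1 <= k)%N -> 0 < Im tau -> @ex_derive C_AbsRing C_NormedModule (T2k k) tau.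
Proof.
intros Hk Ht; pose proof (nome_lt1 tau Ht) as N.
destruct (q_series_Cderiv k _ Hk N) as [d1 D1]; destruct (q_series_Cderiv 1 _ isT N) as [d2 D2].
destruct (Cderiv_nome tau) as [e De]; destruct (Cderiv_pow _ _ _ k D2) as [d3 D3].
pose proof (Cderiv_plus _ _ _ _ _ D1 (Cderiv_scal (- RtoC (d_coef k))%C _ _ _ D3)) as D.
pose proof (Cderiv_comp nome _ _ _ _ De D) as Dc; cbv beta in Dc.
(* The radius [Im tau] keeps [tau + h] in the upper half-plane, where the nome lies in the unit disk
   and [Tq_eq] applies. *)
eapply Cderiv_ex_derive; refine (Cderiv_ext_loc _ _ _ _ (Im tau) Ht _ Dc); intros h Hh.
unfold T2k; rewrite Tq_eq; [ring|]; apply nome_lt1.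
assert (Hi : Rabs (Im h) < Im tau).
{ eapply Rle_lt_trans; [|exact Hh]; eapply Rle_trans; [apply Rmax_r|apply Rmax_Cmod]. }
pose proof (Rabs_def2 _ _ Hi); replace (Im (tau + h)) with (Im tau + Im h) by (destruct tau, h; reflexivity); lra.
Qed.

Lemma nome_half_small tau : 1 <= Im tau -> Cmod (nome (tau / 2)) <= 1 / 2.
Proof.
intros Ht; rewrite Cmod_nome Im_div2; pose proof PI2_1 as P.
assert (E : exp (- (2 * PI * (Im tau / 2))) <= exp (- (1))) by (apply exp_le_mono; nra).
eapply Rle_trans; [exact E|]; rewrite exp_Ropp; unfold Rdiv; rewrite Rmult_1_l.
apply Rinv_le_contravar; [lra|pose proof (exp_ineq1_le 1); lra].
Qed.

Lemma form_at_bound k : (1 <= k)%N -> exists K, 0 < K /\ forall c d tau, 1 <= Im tau ->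
  Cmod (form_at k c d tau) <= K * exp (- (PI * Im tau)).
Proof.
intros Hk; destruct (form_zero_q_bound k Hk) as [K1 [K10 H1]]; destruct (Tq_bound k Hk) as [K2 [K20 H2]].
exists (K1 + K2); split; [lra|]; intros c d tau Ht.
pose proof (exp_pos (- (PI * Im tau))) as E0.
assert (N : Cmod (nome (tau / 2)) = exp (- (PI * Im tau))) by (rewrite Cmod_nome Im_div2; f_equal; field).
pose proof (nome_half_small tau Ht) as S.
destruct c, d; simpl form_at.
- unfold form_zero; rewrite nome_half_shift; eapply Rle_trans; [apply H1; rewrite Cmod_opp; exact S|].
  rewrite Cmod_opp N; nra.
- rewrite Cmod_opp; unfold form_zero; eapply Rle_trans; [apply H1, S|rewrite N; nra].
- unfold form_infty; eapply Rle_trans; [apply H2, S|rewrite N; nra].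
- rewrite Cmod_0; nra.
Qed.

Lemma exp_decay_small K eps : 0 < K -> 0 < eps -> exists A, 0 < A /\ forall y, A < y -> K * exp (- y) < eps.
Proof.
intros HK He; exists (K / eps); split; [apply Rdiv_lt_0_compat; lra|]; intros y Hy.
assert (Y0 : 0 < y) by (pose proof (Rdiv_lt_0_compat K eps HK He); lra).
rewrite exp_Ropp; pose proof (exp_ineq1 y ltac:(lra)) as E.
apply (Rmult_lt_reg_r (exp y)); [apply exp_pos|]; rewrite Rmult_assoc Rinv_l; [|apply Rgt_not_eq, exp_pos].
apply (Rmult_lt_compat_r eps) in Hy; [|exact He].
replace (K / eps * eps) with K in Hy by (field; lra); nra.
Qed.

Lemma zero_at_i_infty_form_at k c d (a b : R) (m : C) (f : C -> C) : (1 <= k)%N -> 0 < a ->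
  (forall tau, 0 < Im tau -> f tau = (m * form_at k c d (RtoC a * tau + RtoC b))%C) -> zero_at_i_infty f.
Proof.
intros Hk Ha Hf eps Heps; destruct (form_at_bound k Hk) as [K [K0 HK]].
pose proof (Cmod_ge_0 m) as m0.
assert (KM : 0 < (1 + Cmod m) * K) by nra.
destruct (exp_decay_small _ eps KM Heps) as [A [A0 HA]].
exists (Rmax (1 / a) (A / a)); intros tau Ht HtA.
assert (L1 : 1 / a < Im tau) by (eapply Rle_lt_trans; [apply Rmax_l|exact HtA]).
assert (L2 : A / a < Im tau) by (eapply Rle_lt_trans; [apply Rmax_r|exact HtA]).
apply (Rmult_lt_compat_l a) in L1; [|exact Ha]; apply (Rmult_lt_compat_l a) in L2; [|exact Ha].
replace (a * (1 / a)) with 1 in L1 by (field; lra); replace (a * (A / a)) with A in L2 by (field; lra).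
assert (I : Im (RtoC a * tau + RtoC b) = a * Im tau) by (destruct tau; simpl; ring).
assert (I1 : 1 <= Im (RtoC a * tau + RtoC b)) by (rewrite I; lra).
rewrite Hf // Cmod_mult; specialize (HK c d _ I1); rewrite I in HK.
pose proof PI2_1 as P; set (y := a * Im tau) in *.
assert (Ey : exp (- (PI * y)) <= exp (- y)) by (apply exp_le_mono; nra).
specialize (HA y L2); pose proof (exp_pos (- y)).
apply Rle_lt_trans with ((1 + Cmod m) * K * exp (- y)); [|exact HA].
rewrite Rmult_assoc; apply Rmult_le_compat; try apply Cmod_ge_0; [lra|].
eapply Rle_trans; [exact HK|apply Rmult_le_compat_l; lra].
Qed.

Lemma T2k_form k z : T2k k z = form_infty k (2 * z).
Proof. unfold T2k, form_infty; do 2 f_equal; field; apply RtoC2_neq0. Qed.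

(** The equations say that [l diag(2,1) g] equals the integral matrix with rows [(a, b)] and
    [(c, d)] times the one with rows [(u, v)] and [(0, 1)]. Through this factorisation the level-2
    transformation law reaches the values of [slash]. *)
Lemma slash_T2k k g a b c d (u v : R) (l : R) tau : (1 <= k)%N -> odd k -> 0 < Im tau -> 0 < u -> l <> 0 ->
  (a * d - b * c = 1)%Z ->
  (RtoC (IZR c) * (RtoC u * tau + RtoC v) + RtoC (IZR d) = RtoC l * aut_factor g tau)%C ->
  (2 * (RtoC (IZR (m11 g)) * tau + RtoC (IZR (m12 g))) * RtoC l
    = RtoC (IZR a) * (RtoC u * tau + RtoC v) + RtoC (IZR b))%C ->
  slash (2 * k) (T2k k) g tau = (RtoC (l ^ (2 * k)%N) * RtoC (parity_sign a b c d) *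
     form_at k (Z.odd c) (Z.odd d) (RtoC u * tau + RtoC v))%C.
Proof.
intros Hk Hodd Ht Hu Hl Hdet Ec En.
set (w := (RtoC u * tau + RtoC v)%C) in *.
assert (Hw : 0 < Im w).
{ replace (Im w) with (u * Im tau) by (unfold w; destruct tau; simpl; ring); nra. }
pose proof (transforms_all k Hk Hodd a b c d Hdet w Hw) as H.
pose proof (aut_neq0 c d w Hw (det_row _ _ _ _ Hdet)) as N.
pose proof (RtoC_neq0 _ Hl) as L0.
assert (J : aut_factor g tau <> RtoC 0) by (intros E; apply N; rewrite Ec E; ring).
unfold slash; rewrite T2k_form.
replace (2 * moebius g tau)%C with ((RtoC (IZR a) * w + RtoC (IZR b)) / (RtoC (IZR c) * w + RtoC (IZR d)))%C.
- rewrite H Ec Cpow_mult_l RtoC_pow; field; apply Cpow_nz, J.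
- rewrite -En Ec; unfold moebius; field; split; assumption.
Qed.

(** For invariance, conjugation by the doubling makes both off-diagonal entries even, so the sign is
    1 and the lower row is that of the cusp at infinity. For the cusps, the parities of the lower
    row of [g] select one of three upper triangular matrices of determinant 2, up to scaling, and
    every [form_at] decays. *)
Lemma T2k_cusp_form k : (1 <= k)%N -> odd k -> cusp_form (2 * k) (Gamma0 4) (T2k k).
Proof.
intros Hk Hodd; split; [intros tau Ht; apply T2k_ex_derive; assumption|split].
- intros g [c' Hg] tau Ht; pose proof (SL2Z_det g) as Hdet.
  assert (Hdet' : (m11 g * m22 g - (2 * m12 g) * (2 * c') = 1)%Z) by lia.
  pose proof (det_odd _ _ _ _ Hdet') as Ho; rewrite !Z.odd_mul in Ho.
  rewrite (slash_T2k k g (m11 g) (2 * m12 g) (2 * c') (m22 g) 2 0 1 tau) //; try lra.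
  + rewrite T2k_form pow1 Cmult_1_l.
    assert (Od : Z.odd (m22 g) = true) by (destruct (Z.odd (m22 g)); [reflexivity|rewrite andbF in Ho; discriminate]).
    unfold parity_sign; rewrite !Z.odd_mul Od /=.
    replace (RtoC 2 * tau + RtoC 0)%C with (2 * tau)%C by ring.
    rewrite orbT; apply Cmult_1_l.
  + assert (Hg' : m21 g = (2 * (2 * c'))%Z) by lia; unfold aut_factor.
    rewrite Hg' (mult_IZR 2 (2 * c')) (mult_IZR 2 c') (RtoC_mult 2 (2 * IZR c')) (RtoC_mult 2 (IZR c')); ring.
  + rewrite mult_IZR RtoC_mult; ring.
- intros g; pose proof (SL2Z_det g) as Hdet.
  assert (half : forall z, Z.odd z = false -> exists z', z = (2 * z')%Z).
  { intros z Hz; exists (Z.div2 z); pose proof (Z.div2_odd z) as E; rewrite Hz in E; simpl Z.b2z in E; lia. }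
  destruct (Z.odd (m21 g)) eqn:Oc; [destruct (Z.odd (m22 g)) eqn:Od|].
  (* Both lower entries are odd, so their difference can be halved; the triangular factor has rows
     [(1, 1)] and [(0, 2)], up to the scalar [l = 1/2]. *)
  + destruct (half (m22 g - m21 g)%Z) as [d' Hd]; [rewrite Z.odd_sub Oc Od; reflexivity|].
    apply (zero_at_i_infty_form_at k (Z.odd (m21 g)) (Z.odd d') (1 / 2) (1 / 2)
      (RtoC ((1 / 2) ^ (2 * k)%N) * RtoC (parity_sign (2 * m11 g) (m12 g - m11 g) (m21 g) d'))%C); [exact Hk|lra|].
    intros tau Ht; apply slash_T2k; try assumption; try lra; [nia| |].
    * unfold aut_factor; replace (m22 g) with (m21 g + 2 * d')%Z by lia.
      rewrite plus_IZR mult_IZR RtoC_plus RtoC_mult; unfold Rdiv; rewrite RtoC_mult RtoC_inv; [|lra]; field; apply RtoC2_neq0.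
    * rewrite minus_IZR mult_IZR RtoC_minus RtoC_mult; unfold Rdiv; rewrite RtoC_mult RtoC_inv; [|lra]; field; apply RtoC2_neq0.
  + destruct (half _ Od) as [d' Hd].
    apply (zero_at_i_infty_form_at k (Z.odd (m21 g)) (Z.odd d') (1 / 2) 0
      (RtoC ((1 / 2) ^ (2 * k)%N) * RtoC (parity_sign (2 * m11 g) (m12 g) (m21 g) d'))%C); [exact Hk|lra|].
    intros tau Ht; apply slash_T2k; try assumption; try lra; [nia| |].
    * unfold aut_factor; rewrite Hd mult_IZR RtoC_mult; unfold Rdiv; rewrite RtoC_mult RtoC_inv; [|lra]; field; apply RtoC2_neq0.
    * rewrite mult_IZR RtoC_mult; unfold Rdiv; rewrite RtoC_mult RtoC_inv; [|lra]; field; apply RtoC2_neq0.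
  + destruct (half _ Oc) as [c' Hc].
    apply (zero_at_i_infty_form_at k (Z.odd c') (Z.odd (m22 g)) 2 0
      (RtoC (1 ^ (2 * k)%N) * RtoC (parity_sign (m11 g) (2 * m12 g) c' (m22 g)))%C); [exact Hk|lra|].
    intros tau Ht; apply slash_T2k; try assumption; try lra; [nia| |].
    * unfold aut_factor; rewrite Hc mult_IZR RtoC_mult; ring.
    * rewrite mult_IZR RtoC_mult; ring.
Qed.

(** * Limits at 1 in Stolz regions *)

Lemma Rabs_atan_le x : Rabs (atan x) <= Rabs x.
Proof.
assert (D : forall y, derivable_pt_lim atan y (/ (1 + y ^ 2))) by apply derivable_pt_lim_atan.
destruct (MVT_gen atan 0 x (fun y => / (1 + y ^ 2))) as [c [_ Hc]].
- intros y _; apply is_derive_Reals, D.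
- intros y _; apply derivable_continuous_pt; eexists; apply D.
- rewrite atan_0 !Rminus_0_r in Hc; rewrite Hc Rabs_mult -{2}(Rmult_1_l (Rabs x)).
  apply Rmult_le_compat_r; [apply Rabs_pos|]; pose proof (pow2_ge_0 c).
  rewrite Rabs_pos_eq; [|left; apply Rinv_0_lt_compat; lra].
  rewrite -Rinv_1; apply Rinv_le_contravar; lra.
Qed.

(* The logarithm of [q] divided by [i pi], for [q] near 1. *)
Definition disk_log (q : C) : C := (atan (Im q / Re q) / PI, - ln (Cmod q) / PI).

(** The bound [1/4] keeps [Re q] at least [3/4], so that [atan] is the argument. The estimates use
    [1 - r <= - ln r <= 4/3 (1 - r)] and [3 < PI <= 4]: real and imaginary parts of the logarithm
    are at most [4/3 |1 - q|] each, and [8/3 < PI]. *)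
Lemma disk_log_spec q : Cmod q < 1 -> Cmod (1 - q) <= 1 / 4 ->
  [/\ nome (disk_log q / 2) = q, (1 - Cmod q) / 4 <= Im (disk_log q) & Cmod (disk_log q) <= Cmod (1 - q)].
Proof.
intros Hq H1; pose proof PI_RGT_0 as P0; pose proof PI_4 as P4; pose proof PI2_3_2 as P3.
set (d := Cmod (1 - q)) in *; set (r := Cmod q) in *; destruct q as [a b].
assert (Ha : Rabs (1 - a) <= d).
{ pose proof (re_le_Cmod (1 - (a, b))%C) as R; unfold d; replace (Re (1 - (a, b))%C) with (1 - a) in R by (simpl; ring); exact R. }
assert (Hb : Rabs b <= d).
{ pose proof (Rmax_Cmod (1 - (a, b))%C) as R; simpl in R.
  pose proof (Rmax_r (Rabs (1 + - a)) (Rabs (0 + - b))) as R2.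
  rewrite Rplus_0_l Rabs_Ropp in R2; rewrite Rplus_0_l Rabs_Ropp in R; unfold d; eapply Rle_trans; [exact R2|exact R]. }
assert (a1 : 3 / 4 <= a) by (apply Rabs_le_between in Ha; lra).
assert (ra : a <= r).
{ pose proof (re_le_Cmod (a, b)) as R; simpl in R; fold r in R; pose proof (Rle_abs a); lra. }
assert (r1 : 1 - r <= d) by (pose proof (Cmod_one_minus_ge (a, b)) as R; exact R).
assert (rsq : r * r = a * a + b * b).
{ unfold r, Cmod; simpl; rewrite sqrt_sqrt; [ring|nra]. }
assert (l1 : 1 - r <= - ln r).
{ pose proof (exp_ineq1_le (ln r)) as E; rewrite exp_ln in E; lra. }
assert (l2 : - ln r <= 4 / 3 * (1 - r)).
{ pose proof (exp_ineq1_le (- ln r)) as E; rewrite exp_Ropp exp_ln in E; [|lra].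
  assert (/ r - 1 <= 4 / 3 * (1 - r)); [|lra].
  replace (/ r - 1) with ((1 - r) * / r) by (field; lra).
  rewrite (Rmult_comm (4 / 3)); apply Rmult_le_compat_l; [lra|].
  replace (4 / 3) with (/ (3 / 4)) by field; apply Rinv_le_contravar; lra. }
assert (th : Rabs (atan (b / a)) <= 4 / 3 * d).
{ eapply Rle_trans; [apply Rabs_atan_le|]; unfold Rdiv at 1; rewrite Rabs_mult (Rabs_pos_eq (/ a));
    [|left; apply Rinv_0_lt_compat; lra].
  rewrite Rmult_comm; apply Rmult_le_compat; try apply Rabs_pos; [left; apply Rinv_0_lt_compat; lra| |exact Hb].
  replace (4 / 3) with (/ (3 / 4)) by field; apply Rinv_le_contravar; lra. }
split.
- unfold nome, disk_log; simpl Re; simpl Im; fold r.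
  match goal with |- Cexp ?z = _ => replace z with ((ln r, atan (b / a)) : C)
    by (apply injective_projections; simpl; field; lra) end.
  unfold Cexp; simpl; rewrite exp_ln; [|lra].
  rewrite cos_atan sin_atan.
  assert (S : sqrt (1 + (b / a)²) = r / a).
  { replace (1 + (b / a)²) with ((r / a)²); [apply sqrt_Rsqr, Rlt_le, Rdiv_lt_0_compat; lra|].
    unfold Rsqr; replace (r / a * (r / a)) with (r * r / (a * a)) by (field; lra); rewrite rsq; field; lra. }
  rewrite S; f_equal; field; lra.
- simpl Im; fold r; apply Rle_trans with ((1 - r) / PI).
  + unfold Rdiv; apply Rmult_le_compat_l; [lra|apply Rinv_le_contravar; lra].
  + unfold Rdiv; apply Rmult_le_compat_r; [left; apply Rinv_0_lt_compat; lra|exact l1].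
- apply Rle_trans with (Rabs (atan (b / a) / PI) + Rabs (- ln r / PI)).
  + replace (disk_log (a, b)) with (RtoC (atan (b / a) / PI) + Ci * RtoC (- ln r / PI))%C
      by (unfold disk_log; simpl Re; simpl Im; fold r; generalize (atan (b / a) / PI) (- ln r / PI);
          intros u v; apply injective_projections; simpl; ring).
    eapply Rle_trans; [apply Cmod_triangle|]; rewrite Cmod_mult Cmod_Ci !Cmod_R; lra.
  + unfold Rdiv; rewrite !Rabs_mult (Rabs_pos_eq (/ PI)); [|left; apply Rinv_0_lt_compat, P0].
    rewrite (Rabs_pos_eq (- ln r)); [|lra].
    rewrite -Rmult_plus_distr_r; apply (Rmult_le_reg_r PI); [exact P0|].
    rewrite Rmult_assoc Rinv_l; [|lra]; rewrite Rmult_1_r; nra.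
Qed.

(** A single term of the exponential series bounds [exp y] from below. *)
Lemma pow_exp_bound n y : 0 < y -> y ^ n * exp (- y) <= INR (n.+1)`! / y.
Proof.
intros Hy; assert (H : y ^ n.+1 * / INR (n.+1)`! <= exp y).
{ unfold exp; destruct (exist_exp y) as [l Hl]; change (y ^ n.+1 * / INR (n.+1)`! <= l); apply is_series_Reals in Hl.
  set (a := fun i => / INR (Factorial.fact i) * y ^ i) in Hl.
  assert (a0 : forall i, 0 <= a i).
  { intros i; unfold a; rewrite fact_factorial; apply Rmult_le_pos; [left; apply Rinv_0_lt_compat, INR_fact_gt0|apply pow_le; lra]. }
  pose proof (sum_n_le_Series a n.+1 a0 (ex_intro _ _ Hl)) as S; rewrite (is_series_unique _ _ Hl) in S.
  rewrite sum_Sn in S; change (plus ?u ?v) with (u + v) in S.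
  assert (0 <= sum_n a n).
  { clear -a0; induction n as [|n IH]; [rewrite sum_O; apply a0|rewrite sum_Sn].
    change (plus ?u ?v) with (u + v); specialize (a0 n.+1); lra. }
  unfold a at 2 in S; rewrite fact_factorial in S; rewrite Rmult_comm; lra. }
pose proof (INR_fact_gt0 n.+1) as F0; pose proof (exp_pos y) as E0.
rewrite exp_Ropp; apply (Rmult_le_reg_r (exp y * y)); [apply Rmult_lt_0_compat; assumption|].
replace (y ^ n * / exp y * (exp y * y)) with (y ^ n.+1) by (simpl; field; lra).
replace (INR (n.+1)`! / y * (exp y * y)) with (exp y * INR (n.+1)`!) by (field; lra).
apply (Rmult_le_compat_r (INR (n.+1)`!)) in H; [|lra].
rewrite Rmult_assoc Rinv_l in H; lra.
Qed.

Section Stolz.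
Variable M : R.

Definition stolz (q : C) : Prop := Cmod q < 1 /\ Cmod (1 - q) <= M * (1 - Cmod q).

(** It bounds [|tau| / Im tau] for [tau = disk_log q]: the factor 4 comes from
    [Im tau >= (1 - |q|) / 4], and [1 + |M|] keeps the constant positive whatever the sign of
    [M]. *)
Definition stolz_const : R := 4 * (1 + Rabs M).

(** The ratio of modulus to imaginary part is preserved by [tau -> -1/tau], so a Stolz region at 1
    corresponds to a sector in which [sigma] tends to infinity. *)
Lemma stolz_inversion q : stolz q -> Cmod (1 - q) <= 1 / 4 -> exists sigma,
  [/\ 0 < Im sigma, disk_log q = (- / sigma)%C, nome (- / sigma / 2) = q,
      Cmod sigma <= stolz_const * Im sigma & / Cmod (1 - q) <= Cmod sigma].
Proof.
intros [H1 H2] H3; destruct (disk_log_spec q H1 H3) as [A B D].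
set (tau := disk_log q) in *.
assert (Ht : 0 < Im tau) by lra.
pose proof (Im_neq0 _ Ht) as T0; assert (t0 : 0 < Cmod tau) by now apply Cmod_gt_0.
assert (E : (- / - / tau)%C = tau) by (field; exact T0).
exists (- / tau)%C; rewrite E.
assert (L : Cmod tau <= stolz_const * Im tau).
{ pose proof (Rle_abs M); pose proof (Rabs_pos M); unfold stolz_const.
  assert (M * (1 - Cmod q) <= (1 + Rabs M) * (1 - Cmod q)) by (apply Rmult_le_compat_r; lra).
  assert ((1 + Rabs M) * (1 - Cmod q) <= (1 + Rabs M) * (4 * Im tau)) by (apply Rmult_le_compat_l; lra).
  lra. }
split; [apply Im_inversion, Ht|reflexivity|exact A| |].
- rewrite Cmod_opp (Cmod_inv _ T0).
  assert (I : Im (- / tau) = Im tau * / (Cmod tau * Cmod tau)).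
  { assert (S : Cmod tau * Cmod tau = Re tau * Re tau + Im tau * Im tau).
    { pose proof (Cmod2_alt tau) as Q; simpl in Q; rewrite !Rmult_1_r in Q; exact Q. }
    rewrite S; destruct tau as [x y]; simpl in *; field; nra. }
  rewrite I; apply (Rmult_le_reg_r (Cmod tau * Cmod tau)); [nra|].
  replace (/ Cmod tau * (Cmod tau * Cmod tau)) with (Cmod tau) by (field; lra).
  replace (stolz_const * (Im tau * / (Cmod tau * Cmod tau)) * (Cmod tau * Cmod tau)) with (stolz_const * Im tau) by (field; lra).
  exact L.
- rewrite Cmod_opp (Cmod_inv _ T0); apply Rinv_le_contravar; assumption.
Qed.

Lemma stolz_const_ge : 4 <= stolz_const.
Proof. unfold stolz_const; pose proof (Rabs_pos M); lra. Qed.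

Lemma stolz_Im_ge q sigma : stolz q -> Cmod (1 - q) < / stolz_const -> Cmod sigma <= stolz_const * Im sigma ->
  / Cmod (1 - q) <= Cmod sigma -> 1 <= Im sigma /\ / Im sigma <= stolz_const * Cmod (1 - q).
Proof.
intros [H1 _] Hd Hs Hi; pose proof stolz_const_ge as S4.
assert (d0 : 0 < Cmod (1 - q)) by apply Cmod_gt_0, one_minus_neq0, H1.
assert (i0 : stolz_const < / Cmod (1 - q)).
{ rewrite -(Rinv_inv stolz_const); apply Rinv_lt_contravar; [|exact Hd].
  apply Rmult_lt_0_compat; [exact d0|apply Rinv_0_lt_compat; lra]. }
assert (I1 : 1 <= Im sigma) by nra.
split; [exact I1|].
apply (Rmult_le_reg_r (Im sigma)); [lra|]; rewrite Rinv_l; [|lra].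
apply (Rmult_le_reg_l (/ Cmod (1 - q))); [apply Rinv_0_lt_compat, d0|].
replace (/ Cmod (1 - q) * (stolz_const * Cmod (1 - q) * Im sigma)) with (stolz_const * Im sigma) by (field; lra).
lra.
Qed.

(** After inversion the form is [sigma^(2k)] times an exponentially small function of [Im sigma]. In
    the sector [|sigma|] is at most a multiple of [Im sigma], so the exponential dominates; this is
    where nontangential approach enters. *)
Lemma Tq_stolz k : (1 <= k)%N -> odd k -> exists K, 0 < K /\ forall q, stolz q -> Cmod (1 - q) < / stolz_const ->
  Cmod (Tq k q) <= K * Cmod (1 - q).
Proof.
intros Hk Hodd; destruct (form_at_bound k Hk) as [K [K0 HK]].
pose proof stolz_const_ge as S4; pose proof (INR_fact_gt0 (2 * k).+1) as F0; pose proof PI2_1 as P1.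
assert (Sk : 0 < stolz_const ^ (2 * k)%N) by (apply pow_lt; lra).
exists (stolz_const ^ (2 * k)%N * K * INR ((2 * k).+1)`! * stolz_const).
assert (C0 : 0 < stolz_const ^ (2 * k)%N * K) by (apply Rmult_lt_0_compat; assumption).
assert (C1 : 0 < stolz_const ^ (2 * k)%N * K * INR ((2 * k).+1)`!) by (apply Rmult_lt_0_compat; assumption).
split; [apply Rmult_lt_0_compat; [exact C1|lra]|].
intros q Hq Hd.
assert (Hd4 : Cmod (1 - q) <= 1 / 4).
{ apply Rle_trans with (/ stolz_const); [lra|]; unfold Rdiv; rewrite Rmult_1_l; apply Rinv_le_contravar; lra. }
destruct (stolz_inversion q Hq Hd4) as [sigma [Hs _ Hn Hl Hi]].
destruct (stolz_Im_ge q sigma Hq Hd Hl Hi) as [I1 I2].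
rewrite -Hn; change (Tq k (nome (- / sigma / 2))) with (form_infty k (- / sigma)).
rewrite form_infty_S // Cmod_mult Cmod_pow.
specialize (HK true false sigma I1); simpl form_at in HK; rewrite Cmod_opp in HK.
set (y := Im sigma) in *; pose proof (pow_exp_bound (2 * k)%N y ltac:(lra)) as B.
assert (Ey : exp (- (PI * y)) <= exp (- y)) by (apply exp_le_mono; nra).
pose proof (exp_pos (- y)) as E0; rewrite Hn.
assert (y0 : 0 <= y ^ (2 * k)%N) by (apply pow_le; lra).
apply Rle_trans with ((stolz_const * y) ^ (2 * k)%N * (K * exp (- y))).
- apply Rmult_le_compat; try apply pow_le; try apply Cmod_ge_0.
  + apply pow_incr; split; [apply Cmod_ge_0|exact Hl].
  + eapply Rle_trans; [exact HK|apply Rmult_le_compat_l; lra].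
- rewrite Rpow_mult_distr.
  apply Rle_trans with (stolz_const ^ (2 * k)%N * K * (y ^ (2 * k)%N * exp (- y))); [right; ring|].
  apply Rle_trans with (stolz_const ^ (2 * k)%N * K * (INR ((2 * k).+1)`! / y)).
  + apply Rmult_le_compat_l; [lra|exact B].
  + unfold Rdiv; rewrite -Rmult_assoc (Rmult_assoc _ stolz_const).
    apply Rmult_le_compat_l; [lra|exact I2].
Qed.
End Stolz.

#[local] Instance within_disk_filter M : Filter (within_disk_to_1 M).
Proof. apply within_filter, locally_filter. Qed.

Lemma within_disk_small M eps : 0 < eps ->
  within_disk_to_1 M (fun q => stolz M q /\ Cmod (1 - q) < eps).
Proof.
intros He.
assert (L : @locally C_UniformSpace (RtoC 1) (fun q => Cmod (q - 1)%C < eps)).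
{ apply (@locally_le_locally_norm C_AbsRing C_NormedModule (RtoC 1)).
  exists (mkposreal eps He); intros y Hy; exact Hy. }
destruct L as [e H]; exists e; intros y Hy Hy2; split; [exact Hy2|].
replace (1 - y)%C with (- (y - 1))%C by ring; rewrite Cmod_opp; exact (H y Hy).
Qed.

Lemma Clim_within_disk M f l K eps : 0 < eps -> 0 < K ->
  (forall q, stolz M q -> Cmod (1 - q) < eps -> Cmod (f q - l)%C <= K * Cmod (1 - q)) ->
  Clim (within_disk_to_1 M) f l.
Proof.
intros He HK H; apply (Clim_squeeze _ _ _ (fun q => K * Cmod (1 - q))).
- generalize (within_disk_small M eps He); apply filter_imp; intros q [H1 H2]; apply H; assumption.
- intros e He'; assert (e1 : 0 < e / K) by (apply Rdiv_lt_0_compat; assumption).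
  generalize (within_disk_small M _ e1); apply filter_imp; intros q [_ H2].
  apply (Rmult_lt_compat_l K) in H2; [|exact HK].
  replace (K * (e / K)) with e in H2 by (field; lra); exact H2.
Qed.

Lemma lim_to_1_Clim f l : (forall M, Clim (within_disk_to_1 M) f l) -> lim_to_1 f l.
Proof. intros H M; apply (filterlim_Clim (within_disk_to_1 M)), H. Qed.

Lemma Tq_lim_to_1 k : (1 <= k)%N -> odd k -> lim_to_1 (Tq k) 0.
Proof.
intros Hk Hodd; apply lim_to_1_Clim; intros M; destruct (Tq_stolz M k Hk Hodd) as [K [K0 H]].
apply (Clim_within_disk M _ _ K (/ stolz_const M)); [apply Rinv_0_lt_compat; pose proof (stolz_const_ge M); lra|exact K0|].
intros q H1 H2; replace (Tq k q - 0)%C with (Tq k q) by ring; apply H; assumption.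
Qed.

(* In weight two the inversion formula reads [q_series 1 q = sigma ^ 2 * (cusp_value 1 + o(1))]. *)
Lemma q_series_1_lim M :
  Clim (within_disk_to_1 M) (fun q => (1 - q ^ 2) ^ 2 * q_series 1 q)%C (RtoC (PI ^ 2 / 4)).
Proof.
pose proof PI2_1 as P1; pose proof PI_RGT_0 as P0; pose proof PI_4 as P4; pose proof (stolz_const_ge M) as S4.
assert (S0 : 0 < / stolz_const M) by (apply Rinv_0_lt_compat; lra).
set (sg := fun q => (- / disk_log q)%C).
destruct (cusp_tail_bound 1 isT) as [K [K0 HK]].
assert (T1 : Clim (within_disk_to_1 M) (fun q => cusp_tail 1 (nome (sg q / 2))) 0).
{ apply (Clim_within_disk M _ _ (K * stolz_const M) (/ stolz_const M)); [exact S0|apply Rmult_lt_0_compat; lra|].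
  intros q Hq Hd.
  assert (Hd4 : Cmod (1 - q) <= 1 / 4).
  { apply Rle_trans with (/ stolz_const M); [lra|]; unfold Rdiv; rewrite Rmult_1_l; apply Rinv_le_contravar; lra. }
  destruct (stolz_inversion M q Hq Hd4) as [sigma [Hs Hlog _ Hl Hi]].
  destruct (stolz_Im_ge M q sigma Hq Hd Hl Hi) as [I1 I2].
  assert (E : sg q = sigma) by (unfold sg; rewrite Hlog; field; apply Im_neq0, Hs).
  rewrite E; replace (cusp_tail 1 (nome (sigma / 2)) - 0)%C with (cusp_tail 1 (nome (sigma / 2))) by ring.
  eapply Rle_trans; [apply HK, nome_half_small, I1|]; rewrite Rmult_assoc; apply Rmult_le_compat_l; [lra|].
  eapply Rle_trans; [|exact I2]; rewrite Cmod_nome Im_div2.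
  replace (2 * PI * (Im sigma / 2)) with (PI * Im sigma) by field.
  pose proof (pow_exp_bound 0 (Im sigma) ltac:(lra)) as B; rewrite Rmult_1_l factS fact0 in B.
  assert (exp (- (PI * Im sigma)) <= exp (- Im sigma)) by (apply exp_le_mono; nra).
  unfold Rdiv in B; simpl (INR _) in B; lra. }
destruct Cexp_remainder as [K' [K0' HK']].
(* With [h = 2 pi i tau] one has [(1 - q^2) sigma = (exp h - 1) / tau], which tends to [2 pi i]. *)
assert (T2 : Clim (within_disk_to_1 M) (fun q => (1 - q ^ 2) * sg q)%C (RtoC (2 * PI) * Ci)%C).
{ assert (e0 : 0 < / (stolz_const M * PI)) by (apply Rinv_0_lt_compat, Rmult_lt_0_compat; lra).
  apply (Clim_within_disk M _ _ (K' * (2 * PI) ^ 2) (/ (stolz_const M * PI))); [exact e0|apply Rmult_lt_0_compat; [lra|apply pow_lt; lra]|].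
  intros q Hq Hd.
  assert (Q : Cmod (1 - q) * (stolz_const M * PI) < 1).
  { apply (Rmult_lt_reg_r (/ (stolz_const M * PI))); [exact e0|]; rewrite Rmult_assoc Rinv_r; [lra|].
    apply Rmult_integral_contrapositive_currified; lra. }
  pose proof (Cmod_ge_0 (1 - q)) as d0.
  assert (Hd8 : Cmod (1 - q) * (2 * PI) <= 1) by nra.
  assert (Hd4 : Cmod (1 - q) <= 1 / 4) by nra.
  destruct (disk_log_spec q (proj1 Hq) Hd4) as [A B D]; set (tau := disk_log q) in *.
  assert (T0 : tau <> RtoC 0) by (apply Im_neq0; destruct Hq; lra).
  assert (t0 : 0 < Cmod tau) by now apply Cmod_gt_0.
  assert (Eq : (q ^ 2)%C = Cexp (RtoC (2 * PI) * Ci * tau)).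
  { rewrite -A; unfold nome; rewrite -Cexp_INR; f_equal; simpl (INR 2).
    replace (1 + 1) with 2 by ring; field; apply RtoC2_neq0. }
  set (h := (RtoC (2 * PI) * Ci * tau)%C) in *.
  assert (Hh : Cmod h = 2 * PI * Cmod tau).
  { unfold h; rewrite !Cmod_mult Cmod_R Cmod_Ci Rabs_pos_eq; lra. }
  assert (h1 : Cmod h <= 1) by (rewrite Hh; nra).
  specialize (HK' h h1); unfold sg; fold tau; rewrite Eq.
  replace ((1 - Cexp h) * - / tau - RtoC (2 * PI) * Ci)%C with ((Cexp h - 1 - h) * / tau)%C by (unfold h; field; exact T0).
  rewrite Cmod_mult (Cmod_inv _ T0); apply (Rmult_le_reg_r (Cmod tau)); [exact t0|].
  rewrite Rmult_assoc Rinv_l; [|lra]; rewrite Rmult_1_r; eapply Rle_trans; [exact HK'|].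
  rewrite Hh; replace (K' * (2 * PI * Cmod tau) ^ 2) with (K' * (2 * PI) ^ 2 * Cmod tau * Cmod tau) by (simpl; ring).
  apply Rmult_le_compat_r; [lra|]; apply Rmult_le_compat_l; [|exact D].
  apply Rmult_le_pos; [lra|apply pow_le; lra]. }
(* The value is [(2 pi i)^2] times [cusp_value 1 = -1/16]. *)
replace (RtoC (PI ^ 2 / 4)) with ((RtoC (2 * PI) * Ci) ^ 2 * (RtoC (cusp_value 1) + 0))%C.
- apply (Clim_ext _ (fun q => ((1 - q ^ 2) * sg q) ^ 2 * (RtoC (cusp_value 1) + cusp_tail 1 (nome (sg q / 2))))%C).
  + generalize (within_disk_small M _ S0); apply filter_imp; intros q [Hq Hd].
    assert (Hd4 : Cmod (1 - q) <= 1 / 4).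
    { apply Rle_trans with (/ stolz_const M); [lra|]; unfold Rdiv; rewrite Rmult_1_l; apply Rinv_le_contravar; lra. }
    destruct (stolz_inversion M q Hq Hd4) as [sigma [Hs Hlog Hn _ _]].
    assert (E : sg q = sigma) by (unfold sg; rewrite Hlog; field; apply Im_neq0, Hs).
    replace (q_series 1 q) with (q_series 1 (nome (- / sigma / 2))) by now rewrite Hn.
    rewrite E q_series_inversion // Cpow_mult_l; change (2 * 1)%N with 2%N; ring.
  + apply (Clim_mult (within_disk_to_1 M)); [apply (Clim_pow (within_disk_to_1 M)), T2|].
    apply (Clim_plus (within_disk_to_1 M)); [apply (Clim_const (within_disk_to_1 M))|exact T1].
- rewrite cusp_value_1 Cplus_0_r Cpow_mult_l -RtoC_pow.
  replace (Ci ^ 2)%C with (RtoC (-1)) by (apply injective_projections; simpl; ring).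
  rewrite -!RtoC_mult; f_equal; field.
Qed.

(** This fixes the common factor of the two limits: splitting Euler's value off [d_k (pi^2/4)^k]
    leaves [(4^k - 1) (2k-1)! / 2]. *)
Lemma euler_lim_const k : (1 <= k)%N ->
  d_coef k * (PI ^ 2 / 4) ^ k =
  (4 ^ k - 1) * INR (2 * k - 1)`! / 2 *
   ((-1) ^ (k + 1)%N * 2 ^ (2 * k)%N * bernoulli (2 * k)%N * PI ^ (2 * k)%N / (2 * INR (2 * k)`!)).
Proof.
intros Hk; unfold d_coef; pose proof (INR_fact_gt0 (2 * k - 1)%N) as F0; pose proof PI_RGT_0 as P0.
assert (Ef : INR (2 * k)`! = 2 * INR k * INR (2 * k - 1)`!).
{ replace (2 * k)%N with (2 * k - 1).+1 at 1 by lia; rewrite INR_factS; f_equal.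
  replace (2 * k - 1).+1 with (2 * k)%N by lia; rewrite mulnE mult_INR; simpl; ring. }
assert (E4 : 2 ^ (2 * k)%N = 4 ^ k) by (rewrite -multE pow_mult; f_equal; simpl; ring).
assert (EP : PI ^ (2 * k)%N = (PI ^ 2) ^ k) by (rewrite -multE pow_mult; reflexivity).
assert (E16 : (-16) ^ k = (-1) ^ k * 4 ^ k * 4 ^ k) by (rewrite -!Rpow_mult_distr; f_equal; ring).
assert (Ed : (PI ^ 2 / 4) ^ k = (PI ^ 2) ^ k * / 4 ^ k) by (unfold Rdiv; rewrite Rpow_mult_distr pow_inv; reflexivity).
rewrite Ef E4 EP E16 Ed addn1; change ((-1) ^ k.+1) with (-1 * (-1) ^ k).
assert (K0 : INR k <> 0) by (apply not_0_INR; lia).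
assert (P4 : 4 ^ k <> 0) by (apply pow_nonzero; lra).
generalize ((PI ^ 2) ^ k); intros X; field; repeat split; try assumption; lra.
Qed.

(** The product side is d_k F_1^k, so the weight-two limit, raised to the k-th power, settles every
    weight. *)
Lemma q_prod_lim_to_1 k : (1 <= k)%N ->
  lim_to_1 (fun q => (1 - q ^ 2) ^ (2 * k)%N * (q ^ k * RtoC (d_coef k) * q_prod k q))%C
    (RtoC (d_coef k * (PI ^ 2 / 4) ^ k)).
Proof.
intros Hk; apply lim_to_1_Clim; intros M.
rewrite RtoC_mult RtoC_pow.
apply (Clim_ext _ (fun q => RtoC (d_coef k) * ((1 - q ^ 2) ^ 2 * q_series 1 q) ^ k)%C).
- generalize (within_disk_small M 1 Rlt_0_1); apply filter_imp; intros q [[Hq _] _].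
  destruct (q_prod_q_series k q Hq) as [_ E].
  rewrite Cpow_mult_l -E -Cpow_muln; ring.
- apply (Clim_mult (within_disk_to_1 M)); [apply (Clim_const (within_disk_to_1 M))|].
  apply (Clim_pow (within_disk_to_1 M)), q_series_1_lim.
Qed.

Theorem theorem3p2 :
  forall k : nat, (1 <= k)%N -> odd k ->
  (* the identity, for every q in the unit disk *)
  (forall q : C, Cmod q < 1 ->
     Cis_series (series_term k q) (q_series k q) /\
     Cis_prod (prod_term k q) (q_prod k q) /\
     (q_series k q - Tq k q = q ^ k * RtoC (d_coef k) * q_prod k q)%C) /\
  is_int_poly_of_degree (4 * k - 2)%N (Po k) /\
  cusp_form (2 * k)%N (Gamma0 4) (T2k k) /\
  lim_to_1 (Tq k) (RtoC 0) /\
  (* q-analogue of Euler's formula: after multiplication by (1 - q^2)^(2k), the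
     two sides of the identity tend, as q -> 1, to the same nonzero multiple of
     the two sides of Euler's formula *)
  (let euler := (-1) ^ (k + 1)%N * 2 ^ (2 * k)%N * bernoulli (2 * k)%N
                * PI ^ (2 * k)%N / (2 * INR (2 * k)`!) in
   let c := (4 ^ k - 1) * INR (2 * k - 1)`! / 2 in
   lim_to_1 (fun q => (1 - q ^ 2) ^ (2 * k)%N * (q_series k q - Tq k q))%C
            (RtoC (c * zeta (2 * k)%N)) /\
   lim_to_1 (fun q => (1 - q ^ 2) ^ (2 * k)%N
                      * (q ^ k * RtoC (d_coef k) * q_prod k q))%C
            (RtoC (c * euler)) /\
   c <> 0 /\
   zeta (2 * k)%N = euler).
Proof.
intros k Hk Hodd.
(* [Tq] is by definition the difference of series and product, so the identity is formal; the
   content of the first clause is convergence. *)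
assert (I : forall q, (q_series k q - Tq k q = q ^ k * RtoC (d_coef k) * q_prod k q)%C).
{ intros q; unfold Tq; ring. }
split; [|split; [|split; [|split]]].
- intros q Hq; split; [apply q_series_is_series; assumption|split; [apply q_prod_q_series, Hq|apply I]].
- apply Po_int_poly, Hk.
- apply T2k_cusp_form; assumption.
- apply Tq_lim_to_1; assumption.
- intros euler c; pose proof (zeta_even k Hk) as Z; fold euler in Z.
  assert (L : lim_to_1 (fun q => (1 - q ^ 2) ^ (2 * k)%N * (q ^ k * RtoC (d_coef k) * q_prod k q))%C (RtoC (c * euler))).
  { unfold c, euler; rewrite -euler_lim_const //; apply q_prod_lim_to_1, Hk. }
  split; [|split; [exact L|split; [|exact Z]]].
  (* Both sides of the identity are the same function of [q], and Euler's formula identifies the two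
     limit values. *)
  + rewrite Z; intros M; refine (filterlim_ext _ _ _ (L M)); intros q; rewrite I; reflexivity.
  + assert (F4 : 4 <= 4 ^ k) by (rewrite -{1}(pow_1 4); apply Rle_pow; [lra|lia]).
    pose proof (INR_fact_gt0 (2 * k - 1)%N); unfold c.
    apply Rgt_not_eq, Rdiv_lt_0_compat; [apply Rmult_lt_0_compat; lra|lra].
Qed.
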